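(* Let $n\ge 1$, $0<\alpha<2n$, $1<p,q<\infty$, $1\le r<\infty$, with $\frac{\alpha}{n}<\frac1p+\frac1q$ and $\frac1r=\frac1p+\frac1q-\frac{\alpha}{n}$. Let $T_\alpha$ be a bilinear operator of the form $$T_\alpha(f,g)(x)=\int_{\mathbb R^{2n}}K_\alpha(x,y,z)f(y)g(z)\,dy\,dz,$$ whose kernel $K_\alpha$, defined on $\mathbb R^{3n}$ away from the diagonal $\{x=y=z\}$, satisfies for some constant $C>0$ $$|K_\alpha(x,y,z)|\le \frac{C}{(|x-y|+|x-z|)^{2n-\alpha}},$$ $$|K_\alpha(x,y,z)-K_\alpha(x+h,y,z)|\le \frac{C|h|}{(|x-y|+|x-z|)^{2n-\alpha+1}},$$ together with the analogous smoothness estimates in the $y$ and $z$ variables. Let $b\in CMO$. Then the commutators $[T_\alpha,b]_1$ and $[T_\alpha,b]_2$ are (jointly) compact bilinear operators from $L^p(\mathbb R^n)\times L^q(\mathbb R^n)$ to $L^r(\mathbb R^n)$.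
   Context: $BMO$ is the space of locally integrable $b$ on $\mathbb R^n$ with $\|b\|_{BMO}=\sup_Q \frac{1}{|Q|}\int_Q|b-b_Q|\,dx<\infty$, the supremum over cubes $Q$, $b_Q$ the average of $b$ over $Q$. $CMO$ denotes the closure of $C_c^\infty(\mathbb R^n)$ in the $BMO$ norm. For a bilinear operator $T$ and a function $b$, the bilinear commutators are $[T,b]_1(f,g)=T(bf,g)-bT(f,g)$ and $[T,b]_2(f,g)=T(f,bg)-bT(f,g)$. The operator $T_\alpha$ is defined by the integral a priori for bounded compactly supported $f,g$ and extends by the same integral formula to a bounded operator $L^p\times L^q\to L^r$ in the stated range. A bilinear operator $T:X\times Y\to Z$ between normed spaces is (jointly) compact if $\{T(x,y):\|x\|_X\le1,\|y\|_Y\le1\}$ is precompact in $Z$. *)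

(* Defs.v *)
From HB Require Import structures.
From mathcomp Require Import all_boot all_order all_algebra.
From mathcomp Require Import all_classical all_reals all_analysis.
Set Implicit Arguments. Unset Strict Implicit. Unset Printing Implicit Defensive.
Import Order.TTheory GRing.Theory Num.Theory.
Import numFieldNormedType.Exports.
Local Open Scope classical_set_scope.
Local Open Scope ring_scope.

Definition Rn (R : realType) (n : nat) := g_sigma_algebraType (@open 'rV[R]_n).
Definition tov {R : realType} {n : nat} (x : Rn R n) : 'rV[R]_n := x.
Definition ofv {R : realType} {n : nat} (x : 'rV[R]_n) : Rn R n := x.

Definition enorm {R : realType} {n : nat} (x : 'rV[R]_n) : R :=
  Num.sqrt (\sum_(i < n) x ord0 i ^+ 2).

(* mu is the Lebesgue measure on (the Borel sets of) R^n: it gives every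
   closed box its volume (this determines a measure on Borel sets uniquely). *)
Definition is_lebesgue {R : realType} {n : nat}
    (mu : {measure set (Rn R n) -> \bar R}) : Prop :=
  forall a b : 'rV[R]_n, (forall i, a ord0 i <= b ord0 i) ->
    mu [set x | forall i, a ord0 i <= tov x ord0 i <= b ord0 i]
    = (\prod_(i < n) (b ord0 i - a ord0 i))%:E.

Definition cube {R : realType} {n : nat} (a : 'rV[R]_n) (l : R) : set (Rn R n) :=
  [set x | forall i, a ord0 i <= tov x ord0 i <= a ord0 i + l].

Definition is_cube {R : realType} {n : nat} (Q : set (Rn R n)) : Prop :=
  exists a l, 0 < l /\ Q = cube a l.

Section BMO.
Context {R : realType} {n : nat} (mu : {measure set (Rn R n) -> \bar R}).

Definition avg (Q : set (Rn R n)) (b : Rn R n -> R) : R :=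
  (fine (mu Q))^-1 * fine (\int[mu]_(x in Q) (b x)%:E)%E.

Definition mean_osc (Q : set (Rn R n)) (b : Rn R n -> R) : R :=
  (fine (mu Q))^-1 * fine (\int[mu]_(x in Q) (`|b x - avg Q b|)%:E)%E.

Definition locally_integrable (b : Rn R n -> R) : Prop :=
  forall Q, is_cube Q -> mu.-integrable Q (EFin \o b).

Definition BMO (b : Rn R n -> R) : Prop :=
  locally_integrable b /\ exists M : R, forall Q, is_cube Q -> mean_osc Q b <= M.

End BMO.

Fixpoint iter_dir {R : realType} {n : nat} (vs : seq 'rV[R]_n)
    (f : 'rV[R]_n -> R) : 'rV[R]_n -> R :=
  match vs with
  | [::] => f
  | v :: vs' => 'D_v (iter_dir vs' f)
  end.

Definition smooth {R : realType} {n : nat} (f : 'rV[R]_n -> R) : Prop :=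
  forall vs : seq 'rV[R]_n, continuous (iter_dir vs f) /\
    forall x v, derivable (iter_dir vs f) x v.

Definition compact_support {R : realType} {n : nat} (f : 'rV[R]_n -> R) : Prop :=
  compact (closure [set x | f x != 0]).

Definition CMO {R : realType} {n : nat} (mu : {measure set (Rn R n) -> \bar R})
    (b : Rn R n -> R) : Prop :=
  BMO mu b /\ forall eps : R, 0 < eps -> exists phi : 'rV[R]_n -> R,
    smooth phi /\ compact_support phi /\
    forall Q, is_cube Q -> mean_osc mu Q (fun x => b x - phi (tov x)) <= eps.

Definition inL {R : realType} {n : nat} (mu : {measure set (Rn R n) -> \bar R})
    (p : R) (f : Rn R n -> R) : Prop :=
  measurable_fun setT f /\ (Lnorm mu p%:E (EFin \o f) < +oo)%E.

Definition Top {R : realType} {n : nat} (mu : {measure set (Rn R n) -> \bar R})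
    (K : Rn R n -> Rn R n -> Rn R n -> R) (f g : Rn R n -> R) (x : Rn R n) : R :=
  fine (\int[(mu \x mu)%E]_yz (K x yz.1 yz.2 * f yz.1 * g yz.2)%:E)%E.

Definition comm1 {R : realType} {n : nat} (mu : {measure set (Rn R n) -> \bar R})
    K (b f g : Rn R n -> R) : Rn R n -> R :=
  fun x => Top mu K (fun y => b y * f y) g x - b x * Top mu K f g x.

Definition comm2 {R : realType} {n : nat} (mu : {measure set (Rn R n) -> \bar R})
    K (b f g : Rn R n -> R) : Rn R n -> R :=
  fun x => Top mu K f (fun z => b z * g z) x - b x * Top mu K f g x.

Definition compact_bilinear {R : realType} {n : nat}
    (mu : {measure set (Rn R n) -> \bar R}) (p q r : R)
    (B : (Rn R n -> R) -> (Rn R n -> R) -> (Rn R n -> R)) : Prop :=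
  (forall f g, inL mu p f -> inL mu q g ->
     (Lnorm mu p%:E (EFin \o f) <= 1)%E -> (Lnorm mu q%:E (EFin \o g) <= 1)%E ->
     inL mu r (B f g)) /\
  (forall fs gs : nat -> Rn R n -> R,
     (forall k, inL mu p (fs k) /\ (Lnorm mu p%:E (EFin \o fs k) <= 1)%E) ->
     (forall k, inL mu q (gs k) /\ (Lnorm mu q%:E (EFin \o gs k) <= 1)%E) ->
     exists phi : nat -> nat, (forall k, (phi k < phi k.+1)%N) /\
     exists h, inL mu r h /\
       (fun k => Lnorm mu r%:E (EFin \o (B (fs (phi k)) (gs (phi k)) \- h)))
         @ \oo --> 0%E).

Definition dist3 {R : realType} {n : nat} (x y z : Rn R n) : R :=
  enorm (tov x - tov y) + enorm (tov x - tov z).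

Definition offdiag {R : realType} {n : nat} (x y z : Rn R n) : Prop :=
  ~ (x = y /\ x = z).

Definition maxd {R : realType} {n : nat} (x y z : Rn R n) : R :=
  Num.max (enorm (tov x - tov y)) (enorm (tov x - tov z)).

Definition frac_kernel {R : realType} {n : nat} (alpha C : R)
    (K : Rn R n -> Rn R n -> Rn R n -> R) : Prop :=
  (forall x y z, offdiag x y z ->
     `|K x y z| <= C / dist3 x y z `^ (2 * n%:R - alpha)) /\
  (forall x y z (h : 'rV[R]_n), offdiag x y z -> enorm h <= maxd x y z / 2 ->
     `|K x y z - K (ofv (tov x + h)) y z|
       <= C * enorm h / dist3 x y z `^ (2 * n%:R - alpha + 1)) /\
  (forall x y z (h : 'rV[R]_n), offdiag x y z -> enorm h <= maxd x y z / 2 ->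
     `|K x y z - K x (ofv (tov y + h)) z|
       <= C * enorm h / dist3 x y z `^ (2 * n%:R - alpha + 1)) /\
  (forall x y z (h : 'rV[R]_n), offdiag x y z -> enorm h <= maxd x y z / 2 ->
     `|K x y z - K x y (ofv (tov z + h))|
       <= C * enorm h / dist3 x y z `^ (2 * n%:R - alpha + 1)).

(* Main.v *)
(** Write [1/r = 1/p1 + 1/q1] with [1/p1 = 1/p - a1/n], [1/q1 = 1/q - a2/n] and
    [a1 + a2 = alpha].  The size bound on [K] dominates the first commutator by the
    product of [J_w f] and [J g], where [J] is the Riesz potential of order [a2] and
    [J_w] the Riesz potential of order [a1] weighted by [w(x, y) = |b x - b y|].  The
    norm of [J_w] from [L^p] to [L^p1] is at most a multiple of the BMO norm of [b]:
    in a dyadic decomposition of the dual bilinear form only [L^s] averages over cubes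
    occur, with [s > 1] close to [1], and the John-Nirenberg inequality handles the
    weight.  Up to an operator of small norm, [b] is therefore a test function [phi].
    For [phi], cut the kernel off near the diagonal, freeze [x] at the corners of a fine
    grid of half-open cubes [Q] in a large box, and estimate the part outside the box by
    a potential of slightly larger order.  This approximates the commutator in [L^r] by
    finite sums of [c_Q 1_Q], on a fixed grid and with coefficients bounded uniformly in
    the unit balls, and precompactness follows.  The second commutator is the first one
    for the kernel [K(x, z, y)]. *)

Require Import Defs.
From HB Require Import structures.
From mathcomp Require Import all_boot all_order all_algebra.
From mathcomp Require Import all_classical all_reals all_analysis.
From mathcomp Require Import measurable_realfun.
From mathcomp Require Import ring lra.
Import Order.TTheory GRing.Theory Num.Theory.
Import numFieldNormedType.Exports.
Local Open Scope classical_set_scope.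
Local Open Scope ring_scope.
Set Implicit Arguments. Unset Strict Implicit. Unset Printing Implicit Defensive.

(** * Cubes and Lebesgue measure *)

(** The weight [|b x - b y|] is unbounded, so [J_w] is not comparable with the plain potential
    pointwise; it is handled through its bilinear form, scale by scale. The part of the kernel at
    distance about [t] is averaged over all cubes of side [2 t] rather than over a dyadic grid,
    because a grid can separate close points. On one cube the weight costs one Hoelder inequality,
    hence averages in [L^s] with [s > 1]. The sum over scales has to give back exactly [L^p]: [f] is
    measured through [min (v^s, v^a)] with [v = t^(n/p) f] and [s < p < a], whose contributions
    decay geometrically on both sides of [v = 1] and add up to a multiple of [f^p] at every point.
    Strong type bounds follow with neither maximal functions nor interpolation.

    Compactness is not tested by equicontinuity of the image: with a grid independent of [f] and
    [g], finitely many bounded coefficients carry all the information. This is where the commutator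
    matters: near the diagonal [phi y - phi x] gains a factor [|x - y|], and for [x] far from the
    support of [phi] the variable [y] is confined to that support. *)

Section euclidean_space.
Context {R : realType} {n : nat}.
Implicit Types (a u : 'rV[R]_n) (l t : R).

Lemma measurable_continuous (f : 'rV[R]_n -> R) : continuous f ->
  measurable_fun setT (fun x : Rn R n => f (tov x)).
Proof.
move=> cf; apply: (measurability _ (RGenOpens.measurableE R)) => _ [_ [a [b ->]] <-].
rewrite setTI; apply: sub_sigma_algebra.
by move/continuousP : cf => cf; exact/cf/interval_open.
Qed.

Lemma measurable_coord i : measurable_fun setT (fun x : Rn R n => tov x ord0 i).
Proof.
apply: (@measurable_continuous (fun x : 'rV[R]_n => x ord0 i)).
exact: coord_continuous.
Qed.

(** Half-open, unlike [cube], so that the pieces of a subdivision are disjoint and no face is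
    counted twice. *)
Definition hcube a l : set (Rn R n) :=
  [set x | forall i, a ord0 i <= tov x ord0 i < a ord0 i + l].

Lemma measurable_box (P : 'I_n -> set R) : (forall i, measurable (P i)) ->
  measurable [set x : Rn R n | forall i, P i (tov x ord0 i)].
Proof.
move=> mP; rewrite (_ : [set x | _] =
    \bigcap_i ((fun x : Rn R n => tov x ord0 i) @^-1` P i)).
  apply: fin_bigcap_measurable => // i _; rewrite -[X in measurable X]setTI.
  exact: measurable_coord.
by apply/seteqP; split=> [x H i _|x H i]; exact: (H i).
Qed.

Lemma measurable_cube a l : measurable (cube a l : set (Rn R n)).
Proof.
rewrite (_ : cube a l = [set x : Rn R n | forall i,
  [set` `[a ord0 i, a ord0 i + l]] (tov x ord0 i)]); last first.
  by apply/seteqP; split=> x /= H i; move: (H i); rewrite in_itv.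
by apply: (@measurable_box (fun i => `[a ord0 i, a ord0 i + l]%classic)) => i; exact: measurable_itv.
Qed.

Lemma measurable_hcube a l : measurable (hcube a l).
Proof.
rewrite (_ : hcube a l = [set x : Rn R n | forall i,
  [set` `[a ord0 i, a ord0 i + l[] (tov x ord0 i)]); last first.
  by apply/seteqP; split=> x /= H i; move: (H i); rewrite in_itv.
by apply: (@measurable_box (fun i => `[a ord0 i, a ord0 i + l[%classic)) => i; exact: measurable_itv.
Qed.

Lemma sub_hcube_cube a l : hcube a l `<=` cube a l.
Proof. by move=> x xa i; have /andP[-> /ltW] := xa i. Qed.

(** Corner of the cell [m] when each side is cut in [M]: dyadic children for [M = 2], the grid of
    the final approximation for general [M]. *)
Definition subcorner M a l (m : {ffun 'I_n -> 'I_M}) : 'rV[R]_n :=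
  \row_i (a ord0 i + (m i)%:R * (l / M%:R)).

Lemma hcube_subdiv M a l (x : Rn R n) : (0 < M)%N -> 0 < l ->
  hcube a l x <-> exists m : {ffun 'I_n -> 'I_M}, hcube (subcorner a l m) (l / M%:R) x.
Proof.
move=> M0 l0; have M0' : 0 < M%:R :> R by rewrite ltr0n.
split=> [H|[m H] i]; last first.
  have /andP[] := H i; rewrite mxE => H1 H2; apply/andP; split.
    by apply: le_trans H1; rewrite lerDl mulr_ge0 // divr_ge0 // ltW.
  apply: lt_le_trans H2 _; rewrite -addrA lerD2l -[X in _ + X]mul1r -mulrDl natr1 mulrA.
  by rewrite ler_pdivrMr // [leLHS]mulrC ler_pM2l // ler_nat.
have key i : exists k : 'I_M, k%:R * (l / M%:R) <= tov x ord0 i - a ord0 i < (k%:R + 1) * (l / M%:R).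
  have /andP[H1 H2] := H i.
  set y := (tov x ord0 i - a ord0 i) / (l / M%:R).
  have lM : 0 < l / M%:R by rewrite divr_gt0.
  have y0 : 0 <= y by rewrite divr_ge0 ?(ltW lM) // subr_ge0.
  have yM : y < M%:R.
    by rewrite ltr_pdivrMr // mulrCA divff ?gt_eqF // mulr1 ltrBlDl.
  have /andP[k1 k2] : (Num.truncn y)%:R <= y < (Num.truncn y).+1%:R by exact: truncn_itv.
  have kM : (Num.truncn y < M)%N by rewrite -(ltr_nat R); exact: le_lt_trans k1 yM.
  exists (Ordinal kM) => /=; rewrite -ler_pdivlMr // -ltr_pdivrMr //.
  by rewrite k1 /= natr1.
have [m Hm] := choice key.
exists [ffun i => m i] => i; rewrite mxE ffunE.
have /andP[] := Hm i; rewrite lerBrDl ltrBlDl mulrDl mul1r addrA => -> ->; done.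
Qed.

Lemma hcube_subdiv_inj M a l (x : Rn R n) (m m' : {ffun 'I_n -> 'I_M}) :
  (0 < M)%N -> 0 < l -> hcube (subcorner a l m) (l / M%:R) x ->
  hcube (subcorner a l m') (l / M%:R) x -> m = m'.
Proof.
move=> M0 l0 H H'; have M0' : 0 < M%:R :> R by rewrite ltr0n.
have lM : 0 < l / M%:R by rewrite divr_gt0.
apply/ffunP => i; apply/val_inj => /=; apply/eqP.
have := H i; have := H' i; rewrite !mxE => /andP[h1 h2] /andP[h3 h4].
have := le_lt_trans h3 h2; have := le_lt_trans h1 h4.
have E (k : R) : a ord0 i + k * (l / M%:R) + l / M%:R = a ord0 i + (k + 1) * (l / M%:R).
  by rewrite mulrDl mul1r addrA.
rewrite !E !ltrD2l.
by rewrite !ltr_pM2r // !natr1 !ltr_nat !ltnS eqn_leq => -> ->.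
Qed.

Section lebesgue.
Context (mu : {measure set (Rn R n) -> \bar R}) (Hmu : is_lebesgue mu).

Lemma mu_cube a l : 0 <= l -> mu (cube a l) = (l ^+ n)%:E.
Proof.
move=> l0; have := Hmu (a := a) (b := \row_i (a ord0 i + l)).
rewrite (_ : [set x | _] = cube a l); last first.
  by apply/seteqP; split=> x /= H i; move: (H i); rewrite mxE.
move=> -> ; last by move=> i; rewrite mxE lerDl.
congr EFin; rewrite (eq_bigr (fun=> l)) ?prodr_const ?card_ord //.
by move=> i _; rewrite mxE addrAC subrr add0r.
Qed.

(** The difference lies in the union of the upper faces; each is a closed box with one side of
    length 0, so [Hmu] gives it measure 0. *)
Lemma mu_cube_boundary a l : 0 <= l -> mu (cube a l `\` hcube a l) = 0%E.
Proof.
move=> l0; pose face (i : 'I_n) : set (Rn R n) :=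
  [set x | forall j, (\row_k (if k == i then a ord0 k + l else a ord0 k)) ord0 j <=
     tov x ord0 j <= (\row_k (a ord0 k + l)) ord0 j].
have mface i : measurable (face i).
  rewrite (_ : face i = [set x : Rn R n | forall j,
    [set` `[(\row_k (if k == i then a ord0 k + l else a ord0 k)) ord0 j,
         (\row_k (a ord0 k + l)) ord0 j]] (tov x ord0 j)]); last first.
    by apply/seteqP; split=> x /= H j; move: (H j); rewrite in_itv.
  by apply: (@measurable_box (fun j => `[(\row_k (if k == i then a ord0 k + l else a ord0 k)) ord0 j,
    (\row_k (a ord0 k + l)) ord0 j]%classic)) => j; exact: measurable_itv.
have face0 i : mu (face i) = 0%E.
  rewrite Hmu => [|j].
    by rewrite (bigD1 i) //= !mxE eqxx subrr mul0r.
  by rewrite !mxE; case: ifP => // _; rewrite lerDl.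
apply: measure_negligible.
  by apply: measurableD; [exact: measurable_cube | exact: measurable_hcube].
(* The union is indexed by the naturals; [insub] sends the indices from [n] on to the empty set. *)
apply: (@negligibleS _ _ _ _ (\bigcup_k (if insub k is Some i then face i else set0))).
  move=> x [xc xh]; have /existsNP[i xi] := xh; exists (val i) => //; rewrite valK => j.
  rewrite !mxE; have /andP[h1 h2] := xc j; rewrite h2 andbT; case: eqP => // ji; subst j.
  by rewrite leNgt; apply/negP => h3; apply: xi; rewrite h1.
apply: negligible_bigcup => k; case: insub => [i|]; last exact: negligible_set0.
by exists (face i); split => //; exact: mface.
Qed.

Lemma mu_hcube a l : 0 <= l -> mu (hcube a l) = (l ^+ n)%:E.
Proof.
move=> l0; rewrite -(mu_cube a l0) -[in RHS](setDKU (@sub_hcube_cube a l)).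
have mB : measurable (cube a l `\` hcube a l : set (Rn R n)).
  by apply: measurableD; [exact: measurable_cube | exact: measurable_hcube].
have E : mu (cube a l `\` hcube a l `|` hcube a l) =
    (mu (cube a l `\` hcube a l) + mu (hcube a l))%E.
  exact: measureU (measurable_hcube a l) (setDKI _ _).
by rewrite E mu_cube_boundary // add0e.
Qed.

Lemma ge0_integral_hcube a l (f : Rn R n -> \bar R) : 0 <= l ->
  measurable_fun setT f -> (forall x, 0 <= f x)%E ->
  (\int[mu]_(x in hcube a l) f x = \int[mu]_(x in cube a l) f x)%E.
Proof.
move=> l0 mf f0.
rewrite (@ge0_negligible_integral _ _ _ mu (cube a l) (cube a l `\` hcube a l)) //.
- by rewrite setDD (setIidr (@sub_hcube_cube a l)).
- by apply: measurableD; [exact: measurable_cube | exact: measurable_hcube].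
- exact: measurable_cube.
- exact: measurable_funTS.
- exact: mu_cube_boundary.
Qed.

(** A point is a cube of side 0. For [n = 0] its volume would be the empty product 1, hence the
    hypothesis. *)
Lemma mu_point (x : Rn R n) : (0 < n)%N -> mu [set x] = 0%E.
Proof.
move=> n0; rewrite (_ : [set x] = cube (tov x) 0); last first.
  apply/seteqP; split=> [y ->|y /= H]; first by move=> i; rewrite addr0 lexx.
  by apply/rowP => i; apply/eqP; rewrite eq_le; have := H i; rewrite addr0 andbC.
by rewrite mu_cube // expr0n eqn0Ngt n0.
Qed.

Lemma lebesgue_sigma_finite : sigma_finite setT mu.
Proof.
exists (fun k => cube (\row_i (- k%:R)) (2 * k%:R)) => [|k].
  apply/seteqP; split=> // x _.
  exists (Num.truncn `|tov x|).+1 => // i; rewrite mxE.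
  have h : `|tov x ord0 i| <= (Num.truncn `|tov x|).+1%:R.
    apply: (@le_trans _ _ `|tov x|); last exact/ltW/truncnS_gt.
    by rewrite [leRHS]/Num.norm /= mx_normrE; apply: (le_bigmax _ _ (ord0, i)).
  by move: h; rewrite ler_norml => /andP[h1 h2]; lra.
by split; [exact: measurable_cube | rewrite mu_cube ?ltry // mulr_ge0].
Qed.

Lemma ge0_integral_subdiv M a l (f : Rn R n -> \bar R) : (0 < M)%N -> 0 < l ->
  measurable_fun setT f -> (forall x, 0 <= f x)%E ->
  (\int[mu]_(x in hcube a l) f x =
   \sum_(m : {ffun 'I_n -> 'I_M}) \int[mu]_(x in hcube (subcorner a l m) (l / M%:R)) f x)%E.
Proof.
move=> M0 l0 mf f0.
rewrite (_ : hcube a l = \big[setU/set0]_(m <- index_enum {ffun 'I_n -> 'I_M})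
   hcube (subcorner a l m) (l / M%:R)).
  rewrite ge0_integral_bigsetU //.
  - by move=> m; exact: measurable_hcube.
  - exact: index_enum_uniq.
  - move=> m m' _ _ [x [h1 h2]]; exact: (hcube_subdiv_inj M0 l0 h1 h2).
  - exact: measurable_funTS.
rewrite -bigcup_seq; apply/seteqP; split=> x.
  by move/(hcube_subdiv _ _ M0 l0) => [m xm]; exists m => //=; rewrite mem_index_enum.
by move=> [m _ xm]; apply/(hcube_subdiv _ _ M0 l0); exists m.
Qed.
End lebesgue.
End euclidean_space.

(** * Powers, Hoelder's inequality and duality *)

Section real_powers.
Context {R : realType}.
Implicit Types (x y p q s : R).

Lemma ler_powRl x y p : 0 <= p -> 0 <= x -> x <= y -> x `^ p <= y `^ p.
Proof.
by move=> p0 x0 xy; apply: ge0_ler_powR => //; rewrite nnegrE // (le_trans x0).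
Qed.

Lemma powR_exprn x p (j : nat) : 0 <= x -> (x ^+ j) `^ p = (x `^ p) ^+ j.
Proof.
by move=> x0; rewrite -(powR_mulrn j x0) -(powR_mulrn j (powR_ge0 x p)) -!powRrM mulrC.
Qed.

Lemma powRK x p : 0 <= x -> p != 0 -> (x `^ p) `^ p^-1 = x.
Proof. by move=> x0 p0; rewrite -powRrM divff // powRr1. Qed.

Lemma powRVK x p : 0 <= x -> p != 0 -> (x `^ p^-1) `^ p = x.
Proof. by move=> x0 p0; rewrite -powRrM mulVf // powRr1. Qed.

Lemma powR_add_le x y p : 0 <= x -> 0 <= y -> 0 <= p ->
  (x + y) `^ p <= 2 `^ p * (x `^ p + y `^ p).
Proof.
move=> x0 y0 p0; wlog xy : x y x0 y0 / x <= y.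
  move=> H; have [/H|/ltW/H] := leP x y; first exact.
  by rewrite addrC [x `^ p + _]addrC; exact.
apply: (@le_trans _ _ ((2 * y) `^ p)).
  by apply: ler_powRl => //; [exact: addr_ge0|lra].
by rewrite powRM // ler_wpM2l ?powR_ge0 // lerDr powR_ge0.
Qed.

Lemma powR_le_exp x p q : 0 <= x <= 1 -> 0 < p -> p <= q -> x `^ q <= x `^ p.
Proof.
move=> /andP[x0 x1] p0 pq; move: x0; rewrite le_eqVlt => /predU1P[<-|x0].
  by rewrite !powR0 ?gt_eqF // (lt_le_trans p0).
rewrite -(subrK p q) powRD; last by rewrite (gt_eqF x0) implybT.
rewrite ler_piMl ?powR_ge0 //; apply: (@le_trans _ _ (1 `^ (q - p))); last by rewrite powR1.
by apply: ler_powRl; rewrite ?subr_ge0 // ltW.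
Qed.

(** Both [x / (x + y)] and [y / (x + y)] lie in [[0, 1]], where a power [s >= 1] decreases them, and
    the two fractions add up to 1. *)
Lemma powR_superadd x y s : 0 <= x -> 0 <= y -> 1 <= s ->
  x `^ s + y `^ s <= (x + y) `^ s.
Proof.
move=> x0 y0 s1.
have [xy0|xy0] := eqVneq (x + y) 0.
  have [-> ->] : x = 0 /\ y = 0 by split; lra.
  by rewrite addr0 powR0 ?addr0 // gt_eqF //; lra.
have xy : 0 < x + y by rewrite lt0r xy0 addr_ge0.
have key z : 0 <= z -> z <= x + y -> z `^ s <= (x + y) `^ s * (z / (x + y)).
  move=> z0 zxy; have zd : 0 <= z / (x + y) by rewrite divr_ge0 // ltW.
  rewrite (_ : z `^ s = (x + y) `^ s * (z / (x + y)) `^ s); last first.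
    by rewrite -powRM ?(ltW xy) // mulrC divfK.
  rewrite ler_pM2l ?powR_gt0 // -[leRHS]powRr1 //.
  by apply: powR_le_exp => //; rewrite zd /= ler_pdivrMr // mul1r.
apply: (le_trans (lerD (key x x0 _) (key y y0 _))); rewrite ?lerDl ?lerDr //.
by rewrite -mulrDr -mulrDl divff // mulr1.
Qed.

End real_powers.

Section holder_duality.
Context d (T : measurableType d) (R : realType) (mu : {measure set T -> \bar R}).
Local Open Scope ereal_scope.
Implicit Types (f g : T -> R) (D : set T).

Lemma measurable_EFin_powR f p D : measurable_fun setT f ->
  measurable_fun D (fun x => ((f x) `^ p)%:E).
Proof.
move=> mf; apply/measurable_funTS/measurable_EFinP.
exact: (measurableT_comp (measurable_powR p)).
Qed.

Lemma ge0_integralZ D f (c : R) : measurable D -> measurable_fun setT f ->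
  (forall x, 0 <= f x)%R -> (0 <= c)%R ->
  \int[mu]_(x in D) (c * f x)%:E = c%:E * \int[mu]_(x in D) (f x)%:E.
Proof.
move=> mD mf f0 c0; have f0' x : D x -> 0 <= (f x)%:E by rewrite lee_fin.
have mf' : measurable_fun D (EFin \o f) by exact/measurable_funTS/measurable_EFinP.
have c0' : 0 <= c%:E by rewrite lee_fin.
by rewrite -(ge0_integralZl mu mD mf' f0' c0').
Qed.

Lemma le_integralR D f g : measurable D -> measurable_fun setT f ->
  measurable_fun setT g -> (forall x, 0 <= f x)%R ->
  (forall x, D x -> f x <= g x)%R ->
  \int[mu]_(x in D) (f x)%:E <= \int[mu]_(x in D) (g x)%:E.
Proof.
move=> mD mf mg f0 fg.
have mf' : measurable_fun D (EFin \o f) by exact/measurable_funTS/measurable_EFinP.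
have mg' : measurable_fun D (EFin \o g) by exact/measurable_funTS/measurable_EFinP.
have f0' x : D x -> 0 <= (EFin \o f) x by rewrite /= lee_fin.
have fg' x : D x -> (EFin \o f) x <= (EFin \o g) x by move=> Dx; rewrite lee_fin fg.
exact: (ge0_le_integral mu mD f0' mf' mg' fg').
Qed.

Lemma ge0_integralDR D f g : measurable D -> measurable_fun setT f ->
  measurable_fun setT g -> (forall x, 0 <= f x)%R -> (forall x, 0 <= g x)%R ->
  \int[mu]_(x in D) (f x + g x)%:E =
  \int[mu]_(x in D) (f x)%:E + \int[mu]_(x in D) (g x)%:E.
Proof.
move=> mD mf mg f0 g0.
have mf' : measurable_fun D (EFin \o f) by exact/measurable_funTS/measurable_EFinP.
have mg' : measurable_fun D (EFin \o g) by exact/measurable_funTS/measurable_EFinP.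
have f0' x : D x -> 0 <= (EFin \o f) x by rewrite /= lee_fin.
have g0' x : D x -> 0 <= (EFin \o g) x by rewrite /= lee_fin.
exact: (ge0_integralD mu mD f0' mf' g0' mg').
Qed.

Lemma Lnorm_leP f (p A : R) : (0 < p)%R -> (0 <= A)%R ->
  Lnorm mu p%:E (EFin \o f) <= A%:E <->
  \int[mu]_x (`|f x| `^ p)%:E <= (A `^ p)%:E.
Proof.
move=> p0 A0.
have E : \int[mu]_x (`|f x| `^ p)%:E = Lnorm mu p%:E (EFin \o f) `^ p.
  by rewrite poweR_Lnorm ?gt_eqF //; apply: eq_integral => x _; rewrite /= poweR_EFin.
have N0 := Lnorm_ge0 mu p%:E (EFin \o f).
have I0 : 0 <= \int[mu]_x (`|f x| `^ p)%:E.
  by apply: integral_ge0 => x _; rewrite lee_fin powR_ge0.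
split=> H.
  rewrite E -poweR_EFin; apply: gt0_ler_poweR => //; first exact: ltW.
    by rewrite in_itv /= N0 leey.
  by rewrite in_itv /= lee_fin A0 leey.
have -> : Lnorm mu p%:E (EFin \o f) = (\int[mu]_x (`|f x| `^ p)%:E) `^ p^-1.
  by rewrite E -poweRrM divff ?gt_eqF // poweRe1.
rewrite -[A in A%:E](@powRK _ _ p) ?gt_eqF // -poweR_EFin.
apply: gt0_ler_poweR => //; first by rewrite invr_ge0 ltW.
  by rewrite in_itv /= I0 leey.
by rewrite in_itv /= lee_fin powR_ge0 leey.
Qed.

Lemma Lnorm_lty f (p : R) : (0 < p)%R ->
  Lnorm mu p%:E (EFin \o f) < +oo <-> \int[mu]_x (`|f x| `^ p)%:E < +oo.
Proof.
move=> p0.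
have -> : \int[mu]_x (`|f x| `^ p)%:E = Lnorm mu p%:E (EFin \o f) `^ p.
  by rewrite poweR_Lnorm ?gt_eqF //; apply: eq_integral => x _; rewrite /= poweR_EFin.
by split=> [/poweR_lty|]; [exact|apply: lty_poweRy; rewrite gt_eqF].
Qed.

Lemma ge0_holder D f g (p q A B : R) : measurable D ->
  measurable_fun setT f -> measurable_fun setT g ->
  (forall x, 0 <= f x)%R -> (forall x, 0 <= g x)%R ->
  (0 < p)%R -> (0 < q)%R -> (p^-1 + q^-1 = 1)%R -> (0 <= A)%R -> (0 <= B)%R ->
  \int[mu]_(x in D) (f x `^ p)%:E <= (A `^ p)%:E ->
  \int[mu]_(x in D) (g x `^ q)%:E <= (B `^ q)%:E ->
  \int[mu]_(x in D) (f x * g x)%:E <= (A * B)%:E.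
Proof.
move=> mD mf mg f0 g0 p0 q0 pq A0 B0 fA gB.
have H (h : T -> R) (r C : R) : (0 < r)%R -> (0 <= C)%R -> (forall x, 0 <= h x)%R ->
    \int[mu]_(x in D) (h x `^ r)%:E <= (C `^ r)%:E ->
    Lnorm mu r%:E (EFin \o (fun x => h x * \1_D x)%R) <= C%:E.
  move=> r0 C0 h0 hC; apply/(Lnorm_leP _ r0 C0).
  apply: le_trans hC; rewrite [leRHS]integral_mkcond le_eqVlt; apply/orP; left.
  apply/eqP; apply: eq_integral => x _; rewrite patchE indicE.
  case: ifPn => xD; first by rewrite mulr1 ger0_norm.
  by rewrite mulr0 normr0 powR0 // gt_eqF.
have mi (h : T -> R) : measurable_fun setT h -> measurable_fun setT (fun x => h x * \1_D x)%R.
  by move=> mh; apply: measurable_funM => //; exact: measurable_indic.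
have := hoelder mu (mi _ mf) (mi _ mg) p0 q0 pq.
rewrite Lnorm1 => hfg; apply: (le_trans _ (le_trans hfg _)); last first.
  rewrite EFinM; apply: lee_pmul; rewrite ?Lnorm_ge0 //; exact: H.
rewrite integral_mkcond le_eqVlt; apply/orP; left; apply/eqP.
apply: eq_integral => x _; rewrite patchE /= indicE.
case: ifPn => xD; first by rewrite !mulr1 ger0_norm // mulr_ge0.
by rewrite !mulr0 normr0.
Qed.


(** An infinite value becomes [k]: the truncations are bounded real functions that increase to the
    given one. *)
Definition trunc_at (k : nat) (y : \bar R) : R := fine (mine y k%:R%:E).

Lemma trunc_at_ge0 k y : 0 <= y -> (0 <= trunc_at k y)%R.
Proof. by move=> y0; rewrite fine_ge0 // le_min y0 lee_fin ler0n. Qed.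

Lemma EFin_trunc_at k y : 0 <= y -> (trunc_at k y)%:E = mine y k%:R%:E.
Proof.
move=> y0; rewrite fineK // ge0_fin_numE; last by rewrite le_min y0 lee_fin ler0n.
by rewrite gt_min ltry orbT.
Qed.

Lemma trunc_at_le k y : 0 <= y -> (trunc_at k y)%:E <= y.
Proof. by move=> y0; rewrite EFin_trunc_at // ge_min lexx. Qed.

Lemma trunc_at_leN k y : 0 <= y -> (trunc_at k y <= k%:R)%R.
Proof. by move=> y0; rewrite -lee_fin EFin_trunc_at // ge_min lexx orbT. Qed.

Lemma measurable_trunc_at k (F : T -> \bar R) : measurable_fun setT F ->
  measurable_fun setT (trunc_at k \o F).
Proof.
move=> mF; apply: (measurableT_comp (f := fine)); first exact: fine_measurable.
by apply: measurable_mine => //; exact: measurable_cst.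
Qed.

Lemma trunc_at_cvg (p : R) y : (0 < p)%R -> 0 <= y ->
  ((trunc_at k y) `^ p)%:E @[k --> \oo] --> y `^ p.
Proof.
move=> p0; case: y => [y| |] // y0.
  apply: cvg_near_cst; near=> k; rewrite poweR_EFin; congr EFin; congr powR.
  rewrite /trunc_at (_ : mine _ _ = y%:E) //; apply/min_idPl; rewrite lee_fin.
  by near: k; exact: nbhs_infty_ger.
rewrite poweRyr ?gt_eqF //; apply/cvgeyPge => A; near=> k.
rewrite /trunc_at (_ : mine _ _ = k%:R%:E) ?lee_fin; last exact/min_idPr/leey.
apply: (@le_trans _ _ ((`|A| `^ p^-1) `^ p)%R).
  by rewrite powRVK ?gt_eqF // ler_norm.
apply: ler_powRl; rewrite ?powR_ge0 ?(ltW p0) //.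
by near: k; exact: nbhs_infty_ger.
Unshelve. all: by end_near. Qed.

(** [F] may be infinite and nothing is known about its integrability, so the extremal function is
    built from [G k], the truncation of [F] at height [k] on [S k]. If [W] is the integral of
    [G k ^ p], testing with [G k ^ (p - 1) / W^(1/q)] gives [W^(1/p) <= A], uniformly in [k], and
    monotone convergence concludes. *)
Lemma Lp_duality (S : (set T)^nat) (F : T -> \bar R) (p q A : R) :
  (forall k, measurable (S k) /\ mu (S k) < +oo) ->
  {homo S : k l / (k <= l)%N >-> (k `<=` l)} -> \bigcup_k S k = setT ->
  measurable_fun setT F -> (forall x, 0 <= F x) ->
  (1 < p)%R -> (1 < q)%R -> (p^-1 + q^-1 = 1)%R -> (0 <= A)%R ->
  (forall h : T -> R, measurable_fun setT h -> (forall x, 0 <= h x)%R ->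
    \int[mu]_x (h x `^ q)%:E <= 1 -> \int[mu]_x (F x * (h x)%:E) <= A%:E) ->
  \int[mu]_x (F x `^ p) <= (A `^ p)%:E.
Proof.
move=> mS ndS ST mF F0 p1 q1 pq A0 H.
have p0 : (0 < p)%R by lra.
have q0 : (0 < q)%R by lra.
pose G k x : R := (trunc_at k (F x) * \1_(S k) x)%R.
have G0 k x : (0 <= G k x)%R by rewrite mulr_ge0 ?trunc_at_ge0 // indicE.
have mG k : measurable_fun setT (G k).
  by apply: measurable_funM; [exact: measurable_trunc_at|
     apply: measurable_indic; have [] := mS k].
have GF k x : (G k x)%:E <= F x.
  rewrite /G indicE; case: (_ \in _); rewrite ?mulr1 ?mulr0 ?F0 //.
  exact: trunc_at_le.
have bnd k : \int[mu]_x (G k x `^ p)%:E <= (A `^ p)%:E.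
  set V := \int[mu]_x _.
  have V0 : 0 <= V by apply: integral_ge0 => x _; rewrite lee_fin powR_ge0.
  have Vfin : V < +oo.
    have [mSk muSk] := mS k.
    apply: (@le_lt_trans _ _ (\int[mu]_x (((k%:R `^ p) * (\1_(S k) x))%:E))).
      apply: ge0_le_integral => //.
      - by move=> x _; rewrite lee_fin powR_ge0.
      - exact: measurable_EFin_powR.
      - by apply/measurable_EFinP/measurable_funM => //; exact: measurable_indic.
      move=> x _; rewrite lee_fin /G indicE.
      case: (_ \in _); rewrite ?mulr1 ?mulr0; last by rewrite powR0 // gt_eqF.
      by apply: ler_powRl; rewrite ?trunc_at_ge0 ?trunc_at_leN ?(ltW p0).
    have mi : measurable_fun setT (\1_(S k) : T -> R) by exact: measurable_indic.
    rewrite (ge0_integralZ measurableT mi (fun x => ltac:(by rewrite indicE)) (powR_ge0 _ _)).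
    by rewrite integral_indic // setIT lte_mul_pinfty // lee_fin powR_ge0.
  have [W [W0 VW]] : exists W : R, (0 <= W)%R /\ V = W%:E.
    by exists (fine V); rewrite fine_ge0 // fineK // ge0_fin_numE.
  rewrite VW lee_fin; move: W0; rewrite le_eqVlt => /predU1P[<-|W0].
    by rewrite powR_ge0.
  (* The norm of [G k ^ (p - 1)] in [L^q], since [(p - 1) q = p]; the case [W = 0] has been set
     aside. *)
  pose c := (W `^ q^-1)%R.
  have c0 : (0 < c)%R by exact: powR_gt0.
  pose h x := (G k x `^ (p - 1) / c)%R.
  have mh : measurable_fun setT h.
    apply: measurable_funM => //.
    exact: (measurableT_comp (measurable_powR _)).
  have Eq : ((p - 1) * q = p)%R.
    have pqE : (q + p = p * q)%R by rewrite -[RHS]mul1r -pq; field; rewrite !gt_eqF.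
    by rewrite mulrBl mul1r -pqE; lra.
  have := H h mh; rewrite {1}/h => /(_ (fun x => divr_ge0 (powR_ge0 _ _) (ltW c0))).
  have -> : \int[mu]_x (h x `^ q)%:E = 1.
    rewrite (eq_integral (fun x => (W^-1 * (G k x `^ p))%:E)); last first.
      move=> x _; congr EFin; rewrite /h powRM ?powR_ge0 ?invr_ge0 ?(ltW c0) //.
      rewrite -powRrM Eq mulrC; congr (_ * _)%R.
      by rewrite -powR_inv1 ?(ltW c0) // -powRrM mulN1r powRN /c powRVK ?ltW ?gt_eqF.
    rewrite ge0_integralZ ?invr_ge0 ?(ltW W0) //; last 2 first.
    - exact: (measurableT_comp (measurable_powR _)).
    - by move=> x; exact: powR_ge0.
    by rewrite -/V VW -EFinM mulVf // gt_eqF.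
  move=> /(_ (lexx _)) HA.
  have : (W / c)%:E <= A%:E.
    apply: le_trans HA.
    have <- : \int[mu]_x (c^-1 * (G k x `^ p))%:E = (W / c)%:E.
      rewrite ge0_integralZ ?invr_ge0 ?(ltW c0) //; last 2 first.
      - exact: (measurableT_comp (measurable_powR _)).
      - by move=> x; exact: powR_ge0.
      by rewrite -/V VW -EFinM mulrC.
    apply: ge0_le_integral => //.
    - by move=> x _; rewrite lee_fin mulr_ge0 ?powR_ge0 // invr_ge0 ltW.
    - apply/measurable_EFinP/measurable_funM => //.
      exact: (measurableT_comp (measurable_powR _)).
    - by apply: emeasurable_funM => //; exact/measurable_EFinP.
    move=> x _; apply: (@le_trans _ _ ((G k x)%:E * (h x)%:E)); last first.
      by apply: lee_wpmul2r => //; rewrite lee_fin divr_ge0 ?powR_ge0 // ltW.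
    rewrite -EFinM lee_fin /h [leRHS]mulrA [leLHS]mulrC ler_wpM2r // ?invr_ge0 ?(ltW c0) //.
    rewrite -[X in (_ <= X * _)%R](@powRr1 _ (G k x)) // -powRD; last first.
      by rewrite addrC subrK gt_eqF.
    by rewrite addrC subrK.
  rewrite lee_fin => WA.
  rewrite -[leLHS](@powRVK _ _ p) ?(ltW W0) ?(gt_eqF p0) //; apply: ler_powRl; rewrite ?powR_ge0 ?(ltW p0) //.
  apply: le_trans WA; rewrite le_eqVlt; apply/orP; left; apply/eqP.
  rewrite /c -[X in _ = (X / _)%R](powRr1 (ltW W0)) -powRB; last first.
    by rewrite (gt_eqF W0) implybT.
  by congr powR; lra.
have cvgG x : ((G k x) `^ p)%:E @[k --> \oo] --> F x `^ p.
  have [k0 _ xS] : (\bigcup_k S k) x by rewrite ST.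
  apply: cvg_trans (trunc_at_cvg p0 (F0 x)); apply: near_eq_cvg; near=> k.
  congr (_ `^ p)%:E; rewrite /G indicE mem_set ?mulr1 //.
  by apply: (ndS k0) => //; near: k; exact: nbhs_infty_ge.
have -> : \int[mu]_x (F x `^ p) = \int[mu]_x (limn (fun k => ((G k x) `^ p)%:E)).
  by apply: eq_integral => x _; apply/esym/cvg_lim => //; exact: cvgG.
have nd x : setT x -> {homo (fun k => ((G k x) `^ p)%:E) : k l / (k <= l)%N >-> k <= l}.
  move=> _ k l kl; rewrite lee_fin; apply: ler_powRl; rewrite ?(ltW p0) //.
  apply: ler_pM; rewrite ?trunc_at_ge0 ?indicE //.
    by rewrite -lee_fin !EFin_trunc_at // le_min !ge_min lexx /= lee_fin ler_nat kl orbT.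
  case: (boolP (x \in S k)) => // /set_mem xS.
  by rewrite mem_set //; exact: (ndS _ _ kl).
have g0 k x : setT x -> 0 <= ((G k x) `^ p)%:E by rewrite lee_fin powR_ge0.
have cv := @cvg_monotone_convergence _ _ _ mu setT measurableT
  (fun k x => ((G k x) `^ p)%:E) (fun k => measurable_EFin_powR p (mG k)) g0 nd.
rewrite -(cvg_lim _ cv) //; apply: lime_le; last by near=> k; exact: bnd.
by apply/cvg_ex; eexists; exact: cv.
Unshelve. all: by end_near. Qed.
End holder_duality.

(** * Precompactness in L^r *)

Lemma cvg_powR (R : realType) (v : R^nat) (c r : R) : 0 < r -> 0 <= c ->
  (forall k, 0 <= v k) -> v @ \oo --> c -> (v k `^ r) @[k --> \oo] --> c `^ r.
Proof.
move=> r0 c0 v0 vc; have rN0 : r != 0 by rewrite gt_eqF.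
apply/cvgrPdist_le => e e0.
have lo : \forall k \near \oo, c `^ r - e <= v k `^ r.
  have [ce|ce] := ltP (c `^ r - e) 0.
    by near=> k; rewrite (le_trans (ltW ce)) ?powR_ge0.
  have h : (c `^ r - e) `^ r^-1 < c.
    rewrite -[ltRHS](@powRK _ _ r) //.
    by apply: gt0_ltr_powR; rewrite ?invr_gt0 ?nnegrE ?powR_ge0 // ltrBlDr ltrDl.
  near=> k; rewrite -[leLHS](@powRVK _ _ r) //.
  apply: ler_powRl; rewrite ?powR_ge0 ?(ltW r0) //.
  by apply/ltW; near: k; exact: (cvgr_gt _ vc).
have hi : \forall k \near \oo, v k `^ r <= c `^ r + e.
  have ce : 0 <= c `^ r + e by rewrite addr_ge0 ?powR_ge0 // ltW.
  have h : c < (c `^ r + e) `^ r^-1.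
    rewrite -[ltLHS](@powRK _ _ r) //.
    by apply: gt0_ltr_powR; rewrite ?invr_gt0 ?nnegrE ?powR_ge0 // ltrDl.
  near=> k; rewrite -[leRHS](@powRVK _ _ r) //.
  apply: ler_powRl; rewrite ?(ltW r0) //.
  by apply/ltW; near: k; exact: (cvgr_lt _ vc).
by near=> k; rewrite ler_distlC; apply/andP; split; near: k.
Unshelve. all: by end_near. Qed.

Section Lr_compactness.
Context d (T : measurableType d) (R : realType) (mu : {measure set T -> \bar R}).
Local Open Scope ereal_scope.

Lemma measurable_norm_powR (f : T -> R) (r : R) : measurable_fun setT f ->
  measurable_fun setT (fun x => `|f x| `^ r)%R.
Proof.
move=> mf; apply: (measurableT_comp (measurable_powR _)).
exact: measurableT_comp.
Qed.

Lemma integral_powR_add_le (f g : T -> R) (r a b : R) : (0 < r)%R ->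
  measurable_fun setT f -> measurable_fun setT g ->
  \int[mu]_x (`|f x| `^ r)%:E <= a%:E -> \int[mu]_x (`|g x| `^ r)%:E <= b%:E ->
  \int[mu]_x (`|f x + g x| `^ r)%:E <= (2 `^ r * (a + b))%:E.
Proof.
move=> r0 mf mg fa gb.
apply: (@le_trans _ _ (\int[mu]_x (2 `^ r * (`|f x| `^ r + `|g x| `^ r))%:E)).
  apply: le_integralR; [exact: measurableT| | |by move=> x; exact: powR_ge0|move=> x _].
  - exact/measurable_norm_powR/measurable_funD.
  - apply/measurable_funM => //.
    by apply: measurable_funD; exact: measurable_norm_powR.
  apply: le_trans (powR_add_le (normr_ge0 (f x)) (normr_ge0 (g x)) (ltW r0)).
  by apply: ler_powRl; rewrite ?(ltW r0) ?ler_normD.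
rewrite ge0_integralZ; [|exact: measurableT
  |by apply: measurable_funD; exact: measurable_norm_powR
  |by move=> x; rewrite addr_ge0 ?powR_ge0|exact: powR_ge0].
rewrite EFinM; apply: lee_wpmul2l; first by rewrite lee_fin powR_ge0.
rewrite ge0_integralDR; [by rewrite EFinD; exact: leeD|exact: measurableT| | | |].
- exact: measurable_norm_powR.
- exact: measurable_norm_powR.
- by move=> x; exact: powR_ge0.
- by move=> x; exact: powR_ge0.
Qed.

(** Riesz-Fischer for a sequence that is Cauchy at a geometric rate: the increments are summable
    almost everywhere, and the rate passes to the limit by Fatou's lemma. *)
Lemma Lr_fast_complete (u : nat -> T -> R) (r : R) : (1 <= r)%R ->
  (forall k, measurable_fun setT (u k)) ->
  (forall k l, (k <= l)%N ->
    \int[mu]_x (`|u l x - u k x| `^ r)%:E <= (((2^-1) ^+ k) `^ r)%:E) ->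
  exists h : T -> R, measurable_fun setT h /\
    forall k, \int[mu]_x (`|u k x - h x| `^ r)%:E <= (((2^-1) ^+ k) `^ r)%:E.
Proof.
move=> r1 mu_ Hu; have r0 : (0 < r)%R by lra.
pose rho k : R := ((2^-1) ^+ k)%R.
have rho0 k : (0 < rho k)%R by rewrite exprn_gt0.
(* Increments up to [rho k] are summable as they stand. A larger increment [v] satisfies
   [v / rho k <= (v / rho k)^r], hence [v <= w k x], and [w k] has integral at most [rho k]. So
   [v <= rho k + w k x] in all cases, which avoids Minkowski's inequality for series. *)
pose w k x : R := (rho k * (`|u k.+1 x - u k x| / rho k) `^ r)%R.
have w0 k x : (0 <= w k x)%R by rewrite mulr_ge0 ?powR_ge0 // ltW.
have mw k : measurable_fun setT (w k).
  apply: measurable_funM => //; apply: (measurableT_comp (measurable_powR _)).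
  apply: measurable_funM => //; apply: measurableT_comp => //.
  exact: measurable_funB.
have iw k : \int[mu]_x (w k x)%:E <= (rho k)%:E.
  rewrite ge0_integralZ; [|exact: measurableT| |by move=> x; exact: powR_ge0|exact: ltW]; last first.
    apply: (measurableT_comp (measurable_powR _)).
    apply: measurable_funM => //; apply: measurableT_comp => //.
    exact: measurable_funB.
  rewrite -[leRHS]mule1; apply: lee_wpmul2l; first by rewrite lee_fin ltW.
  rewrite (eq_integral (fun x => ((rho k `^ r)^-1 * (`|u k.+1 x - u k x| `^ r))%:E)); last first.
    move=> x _; congr EFin; rewrite mulrC powRM ?invr_ge0 ?(ltW (rho0 k)) //.
    by rewrite -powR_inv1 ?(ltW (rho0 k)) // -powRrM mulN1r powRN.
  rewrite ge0_integralZ; [|exact: measurableT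
    |by apply: measurable_norm_powR; exact: measurable_funB
    |by move=> x; exact: powR_ge0|by rewrite invr_ge0 powR_ge0].
  have := Hu k k.+1 (leqnSn k).
  move=> /(lee_wpmul2l (_ : 0 <= ((rho k `^ r)^-1)%:E)); rewrite lee_fin invr_ge0 powR_ge0.
  move=> /(_ isT) /le_trans; apply.
  by rewrite -EFinM mulVf // gt_eqF // powR_gt0.
have Rho n : (\sum_(0 <= k < n) (rho k)%:E <= 2%:R%:E).
  rewrite sumEFin lee_fin.
  have -> : (\sum_(0 <= i < n) rho i = 2 - 2 * (2^-1) ^+ n)%R.
    elim: n => [|n IH]; first by rewrite big_nil expr0; lra.
    by rewrite big_nat_recr //= IH exprS /rho; lra.
  by rewrite gerBl mulr_ge0 // exprn_ge0.
pose S x := \sum_(k <oo) (w k x)%:E.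
have mS : measurable_fun setT S.
  by apply: ge0_emeasurable_sum => [k x _ _|k _]; [rewrite lee_fin|exact/measurable_EFinP].
have iS : \int[mu]_x S x <= 2%:R%:E.
  rewrite /S integral_nneseries //; last 2 first.
  - by move=> k; exact/measurable_EFinP.
  - by move=> k x _; rewrite lee_fin.
  apply: lime_le; first by apply: is_cvg_nneseries => k _ _; apply: integral_ge0 => x _; rewrite lee_fin.
  near=> n; apply: le_trans (Rho n); apply: lee_sum => k _; exact: iw.
have S0 x : 0 <= S x by apply: nneseries_ge0 => k _ _; rewrite lee_fin.
have [N [mN N0 NS]] : {ae mu, forall x, setT x -> S x \is a fin_num}.
  apply: integrable_ae => //; apply/integrableP; split => //.
  under eq_integral do rewrite gee0_abs //.
  exact: le_lt_trans iS (ltry _).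
(* Setting the sequence to 0 on the null set [N] makes it converge everywhere, so that the limit is
   measurable. *)
pose u' k x : R := (u k x * \1_(~` N) x)%R.
have mu' k : measurable_fun setT (u' k).
  by apply: measurable_funM => //; apply: measurable_indic; exact: measurableC.
have cvu x : cvgn (u' ^~ x).
  have [xN|xN] := pselect (N x).
    have -> : u' ^~ x = cst 0%R.
      by apply/funext => k; rewrite /u' indicE memNset ?mulr0 //; exact.
    exact: is_cvg_cst.
  have -> : u' ^~ x = u ^~ x.
    by apply/funext => k; rewrite /u' indicE mem_set ?mulr1.
  have Sx : S x \is a fin_num.
    by apply: contrapT => h; apply: xN; apply: NS => /= /(_ I).
  rewrite (_ : u ^~ x = (fun n => u 0%N x + series (telescope (u ^~ x)) n)%R); last first.
    by apply/funext => n; exact: eq_sum_telescope.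
  apply: is_cvgD; first exact: is_cvg_cst.
  apply: normed_cvg.
  apply: (@series_le_cvg _ _ (fun k => rho k + w k x)%R); [by move=> k; exact: normr_ge0
    |by move=> k; exact: addr_ge0 (ltW (rho0 k)) (w0 k x)| |].
    move=> k; rewrite /telescope /w.
    set v := `|_|%R; have v0 : (0 <= v)%R by exact: normr_ge0.
    have [vr|vr] := leP v (rho k).
      by rewrite (le_trans vr) // lerDl mulr_ge0 ?powR_ge0 // ltW.
    apply: (@le_trans _ _ (rho k * (v / rho k) `^ r))%R; last by rewrite lerDr ltW.
    rewrite -[leLHS](@divfK _ (rho k)) ?gt_eqF // mulrC ler_pM2l //.
    rewrite -[leLHS]powRr1; last by rewrite divr_ge0 // ltW.
    by apply: ler_powR => //; rewrite ler_pdivlMr // mul1r ltW.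
  apply: nondecreasing_is_cvgn.
    apply: nondecreasing_series => k _ _.
    exact: addr_ge0 (ltW (rho0 k)) (w0 k x).
  exists (2 + fine (S x))%R => _ [n _ <-]; rewrite /series /= big_split /=.
  apply: lerD; first by rewrite -lee_fin -sumEFin Rho.
  rewrite -lee_fin fineK // -sumEFin; apply: nneseries_lim_ge => k _ _.
  by rewrite lee_fin.
pose h x : R := limn (u' ^~ x).
have mh : measurable_fun setT h.
  by apply: (measurable_fun_cvg mu') => x _; exact: cvu.
exists h; split => // k.
have ae_u l x : ~ N x -> u' l x = u l x.
  by move=> xN; rewrite /u' indicE mem_set ?mulr1.
have int_eq l : \int[mu]_x (`|u' l x - u' k x| `^ r)%:E = \int[mu]_x (`|u l x - u k x| `^ r)%:E.
  apply: ge0_ae_eq_integral => //.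
  - by apply/measurable_EFinP/measurable_norm_powR/measurable_funB.
  - by apply/measurable_EFinP/measurable_norm_powR/measurable_funB.
  - exists N; split => // x /= /not_implyP[_ ne]; apply: contrapT => xN; apply: ne.
    by rewrite !ae_u.
have -> : \int[mu]_x (`|u k x - h x| `^ r)%:E = \int[mu]_x (`|u' k x - h x| `^ r)%:E.
  apply: ge0_ae_eq_integral => //.
  - by apply/measurable_EFinP/measurable_norm_powR/measurable_funB.
  - by apply/measurable_EFinP/measurable_norm_powR/measurable_funB.
  - exists N; split => // x /= /not_implyP[_ ne]; apply: contrapT => xN; apply: ne.
    by rewrite !ae_u.
have lim x : (`|u' l x - u' k x| `^ r)%:E @[l --> \oo] --> (`|u' k x - h x| `^ r)%:E.
  apply: cvg_EFin; first by near=> l.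
  apply: cvg_powR => //; rewrite distrC; apply: cvg_norm; apply: cvgB; last exact: cvg_cst.
  exact: cvu.
rewrite (eq_integral (fun x => limn_einf (fun l => (`|u' l x - u' k x| `^ r)%:E))); last first.
  by move=> x _; rewrite (cvg_limn_einf_sup (lim x)).1.
apply: le_trans (fatou mu measurableT _ _) _ => //.
- by move=> l; apply/measurable_EFinP/measurable_norm_powR/measurable_funB.
rewrite limn_einf_lim; apply: lime_le; first exact: is_cvg_einfs.
near=> n; apply: (@le_trans _ _ (\int[mu]_x (`|u' (n + k)%N x - u' k x| `^ r)%:E)).
  by apply: ereal_inf_lbound; exists (n + k)%N => //=; exact: leq_addr.
by rewrite int_eq; apply: Hu; exact: leq_addl.
Unshelve. all: by end_near. Qed.
(* The limits of the coefficients along an ultrafilter [U] on the indices take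
   the place of a diagonal extraction of subsequences. *)
Lemma ultra_bounded_cvg (U : set_system nat) (c : nat -> R) (M : R) :
  UltraFilter U -> (forall k, `|c k| <= M)%R ->
  exists l, forall e : R, (0 < e)%R -> U [set k | `|c k - l| < e]%R.
Proof.
move=> UF cM; have PU := @ultra_proper _ _ UF.
have FA : fmap c U [set` `[(- M)%R, M]%R].
  rewrite /fmap /=.
  apply: filterE => k.
  by have := cM k; rewrite ler_norml /preimage /= in_itv.
have [l [_ cl]] := @segment_compact R (- M)%R M (fmap c U) _ FA.
exists l => e e0; have [H|UC] := in_ultra_setVsetC (c @^-1` (ball l e)) UF.
  by apply: filterS H => k; rewrite /ball /= distrC.
have [x [xl1 xl2]] := cl (~` ball l e) (ball l e) UC (nbhsx_ballx l e e0).
by [].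
Qed.

(** For each [eta] the sets [Q i] are fixed and only finitely many bounded coefficients vary. Their
    limits along the ultrafilter [U] define one step function [g_ j] to which [u k] is close for
    [U]-almost every [k]. Picking [phi k] in the sets that belong to [g_ 0, ..., g_ k] gives a
    Cauchy sequence at rate [2^-k]. *)
Lemma Lr_precompact (u : nat -> T -> R) (r : R) : (1 <= r)%R ->
  (forall k, measurable_fun setT (u k)) ->
  (forall k, \int[mu]_x (`|u k x| `^ r)%:E < +oo) ->
  (forall eta : R, (0 < eta)%R -> exists (I : finType) (c : nat -> I -> R)
      (Q : I -> set T) (M : R),
    [/\ forall i, measurable (Q i) /\ mu (Q i) < +oo,
        forall k i, (`|c k i| <= M)%R &
        forall k, \int[mu]_x (`|u k x - \sum_i c k i * \1_(Q i) x| `^ r)%:E <= eta%:E]) ->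
  exists phi : nat -> nat, (forall k, (phi k < phi k.+1)%N) /\
    exists h : T -> R, [/\ measurable_fun setT h, \int[mu]_x (`|h x| `^ r)%:E < +oo &
      forall k, \int[mu]_x (`|u (phi k) x - h x| `^ r)%:E <= (((2^-1) ^+ k) `^ r)%:E].
Proof.
move=> r1 mu_ iu H; have r0 : (0 < r)%R by lra.
(* The triangle inequality costs [2^r] twice, once to replace the coefficients by their limits and
   once to compare two members of the sequence with [g_ j]; four copies of [eta j] then add up to
   [(2^-j)^r]. *)
pose eta (j : nat) : R := (((2^-1) ^+ j) `^ r / (4 * (2 `^ r) * (2 `^ r)))%R.
have eta0 j : (0 < eta j)%R by rewrite divr_gt0 ?mulr_gt0 ?powR_gt0 ?exprn_gt0.
have [U [UF Uoo]] := ultraFilterLemma (@eventually_filter).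
have PU := @ultra_proper _ _ UF.
have key j : exists2 g : T -> R, measurable_fun setT g &
    U [set k | \int[mu]_x (`|u k x - g x| `^ r)%:E <= (2 `^ r * (eta j + eta j))%:E].
  have [I [c [Q [M [mQ cM uc]]]]] := H _ (eta0 j).
  have [l cl] := choice (fun i => ultra_bounded_cvg UF (fun k => cM k i)).
  exists (fun x => \sum_i l i * \1_(Q i) x)%R.
    by apply: measurable_sum => i; apply: measurable_funM => //;
      apply: measurable_indic; have [] := mQ i.
  pose V := \int[mu]_x ((\sum_i \1_(Q i) x) `^ r)%:E.
  have mi : measurable_fun setT (fun x => \sum_i \1_(Q i) x : R)%R.
    by apply: measurable_sum => i; apply: measurable_indic; have [] := mQ i.
  have V0 : 0 <= V by apply: integral_ge0 => x _; rewrite lee_fin powR_ge0.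
  have Vfin : V < +oo.
    pose m : R := #|I|%:R.
    apply: (@le_lt_trans _ _ (\int[mu]_x (m `^ r * \sum_i \1_(Q i) x)%:E)).
      apply: le_integralR; [exact: measurableT| |exact: measurable_funM|by move=> x; exact: powR_ge0|].
        exact: (measurableT_comp (measurable_powR _)).
      move=> x _; have [xQ|xQ] := pselect (exists i, Q i x).
        have [i xi] := xQ.
        apply: (@le_trans _ _ (m `^ r)%R).
          apply: ler_powRl; rewrite ?(ltW r0) //; first by apply: sumr_ge0 => *; rewrite indicE.
          rewrite /m -sum1_card natr_sum; apply: ler_sum => k _; rewrite indicE.
          by case: (_ \in _).
        rewrite ler_peMr ?powR_ge0 // (bigD1 i) //= indicE mem_set // lerDl.
        by apply: sumr_ge0 => *; rewrite indicE.
      rewrite big1 ?powR0 ?mulr0 ?gt_eqF // => i _.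
      by rewrite indicE memNset // => Qix; apply: xQ; exists i.
    rewrite ge0_integralZ; [|exact: measurableT|exact: mi
      |by move=> x; apply: sumr_ge0 => *; rewrite indicE|exact: powR_ge0].
    apply: lte_mul_pinfty; rewrite ?lee_fin ?powR_ge0 //.
    under eq_integral do rewrite -sumEFin.
    rewrite ge0_integral_sum //; last first.
      by move=> i; apply/measurable_EFinP; apply: measurable_indic; have [] := mQ i.
    apply: lte_sum_pinfty => i _; have [mQi Qoo] := mQ i.
    by rewrite integral_indic // setIT.
  have [W [W0 VW]] : exists W : R, (0 <= W)%R /\ V = W%:E.
    by exists (fine V); rewrite fine_ge0 // fineK // ge0_fin_numE.
  (* Makes [e^r W <= eta j]; adding 1 covers [W = 0]. *)
  pose e : R := ((eta j / (W + 1)) `^ r^-1)%R.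
  have e0 : (0 < e)%R by rewrite powR_gt0 // divr_gt0 //; lra.
  have : U [set k | forall i, (`|c k i - l i| < e)%R].
    by apply: filter_forall => i; exact: cl.
  apply: filterS => k /= ck.
  have -> : (fun x => (`|u k x - \sum_i l i * \1_(Q i) x| `^ r)%:E) =
     (fun x => (`|(u k x - \sum_i c k i * \1_(Q i) x) +
        (\sum_i (c k i - l i) * \1_(Q i) x)| `^ r)%:E).
    apply/funext => x; congr ((`| _ | `^ r)%:E).
    have -> : (\sum_i (c k i - l i) * \1_(Q i) x =
        \sum_i c k i * \1_(Q i) x - \sum_i l i * \1_(Q i) x)%R.
      by rewrite -sumrB; apply: eq_bigr => i _; rewrite mulrBl.
    by rewrite addrA subrK.
  have mc (a : I -> R) : measurable_fun setT (fun x => \sum_i a i * \1_(Q i) x)%R.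
    by apply: measurable_sum => i; apply: measurable_funM => //;
      apply: measurable_indic; have [] := mQ i.
  apply: integral_powR_add_le; [exact: r0|exact: measurable_funB|exact: mc|exact: uc|].
  apply: (@le_trans _ _ (\int[mu]_x (e `^ r * (\sum_i \1_(Q i) x) `^ r)%:E)).
    apply: le_integralR; [exact: measurableT|exact: measurable_norm_powR| |by move=> x; exact: powR_ge0|].
      by apply: measurable_funM => //; exact: (measurableT_comp (measurable_powR _)).
    move=> x _; rewrite -powRM ?(ltW e0) //; last by apply: sumr_ge0 => *; rewrite indicE.
    apply: ler_powRl; rewrite ?(ltW r0) //; apply: le_trans (ler_norm_sum _ _ _) _.
    rewrite mulr_sumr; apply: ler_sum => i _; rewrite normrM.
    by apply: ler_pM => //; [exact/ltW|rewrite indicE ger0_norm].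
  rewrite ge0_integralZ; [|exact: measurableT|exact: (measurableT_comp (measurable_powR _))
    |by move=> x; exact: powR_ge0|exact: powR_ge0].
  rewrite -/V VW -EFinM lee_fin /e powRVK ?(gt_eqF r0) //; last by rewrite divr_ge0 ?(ltW (eta0 j)) //; lra.
  rewrite -mulrA ler_piMr ?(ltW (eta0 j)) // mulrC ler_pdivrMr; lra.
have [g_ mg Ug] : exists2 g_ : nat -> T -> R, (forall j, measurable_fun setT (g_ j)) &
    forall j, U [set k | \int[mu]_x (`|u k x - g_ j x| `^ r)%:E <= (2 `^ r * (eta j + eta j))%:E].
  have /choice[g_ Hg] : forall j, exists g : T -> R, measurable_fun setT g /\
    U [set k | \int[mu]_x (`|u k x - g x| `^ r)%:E <= (2 `^ r * (eta j + eta j))%:E].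
    by move=> j; have [g mg Ug] := key j; exists g.
  by exists g_ => j; have [] := Hg j.
(* A finite intersection of sets of [U] with a tail, which [U] contains because it refines the
   filter at infinity, is again in [U] and so is not empty. *)
have nxt k : exists f : nat -> nat, forall N, (N < f N)%N /\ forall j, (j <= k)%N ->
    \int[mu]_x (`|u (f N) x - g_ j x| `^ r)%:E <= (2 `^ r * (eta j + eta j))%:E.
  suff /choice[f Hf] : forall N, exists m, (N < m)%N /\ forall j, (j <= k)%N ->
    \int[mu]_x (`|u m x - g_ j x| `^ r)%:E <= (2 `^ r * (eta j + eta j))%:E by exists f.
  move=> N; have : U [set m | (N < m)%N /\ forall j : 'I_k.+1,
    \int[mu]_x (`|u m x - g_ j x| `^ r)%:E <= (2 `^ r * (eta j + eta j))%:E].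
    apply: filterI; first by apply: Uoo; exact: nbhs_infty_gt.
    by apply: filter_forall => j; exact: Ug.
  move=> /filter_ex[m [Nm Hm]]; exists m; split => // j jk.
  exact: (Hm (Ordinal (jk : (j < k.+1)%N))).
have [pick Hpick] := choice nxt.
pose phi := fix phi k := if k is k'.+1 then pick k (phi k') else pick 0%N 0%N.
have phiP k j : (j <= k)%N ->
    \int[mu]_x (`|u (phi k) x - g_ j x| `^ r)%:E <= (2 `^ r * (eta j + eta j))%:E.
  by case: k => [|k] jk; apply: (Hpick _ _).2.
exists phi; split=> [k|]; first exact: (Hpick _ _).1.
have fast k l : (k <= l)%N ->
    \int[mu]_x (`|u (phi l) x - u (phi k) x| `^ r)%:E <= (((2^-1) ^+ k) `^ r)%:E.
  move=> kl.
  have -> : (((2^-1) ^+ k) `^ r = 2 `^ r * (2 `^ r * (eta k + eta k) + 2 `^ r * (eta k + eta k)))%R.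
    rewrite /eta; have : (0 < 2 `^ r :> R)%R by exact: powR_gt0.
    by move: (2 `^ r)%R => y y0; field; rewrite gt_eqF.
  have -> : (fun x => (`|u (phi l) x - u (phi k) x| `^ r)%:E) =
     (fun x => (`|(u (phi l) x - g_ k x) + (g_ k x - u (phi k) x)| `^ r)%:E).
    by apply/funext => x; rewrite addrA subrK.
  apply: integral_powR_add_le; [exact: r0|exact: measurable_funB|exact: measurable_funB|exact: phiP|].
  under eq_integral do rewrite distrC; exact: phiP.
have [h [mh Hh]] := Lr_fast_complete r1 (fun k => mu_ (phi k)) fast.
exists h; split => //.
have -> : (fun x => (`|h x| `^ r)%:E) = (fun x => (`|u (phi 0%N) x + (h x - u (phi 0%N) x)| `^ r)%:E).
  by apply/funext => x; rewrite addrC subrK.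
apply: le_lt_trans (integral_powR_add_le r0 (mu_ _) (measurable_funB mh (mu_ (phi 0%N)))
   (_ : _ <= (fine (\int[mu]_x (`|u (phi 0%N) x| `^ r)%:E))%:E) _) (ltry _).
  by rewrite fineK // ge0_fin_numE //; apply: integral_ge0 => x _; rewrite lee_fin powR_ge0.
by under eq_integral do rewrite distrC; exact: Hh.
Qed.
End Lr_compactness.

(** * Density of dyadic step functions *)

Section dyadic_steps.
Context {R : realType} {n : nat}.
Implicit Types (a : 'rV[R]_n) (l : R) (g : Rn R n -> R).

Lemma sub_hcube_subdiv a l (m : {ffun 'I_n -> 'I_2}) : 0 < l ->
  hcube (subcorner a l m) (l / 2) `<=` hcube a l.
Proof. by move=> l0 x xm; apply/(hcube_subdiv (M := 2) _ _ _ l0) => //; exists m. Qed.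

(** Constancy on the dyadic subcubes of generation [N], by recursion on the children like the
    stopping argument that uses it. *)
Fixpoint dstep (N : nat) a l g : Prop :=
  if N is N'.+1 then forall m : {ffun 'I_n -> 'I_2}, dstep N' (subcorner a l m) (l / 2) g
  else exists v, forall x, hcube a l x -> g x = v.

Lemma dstep_cst N a l g v : 0 < l -> (forall x, hcube a l x -> g x = v) -> dstep N a l g.
Proof.
elim: N a l => [|N IH] a l l0 gv /=; first by exists v.
by move=> m; apply: IH; [rewrite divr_gt0|move=> x /(sub_hcube_subdiv l0)/gv].
Qed.

Lemma dstep_le N N' a l g : 0 < l -> (N <= N')%N -> dstep N a l g -> dstep N' a l g.
Proof.
elim: N N' a l => [|N IH] N' a l l0; first by move=> _ [v gv]; exact: dstep_cst gv.
case: N' => // N' NN' H m; apply: IH; [by rewrite divr_gt0|exact: NN'|exact: H].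
Qed.

Lemma dstep_op (op : R -> R -> R) N a l g g' : dstep N a l g -> dstep N a l g' ->
  dstep N a l (fun x => op (g x) (g' x)).
Proof.
elim: N a l => [|N IH] a l; last by move=> H H' m; exact: IH.
by move=> [v gv] [v' gv']; exists (op v v') => x xa; rewrite gv ?gv'.
Qed.

(** Inner approximation by dyadic cubes: the union of those of generation [N] that lie in [O]. For
    open [O] it increases with [N] to the part of [O] in the cube. *)
Fixpoint inner (N : nat) a l (O : set (Rn R n)) : set (Rn R n) :=
  if N is N'.+1 then \bigcup_(m : {ffun 'I_n -> 'I_2}) inner N' (subcorner a l m) (l / 2) O
  else [set x | hcube a l x /\ hcube a l `<=` O].

Lemma inner_sub N a l O : 0 < l -> inner N a l O `<=` hcube a l `&` O.
Proof.
elim: N a l => [|N IH] a l l0 x /=; first by move=> [xa aO]; split => //; exact: aO.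
move=> [m _ /IH]; rewrite divr_gt0 // => /(_ isT)[xm xO]; split => //.
exact: (sub_hcube_subdiv l0 xm).
Qed.

Lemma inner_mono N a l O : 0 < l -> inner N a l O `<=` inner N.+1 a l O.
Proof.
elim: N a l => [|N IH] a l l0 x.
  move=> [xa aO]; have /(hcube_subdiv (M := 2) _ _ _ l0) := xa => /(_ isT)[m xm].
  exists m => //; split => // y /(sub_hcube_subdiv l0); exact: aO.
by move=> [m _ xm]; exists m => //; apply: IH xm; rewrite divr_gt0.
Qed.

Lemma inner_cover N a l O (x : Rn R n) : 0 < l -> hcube a l x ->
  (forall y : Rn R n, (forall i, `|tov x ord0 i - tov y ord0 i| < l / 2 ^+ N) -> O y) ->
  inner N a l O x.
Proof.
elim: N a l => [|N IH] a l l0 xa HO.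
  split=> // y ya; apply: HO => i; rewrite expr0 divr1.
  by have /andP[] := xa i; have /andP[] := ya i; rewrite ltr_norml; lra.
have /(hcube_subdiv (M := 2) _ _ _ l0) := xa => /(_ isT)[m xm].
exists m => //; apply: IH => //; first by rewrite divr_gt0.
by move=> y yx; apply: HO => i; rewrite exprS invfM mulrA.
Qed.

Lemma measurable_inner N a l O : measurable (inner N a l O).
Proof.
elim: N a l => [|N IH] a l /=.
  have [aO|aO] := pselect (hcube a l `<=` O).
    rewrite (_ : [set x | _] = hcube a l); first exact: measurable_hcube.
    by apply/seteqP; split => [x []|x].
  rewrite (_ : [set x | _] = set0); first exact: measurable0.
  by apply/seteqP; split => [x []|x].
by apply: fin_bigcup_measurable => // m _; exact: IH.
Qed.

(** On a child cube the set built from the parent agrees with the one built from that child, because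
    distinct children are disjoint. *)
Lemma dstep_inner N a l O : 0 < l -> dstep N a l (\1_(inner N a l O)).
Proof.
elim: N a l => [|N IH] a l l0 /=.
  have [aO|aO] := pselect (hcube a l `<=` O).
    by exists 1 => x xa; rewrite indicE mem_set.
  by exists 0 => x xa; rewrite indicE memNset // => -[].
move=> m; have l2 : 0 < l / 2 by rewrite divr_gt0.
suff : forall x, hcube (subcorner a l m) (l / 2) x ->
  \1_(inner N.+1 a l O) x = \1_(inner N (subcorner a l m) (l / 2) O) x :> R.
  move: (IH (subcorner a l m) _ l2).
  move: (\1_(inner N.+1 a l O)) (\1_(inner N (subcorner a l m) (l / 2) O)) => g g'.
  move: (subcorner a l m) (l / 2) l2 => a' l' l'0.
  elim: {IH} N a' l' l'0 => [|N IH] a' l' l'0 /=.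
    by move=> [v gv] gg'; exists v => x xa; rewrite gg' ?gv.
  move=> H gg' m'; apply: IH; [by rewrite divr_gt0|exact: H|].
  by move=> x /(sub_hcube_subdiv l'0)/gg'.
move=> x xm; rewrite !indicE; congr (_%:R); congr nat_of_bool; apply/idP/idP; rewrite !inE.
  move=> [m' _ xm']; have [xm'' _] := inner_sub l2 xm'.
  by have <- := hcube_subdiv_inj (M := 2) _ l0 xm'' xm.
by move=> xm'; exists m.
Qed.

(** * Approximation by dyadic step functions, in [L^1] and in measure *)

Section density.
Context (mu : {measure set (Rn R n) -> \bar R}) (Hmu : is_lebesgue mu).
Variables (a : 'rV[R]_n) (l : R) (l0 : 0 < l).

Definition step_approx (A : set (Rn R n)) := measurable A /\
  forall e : R, 0 < e -> exists N g, [/\ measurable_fun setT g, dstep N a l g &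
    (\int[mu]_(x in hcube a l) (`|\1_A x - g x|)%:E <= e%:E)%E].

Lemma measurable_abs_diff (f g : Rn R n -> R) : measurable_fun setT f ->
  measurable_fun setT g -> measurable_fun setT (fun x => `|f x - g x|).
Proof. by move=> mf mg; apply: measurableT_comp => //; exact: measurable_funB. Qed.

Lemma step_approx_setD A B : B `<=` A -> step_approx A -> step_approx B ->
  step_approx (A `\` B).
Proof.
move=> BA [mA HA] [mB HB]; split; first exact: measurableD.
move=> e e0; have e2 : 0 < e / 2 by rewrite divr_gt0.
have [N [g [mg sg ig]]] := HA _ e2; have [N' [g' [mg' sg' ig']]] := HB _ e2.
exists (maxn N N'), (fun x => g x - g' x); split; first exact: measurable_funB.
  by apply: (dstep_op (fun x y => x - y)); [apply: dstep_le sg|apply: dstep_le sg'];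
    rewrite ?leq_maxl ?leq_maxr.
have mi C : measurable C -> measurable_fun setT (\1_C : Rn R n -> R) by exact: measurable_indic.
apply: (@le_trans _ _ (\int[mu]_(x in hcube a l) (`|\1_A x - g x| + `|\1_B x - g' x|)%:E)%E).
  apply: le_integralR; [exact: measurable_hcube| | |by move=> x; exact: normr_ge0|].
  - by apply: measurable_abs_diff; [apply: mi; exact: measurableD|exact: measurable_funB].
  - by apply: measurable_funD; apply: measurable_abs_diff => //; exact: mi.
  move=> x _; have -> : \1_(A `\` B) x = \1_A x - \1_B x :> R.
    rewrite !indicE in_setD; case: (boolP (x \in B)) => /=; last by rewrite andbT subr0.
    by move=> /set_mem/BA/mem_set ->; rewrite subrr.
  by rewrite (le_trans _ (ler_normB _ _)) // le_eqVlt; apply/orP; left; apply/eqP; congr `| _ |; ring.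
rewrite ge0_integralDR; [|exact: measurable_hcube| | |by move=> x; exact: normr_ge0|by move=> x; exact: normr_ge0].
- by rewrite (splitr e) EFinD; exact: leeD.
- by apply: measurable_abs_diff => //; exact: mi.
- by apply: measurable_abs_diff => //; exact: mi.
Qed.
Lemma mi_indic (C : set (Rn R n)) : measurable C -> measurable_fun setT (\1_C : Rn R n -> R).
Proof. exact: measurable_indic. Qed.

(** Continuity from above: inside the cube, of finite measure, some [A k] already misses less than
    [e / 2] of the union. *)
Lemma step_approx_bigcup (A : (set (Rn R n))^nat) :
  {homo A : k m / (k <= m)%N >-> k `<=` m} -> (forall k, step_approx (A k)) ->
  step_approx (\bigcup_k A k).
Proof.
move=> ndA HA; have mA : measurable (\bigcup_k A k).
  by apply: bigcupT_measurable => k; have [] := HA k.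
split=> // e e0; have e2 : 0 < e / 2 by rewrite divr_gt0.
pose G k := hcube a l `&` (\bigcup_k A k `\` A k).
have mG k : measurable (G k).
  apply: measurableI; first exact: measurable_hcube.
  by apply: measurableD => //; have [] := HA k.
have G0 : \bigcap_k G k = set0.
  rewrite -subset0 => x Gx; have [_ [[k _ xk] _]] := Gx 0%N I.
  by have [_ [_]] := Gx k I.
have cv : mu (G k) @[k --> \oo] --> 0%E.
  rewrite -(measure0 mu) -G0; apply: nonincreasing_cvg_mu.
  - apply: (@le_lt_trans _ _ (mu (hcube a l))); last by rewrite mu_hcube ?ltry // ltW.
    by apply: le_measure; rewrite ?inE; [exact: mG|exact: measurable_hcube|exact: subIsetl].
  - exact: mG.
  - by rewrite G0; exact: measurable0.
  - apply/nonincreasing_seqP => k; apply/subsetPset => x [xa [xA xk]]; split => //; split => //.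
    by move=> h; apply: xk; apply: ndA h.
have /cv[k _ /(_ k (leqnn k)) /= Gk] : nbhs (0%E : \bar R) [set y | y < (e / 2)%:E]%E.
  apply: open_nbhs_nbhs; split; first exact: open_ereal_lt_ereal.
  by rewrite /= lte_fin.
have [mAk /(_ _ e2)[N [g [mg sg ig]]]] := HA k.
exists N, g; split => //.
have mDk : measurable (\bigcup_k A k `\` A k) by exact: measurableD.
apply: (@le_trans _ _ (\int[mu]_(x in hcube a l)
    (\1_(\bigcup_k A k `\` A k) x + `|\1_(A k) x - g x|)%:E)%E).
  apply: le_integralR; [exact: measurable_hcube| | |by move=> x; exact: normr_ge0|].
  - by apply: measurable_abs_diff => //; exact: mi_indic.
  - by apply: measurable_funD; [exact: mi_indic|apply: measurable_abs_diff => //; exact: mi_indic].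
  move=> x _; have -> : \1_(\bigcup_k A k) x = \1_(\bigcup_k A k `\` A k) x + \1_(A k) x :> R.
    rewrite !indicE in_setD; case: (boolP (x \in A k)) => /= xA; last by rewrite andbT addr0.
    by rewrite mem_set; [rewrite andbF add0r|exists k => //; exact: set_mem].
  rewrite -addrA (le_trans (ler_normD _ _)) // lerD2r indicE ger0_norm //.
rewrite ge0_integralDR; [|exact: measurable_hcube| | |by move=> x; rewrite indicE|by move=> x; exact: normr_ge0].
- rewrite (splitr e) EFinD; apply: leeD => //.
  by rewrite integral_indic; [rewrite setIC; exact: ltW|exact: measurable_hcube|].
- exact: mi_indic.
- by apply: measurable_abs_diff => //; exact: mi_indic.
Qed.

Lemma step_approx_open (O : set 'rV[R]_n) : open O -> step_approx (O : set (Rn R n)).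
Proof.
move=> oO.
have mO : measurable (O : set (Rn R n)) by exact: sub_sigma_algebra.
have [] : step_approx (\bigcup_N inner N a l O).
  apply: step_approx_bigcup.
    apply: (@homo_leq _ _ (fun A B : set (Rn R n) => A `<=` B)) => [x //|y x z xy yz t /xy/yz //|N].
    exact: inner_mono.
  move=> N; split; first exact: measurable_inner.
  move=> e e0; exists N, (\1_(inner N a l O)); split.
  - by apply: mi_indic; exact: measurable_inner.
  - exact: dstep_inner.
  - by rewrite integral0_eq ?lee_fin ?(ltW e0) // => x _; rewrite subrr normr0.
move=> _ H; split => // e /H[N [g [mg sg ig]]]; exists N, g; split => //.
apply: le_trans ig; rewrite le_eqVlt; apply/orP; left; apply/eqP.
apply: eq_integral => x /set_mem xa; congr (`| _ - _ |)%:E.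
rewrite !indicE; congr (_%:R); congr nat_of_bool; apply/idP/idP; rewrite !inE; last first.
  by move=> [M _ /(inner_sub l0)[]].
move=> Ox; have /nbhs_ballP[e' /= e'0 He'] : nbhs (x : 'rV[R]_n) O by exact: open_nbhs_nbhs.
exists (Num.truncn (l / e')).+1 => //; apply: inner_cover => // y yx; apply: He'.
split=> // i j; rewrite (ord1 i); apply: lt_le_trans (yx j) _.
rewrite ler_pdivrMr ?exprn_gt0 // mulrC -ler_pdivrMr //.
apply: (@le_trans _ _ (Num.truncn (l / e')).+1%:R); first exact/ltW/truncnS_gt.
by rewrite -natrX ler_nat ltnW // ltn_expl.
Qed.

(** Pi-lambda theorem: open sets are stable under intersection and generate the Borel sets, and
    approximable sets are stable under proper differences and increasing unions. *)
Lemma step_approx_measurable (A : set (Rn R n)) : measurable A -> step_approx A.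
Proof.
move=> mA; apply: (@lambda_system_subset _ (@open 'rV[R]_n) _ setT step_approx) => //.
- by move=> O O' oO oO'; exact: openI.
- split => //.
  + by apply: step_approx_open; exact: openT.
  + by move=> B C CB HB HC; exact: step_approx_setD.
  + move=> F ndF HF; apply: step_approx_bigcup => //.
    by move=> i j /ndF/subsetPset.
- by move=> O /step_approx_open.
Qed.

Lemma dstep_sum (I : Type) (s : seq I) N (h : I -> Rn R n -> R) :
  (forall i, dstep N a l (h i)) -> dstep N a l (fun x => \sum_(i <- s) h i x).
Proof.
move=> H; elim: s => [|i s IH].
  by apply: (@dstep_cst _ _ _ _ 0) => // x _; rewrite big_nil.
rewrite (_ : (fun x => _) = (fun x => h i x + \sum_(i <- s) h i x)).
  exact: (dstep_op (fun x y => x + y)).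
by apply/funext => x; rewrite big_cons.
Qed.

(** The sum is the integer part of [v] capped at [m]. It writes a function with values in [[0, m]],
    up to an error 1, as a sum of indicators of superlevel sets. *)
Lemma count_le (m : nat) (v : R) : 0 <= v ->
  [/\ \sum_(j < m) (j.+1%:R <= v)%R%:R <= v,
      m%:R <= v -> m%:R <= \sum_(j < m) (j.+1%:R <= v)%R%:R :> R &
      v <= m%:R -> v - 1 <= \sum_(j < m) (j.+1%:R <= v)%R%:R].
Proof.
suff : 0 <= v -> [/\ \sum_(j < m) (j.+1%:R <= v)%R%:R <= v,
      \sum_(j < m) (j.+1%:R <= v)%R%:R <= m%:R :> R,
      m%:R <= v -> m%:R <= \sum_(j < m) (j.+1%:R <= v)%R%:R :> R &
      v <= m%:R -> v - 1 <= \sum_(j < m) (j.+1%:R <= v)%R%:R].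
  by move=> H /H[].
move=> v0; elim: m => [|m [IH1 IH2 IH3 IH4]].
  by rewrite big_ord0; split => // ?; lra.
rewrite big_ord_recr /=; set S := \sum_(_ < m) _ in IH1 IH2 IH3 IH4 *.
have E : m.+1%:R = m%:R + 1 :> R by rewrite natr1.
have [mv|mv] /= := leP m.+1%:R v.
  have mv' : m%:R <= v by lra.
  by have := IH3 mv'; split; lra.
rewrite addr0; split; [exact: IH1|by apply: le_trans IH2 _; rewrite E lerDl|lra|move=> _].
by have [vm|vm] := leP v m%:R; [exact: IH4|have := IH3 (ltW vm); lra].
Qed.

(** Where [|f| < J], the function [f + J] is within 1 of a sum of [2 J] indicators; replacing each
    of them by a step function costs another 1 outside a set that Markov's inequality makes small.
    Accuracy 2 is enough, since only constants matter in the stopping argument. *)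
Lemma measurable_approx_dstep (f : Rn R n -> R) (e : R) : measurable_fun setT f -> 0 < e ->
  exists N g, [/\ measurable_fun setT g, dstep N a l g &
    (mu (hcube a l `&` [set x | (`|f x - g x| > 2)%R]) <= e%:E)%E].
Proof.
move=> mf e0; have e2 : 0 < e / 2 by rewrite divr_gt0.
pose G (k : nat) := hcube a l `&` [set x | (k%:R <= `|f x|)%R].
have mset (h : Rn R n -> R) (t : R) : measurable_fun setT h ->
    measurable [set x | (t <= h x)%R].
  move=> mh; rewrite (_ : [set x | _] = h @^-1` `[t, +oo[%classic).
    by rewrite -[X in measurable X]setTI; apply: mh => //; exact: measurable_itv.
  by apply/seteqP; split => x /=; rewrite in_itv /= andbT.
have mG k : measurable (G k).
  apply: measurableI; first exact: measurable_hcube.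
  by apply: mset; exact: measurableT_comp.
have G0 : \bigcap_k G k = set0.
  rewrite -subset0 => x Gx; have [_ /=] := Gx (Num.truncn `|f x|).+1 I.
  by rewrite leNgt truncnS_gt.
have cv : mu (G k) @[k --> \oo] --> 0%E.
  rewrite -(measure0 mu) -G0; apply: nonincreasing_cvg_mu.
  - apply: (@le_lt_trans _ _ (mu (hcube a l))); last by rewrite mu_hcube ?ltry // ltW.
    by apply: le_measure; rewrite ?inE; [exact: mG|exact: measurable_hcube|exact: subIsetl].
  - exact: mG.
  - by rewrite G0; exact: measurable0.
  - apply/nonincreasing_seqP => k; apply/subsetPset => x [xa /= xk]; split => //=.
    by rewrite (le_trans _ xk) // ler_nat.
have /cv[J _ /(_ J (leqnn J)) /= GJ] : nbhs (0%E : \bar R) [set y | y < (e / 2)%:E]%E.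
  apply: open_nbhs_nbhs; split; first exact: open_ereal_lt_ereal.
  by rewrite /= lte_fin.
pose A (j : 'I_(2 * J)) : set (Rn R n) := [set x | (j.+1%:R - J%:R <= f x)%R].
have mA j : measurable (A j) by exact: mset.
(* Error allowed to each of the [2 J] indicators; the successor covers [J = 0]. *)
pose d : R := e / 2 / (2 * J).+1%:R.
have d0 : 0 < d by rewrite divr_gt0.
have HA j : exists Ng : nat * (Rn R n -> R), [/\ measurable_fun setT Ng.2, dstep Ng.1 a l Ng.2 &
    (\int[mu]_(x in hcube a l) (`|\1_(A j) x - Ng.2 x|)%:E <= d%:E)%E].
  by have [_ /(_ _ d0)[N [g H]]] := step_approx_measurable (mA j); exists (N, g).
have [Ng HNg] := choice HA.
pose g x : R := \sum_j (Ng j).2 x - J%:R.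
exists (\max_j (Ng j).1), g; split.
- by apply: measurable_funB => //; apply: measurable_sum => j; have [] := HNg j.
- apply: (dstep_op (fun x y => x - y)); last by apply: (@dstep_cst _ _ _ _ J%:R).
  have H j : dstep (\max_j (Ng j).1) a l (Ng j).2.
    by have [_ H _] := HNg j; apply: dstep_le H => //; exact: (leq_bigmax j).
  exact: dstep_sum.
pose h x : R := \sum_j `|\1_(A j) x - (Ng j).2 x|.
have mhj j : measurable_fun setT (fun x => `|\1_(A j) x - (Ng j).2 x|).
  by have [mg _ _] := HNg j; apply: measurable_abs_diff => //; exact: mi_indic.
have mh : measurable_fun setT h by exact: measurable_sum.
have h0 x : 0 <= h x by apply: sumr_ge0 => j _; exact: normr_ge0.
have mg : measurable_fun setT g.
  by apply: measurable_funB => //; apply: measurable_sum => j; have [] := HNg j.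
have ih : (\int[mu]_(x in hcube a l) (h x)%:E <= (e / 2)%:E)%E.
  under eq_integral do rewrite /h -sumEFin.
  rewrite ge0_integral_sum; [|exact: measurable_hcube
     |by move=> j; apply/measurable_funTS/measurable_EFinP|by move=> j x _; rewrite lee_fin].
  apply: (@le_trans _ _ (\sum_(j < 2 * J) d%:E)%E).
    by apply: lee_sum => j _; have [_ _] := HNg j.
  rewrite sumEFin lee_fin sumr_const card_ord -[leLHS]mulr_natr /d mulrAC ler_pdivrMr //.
  by rewrite ler_pM2l // ler_nat.
pose B := hcube a l `&` [set x | (1 <= h x)%R].
have mB : measurable B.
  by apply: measurableI; [exact: measurable_hcube|exact: mset].
have muB : (mu B <= (e / 2)%:E)%E.
  have mh' : measurable_fun (hcube a l) (EFin \o h) by exact/measurable_funTS/measurable_EFinP.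
  have := le_integral_abse mu (measurable_hcube a l) mh' ltr01.
  rewrite mul1e => H.
  apply: le_trans ih; rewrite (eq_integral (fun x => `|(EFin \o h) x|%E)); last first.
    by move=> x _; rewrite /= ger0_norm.
  apply: le_trans H; rewrite le_eqVlt; apply/orP; left; apply/eqP; congr (mu (_ `&` _)).
  by apply/seteqP; split => x /=; rewrite lee_fin ger0_norm.
have mC : measurable (hcube a l `&` [set x | (`|f x - g x| > 2)%R]).
  apply: measurableI; first exact: measurable_hcube.
  rewrite (_ : [set x | _] = (fun x => `|f x - g x|) @^-1` `]2, +oo[%classic).
    rewrite -[X in measurable X]setTI.
    by apply: measurable_abs_diff => //; exact: measurable_itv.
  by apply/seteqP; split => x /=; rewrite in_itv /= andbT.
have sub : hcube a l `&` [set x | (`|f x - g x| > 2)%R] `<=` G J `|` B.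
  move=> x [xa /= fg]; have [Jf|fJ] := leP J%:R `|f x|; first by left.
  right; split => //=; rewrite leNgt; apply/negP => h1.
  have /andP[f1 f2] : - J%:R < f x < J%:R by rewrite -ltr_norml.
  have v0 : 0 <= f x + J%:R by lra.
  have [c1 c2 c3] := count_le (2 * J) v0.
  have E : \sum_(j < 2 * J) (j.+1%:R <= f x + J%:R)%R%:R = \sum_j \1_(A j) x :> R.
    apply: eq_bigr => j _; rewrite indicE; congr (_%:R); congr nat_of_bool.
    by rewrite -lerBlDr; apply/idP/idP; rewrite inE.
  have hE : `|\sum_j \1_(A j) x - \sum_j (Ng j).2 x| <= h x.
    by rewrite -sumrB; exact: ler_norm_sum.
  rewrite E in c1 c2 c3; move: fg; rewrite /g.
  have v2 : f x + J%:R <= (2 * J)%:R by rewrite natrM; lra.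
  have {}c3 := c3 v2.
  rewrite ltNge => /negP; apply.
  by move: hE h1; rewrite !ler_norml => /andP[] *; apply/andP; split; lra.
apply: (@le_trans _ _ (mu (G J `|` B))).
  by apply: le_measure; rewrite ?inE //; exact: measurableU.
apply: (@le_trans _ _ (mu (G J) + mu B)%E); first exact: measureU2.
by rewrite (splitr e) EFinD; apply: leeD => //; exact: ltW.
Qed.
End density.
End dyadic_steps.

(** * The John-Nirenberg inequality *)

Lemma le_integral_trunc d (T : measurableType d) (R : realType)
    (mu : {measure set T -> \bar R}) (D : set T) (F : T -> \bar R) (c : \bar R) :
  measurable D -> measurable_fun setT F -> (forall x, 0 <= F x)%E ->
  (forall k, \int[mu]_(x in D) (trunc_at k (F x))%:E <= c)%E ->
  (\int[mu]_(x in D) F x <= c)%E.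
Proof.
move=> mD mF F0 H.
have mt k : measurable_fun setT (fun x => trunc_at k (F x)).
  by apply: (measurable_trunc_at k (F := F)).
have cvgG x : (trunc_at k (F x))%:E @[k --> \oo] --> F x.
  have := trunc_at_cvg ltr01 (F0 x); rewrite poweRe1 //.
  by under eq_fun do rewrite powRr1 ?trunc_at_ge0 //.
rewrite (eq_integral (fun x => limn (fun k => (trunc_at k (F x))%:E))); last first.
  by move=> x _; apply/esym/cvg_lim => //; exact: cvgG.
have nd x : D x -> {homo (fun k => (trunc_at k (F x))%:E) : k l / (k <= l)%N >-> (k <= l)%E}.
  move=> _ k l kl; rewrite !EFin_trunc_at // le_min !ge_min lexx /= lee_fin ler_nat kl orbT //.
have g0 k x : D x -> (0 <= (trunc_at k (F x))%:E)%E by rewrite lee_fin trunc_at_ge0.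
have mt' k : measurable_fun D (fun x => (trunc_at k (F x))%:E).
  exact/measurable_funTS/measurable_EFinP.
have cv := @cvg_monotone_convergence _ _ _ mu D mD
  (fun k x => (trunc_at k (F x))%:E) mt' g0 nd.
rewrite -(cvg_lim _ cv) //; apply: lime_le; last by near=> k; exact: H.
by apply/cvg_ex; eexists; exact: cv.
Unshelve. all: by end_near. Qed.

Section john_nirenberg.
Context {R : realType} {n : nat} (mu : {measure set (Rn R n) -> \bar R})
  (Hmu : is_lebesgue mu).
Implicit Types (a : 'rV[R]_n) (l c : R).

Lemma locally_integrable_measurable (b : Rn R n -> R) :
  Defs.locally_integrable mu b -> measurable_fun setT b.
Proof.
move=> ib; pose C (k : nat) := cube (\row_(_ < n) (- k.+1%:R)) (2 * k.+1%:R) : set (Rn R n).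
have CT : \bigcup_k C k = setT.
  apply/seteqP; split=> // x _; exists (Num.truncn `|tov x|) => // i; rewrite mxE.
  have h : `|tov x ord0 i| <= (Num.truncn `|tov x|).+1%:R.
    apply: (@le_trans _ _ `|tov x|); last exact/ltW/truncnS_gt.
    by rewrite [leRHS]/Num.norm /= mx_normrE; apply: (le_bigmax _ _ (ord0, i)).
  by move: h; rewrite ler_norml => /andP[h1 h2]; lra.
rewrite -CT; apply/measurable_fun_bigcup => [k|k]; first exact: measurable_cube.
apply/measurable_EFinP; apply: (@measurable_int _ _ _ mu); apply: ib.
by exists (\row_(_ < n) (- k.+1%:R)), (2 * k.+1%:R); split => //; rewrite mulr_gt0.
Qed.

Lemma integral_one (D : set (Rn R n)) : measurable D ->
  (\int[mu]_(x in D) (cst (1 : R) x)%:E = mu D)%E.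
Proof. by move=> mD; rewrite -[RHS]mul1e; exact: (integral_cst mu mD 1%E). Qed.

Section normalised.
Variables (b : Rn R n -> R) (ib : Defs.locally_integrable mu b).

Let mb : measurable_fun setT b. Proof. exact: locally_integrable_measurable. Qed.

Lemma measurable_dist_cst c : measurable_fun setT (fun x => `|b x - c|).
Proof. by apply: measurableT_comp => //; exact: measurable_funB. Qed.

Definition osc a l c := fine (\int[mu]_(x in hcube a l) (`|b x - c|)%:E)%E.

Lemma integrable_cube a l : 0 < l -> mu.-integrable (cube a l) (EFin \o b).
Proof. by move=> l0; apply: ib; exists a, l. Qed.

Lemma integrable_cube_subr a l c : 0 < l -> mu.-integrable (cube a l) (EFin \o (fun x => b x - c)).
Proof.
move=> l0; apply: (eq_integrable (measurable_cube a l) (fun x => (b x)%:E - (cst c x)%:E)%E) => //.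
apply: (integrableB (measurable_cube a l)); first exact: integrable_cube.
apply: measurable_bounded_integrable; first exact: measurable_cube.
- by rewrite mu_cube ?ltry // ltW.
- exact: measurable_cst.
- by exists `|c|; split; [exact: normr_real|move=> M cM x _ /=; exact: ltW].
Qed.

Lemma oscE a l c : 0 < l ->
  (\int[mu]_(x in hcube a l) (`|b x - c|)%:E = (osc a l c)%:E)%E.
Proof.
move=> l0; rewrite /osc fineK // ge0_fin_numE; last by apply: integral_ge0 => x _; rewrite lee_fin.
rewrite ge0_integral_hcube ?(ltW l0) //; last by apply/measurable_EFinP; exact: measurable_dist_cst.
by have /integrableP[_] := integrable_cube_subr a c l0.
Qed.

Lemma osc_ge0 a l c : 0 <= osc a l c.
Proof. by apply: fine_ge0; apply: integral_ge0 => x _; rewrite lee_fin. Qed.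

Lemma osc_subdiv a l c : 0 < l ->
  osc a l c = \sum_(m : {ffun 'I_n -> 'I_2}) osc (subcorner a l m) (l / 2) c.
Proof.
move=> l0; apply: EFin_inj; rewrite -oscE // (ge0_integral_subdiv mu (M := 2) a _ l0) //.
  by rewrite -sumEFin; apply: eq_bigr => m _; rewrite oscE // divr_gt0.
by apply/measurable_EFinP; exact: measurable_dist_cst.
Qed.

Lemma avg_sub_le a l c : 0 < l -> `|avg mu (cube a l) b - c| * l ^+ n <= osc a l c.
Proof.
move=> l0; have ln0 : 0 < l ^+ n by rewrite exprn_gt0.
have i1 := integrable_cube a l0.
have ic : mu.-integrable (cube a l) (EFin \o cst c).
  apply: measurable_bounded_integrable; first exact: measurable_cube.
  - by rewrite mu_cube ?ltry // ltW.
  - exact: measurable_cst.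
  - by exists `|c|; split; [exact: normr_real|move=> M cM x _ /=; exact: ltW].
have E : ((avg mu (cube a l) b - c) * l ^+ n)%:E = (\int[mu]_(x in cube a l) (b x - c)%:E)%E.
  under eq_integral do rewrite EFinB.
  rewrite (integralB_EFin (measurable_cube a l) i1 ic).
  have -> : (\int[mu]_(x in cube a l) (cst c x)%:E = c%:E * mu (cube a l))%E.
    exact: (integral_cst mu (measurable_cube a l) c%:E).
  rewrite (mu_cube Hmu a (ltW l0)) /avg (mu_cube Hmu a (ltW l0)) /=.
  rewrite -[X in _ = (X + _)%E](fineK (integrable_fin_num (measurable_cube a l) i1)).
  rewrite -EFinD; congr EFin; rewrite mulrBl; congr (_ - _).
  by rewrite mulrAC mulVf ?mul1r // gt_eqF.
rewrite -lee_fin -oscE // ge0_integral_hcube ?(ltW l0) //; last by apply/measurable_EFinP; exact: measurable_dist_cst.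
rewrite -[l ^+ n]gtr0_norm // -normrM -abse_EFin E.
apply: le_abse_integral; first exact: measurable_cube.
by apply/measurable_funTS/measurable_EFinP/measurable_funB.
Qed.

Hypothesis osc1 : forall a l, 0 < l -> osc a l (avg mu (cube a l) b) <= l ^+ n.

(** Takes the place of Lebesgue's differentiation theorem at the bottom of the recursion: on a leaf
    that meets [E], one number [v] is close to [b] on the part in [E] and on at least half of the
    leaf, so a bound on the mean of [|b - c|] bounds [|v - c|]. *)
Fixpoint good (N : nat) a l (E : set (Rn R n)) : Prop :=
  if N is N'.+1 then forall m : {ffun 'I_n -> 'I_2}, good N' (subcorner a l m) (l / 2) E
  else hcube a l `&` E = set0 \/ exists v : R,
    (forall x, hcube a l x -> E x -> `|b x - v| <= 2) /\
    ((l ^+ n / 2)%:E <= mu (hcube a l `&` [set x | (`|b x - v| <= 2)%R]))%E.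

Variables (s : R) (s1 : 1 <= s).
(** [lam] is the stopping height. [D0] bounds [|b - c|^s] on the part of a leaf in [E], where
    [|b - v| <= 2] and [|v - c| <= 2 lam + 2]. [2^n lam] bounds the change of [c] at a restart,
    whose cost per unit volume is [2^s (D0 + K + (2^n lam)^s) = 2^s 2 K]; the value [lam = 2^s 2]
    balances it. *)
Let lam : R := 2 `^ (s + 1).
Let D0 : R := (2 * lam + 4) `^ s.
Let K : R := D0 + (2 ^+ n * lam) `^ s.

Let lam2 : 2 <= lam.
Proof.
rewrite /lam -[leLHS]powRr1; last by lra.
by apply: ler_powR; [rewrite ler1n|move: s1; lra].
Qed.

Let D0_ge0 : 0 <= D0. Proof. exact: powR_ge0. Qed.
Let K_ge0 : 0 <= K. Proof. by rewrite addr_ge0 ?powR_ge0. Qed.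

Lemma measurable_dist_powR c (E : set (Rn R n)) : measurable E ->
  measurable_fun setT (fun x => `|b x - c| `^ s * \1_E x).
Proof.
move=> mE; apply: measurable_funM; last exact: measurable_indic.
exact: (measurableT_comp (measurable_powR _) (measurable_dist_cst c)).
Qed.

(* Calderon-Zygmund stopping by recursion on the depth: a child cube where the
   average of |b - c| exceeds [lam] is restarted with c replaced by its mean. *)
Lemma good_integral_le N a l c E : 0 < l -> measurable E -> good N a l E ->
  osc a l c <= lam * l ^+ n ->
  (\int[mu]_(x in hcube a l) (`|b x - c| `^ s * \1_E x)%:E <=
   (D0 * l ^+ n + K * osc a l c)%:E)%E.
Proof.
move=> l0 mE; have s1_ := s1; have L2 : 2 <= lam := lam2.
have s0 : 0 < s by lra.
elim: N a l l0 c => [|N IH] a l l0 c gE oc.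
  have ln0 : 0 < l ^+ n by rewrite exprn_gt0.
  apply: (@le_trans _ _ (D0 * l ^+ n)%:E); last first.
    by rewrite lee_fin lerDl mulr_ge0 // osc_ge0.
  case: gE => [E0|[v [vE vmu]]].
    rewrite integral0_eq; first by rewrite lee_fin mulr_ge0 // ltW.
    move=> x xa; rewrite indicE memNset ?mulr0 // => Ex.
    by have : (hcube a l `&` E) x by []; rewrite E0.
  (* On half of the leaf [|b - c| >= |v - c| - 2], while the mean of [|b - c|] over the leaf is at
     most [lam]. *)
  have vc : `|v - c| <= 2 * lam + 2.
    have [//|] := leP `|v - c| 2; first by lra.
    move=> v2; have : (((`|v - c| - 2) * (l ^+ n / 2))%:E <= (osc a l c)%:E)%E.
      rewrite -oscE // EFinM.
      pose B := [set x | (`|b x - v| <= 2)%R].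
      have mB : measurable B.
        rewrite (_ : B = (fun x => `|b x - v|) @^-1` `]-oo, 2%:R]%classic).
          rewrite -[X in measurable X]setTI.
          by apply: measurable_dist_cst => //; exact: measurable_itv.
        by apply/seteqP; split => x /=; rewrite in_itv.
      apply: (@le_trans _ _ ((`|v - c| - 2)%:E * mu (hcube a l `&` B))%E).
        by apply: lee_wpmul2l => //; rewrite lee_fin; lra.
      have -> : ((`|v - c| - 2)%:E * mu (hcube a l `&` B) =
         \int[mu]_(x in hcube a l) ((`|v - c| - 2) * \1_B x)%:E)%E.
        rewrite ge0_integralZ; [|exact: measurable_hcube|exact: measurable_indic
          |by move=> x; rewrite indicE|lra].
        by rewrite integral_indic; [rewrite setIC|exact: measurable_hcube|].
      apply: le_integralR; [exact: measurable_hcube| |exact: measurable_dist_cst| |].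
      - by apply: measurable_funM => //; exact: measurable_indic.
      - by move=> x; rewrite mulr_ge0 ?indicE //; lra.
      move=> x xa; rewrite indicE; case: (boolP (x \in B)) => [|_]; last by rewrite mulr0.
      rewrite inE /B /= mulr1 => h; have := ler_distD (b x) v c.
      by rewrite [`|v - b x|]distrC; lra.
    rewrite lee_fin => /le_trans /(_ oc); rewrite mulrCA mulrC ler_pM2r //; lra.
  apply: (@le_trans _ _ (\int[mu]_(x in hcube a l) (D0 * cst 1 x)%:E)%E).
    apply: le_integralR; [exact: measurable_hcube|exact: measurable_dist_powR|exact: measurable_funM| |].
      by move=> x; rewrite mulr_ge0 ?powR_ge0 ?indicE.
    move=> x xa; rewrite indicE mulr1; case: (boolP (x \in E)) => [|_]; last by rewrite mulr0.
    rewrite inE mulr1 => Ex; apply: ler_powRl => //; first exact: ltW.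
    by have := vE x xa Ex; have := ler_distD v (b x) c; lra.
  rewrite ge0_integralZ; [|exact: measurable_hcube|exact: measurable_cst|by move=> x|exact: D0_ge0].
  rewrite integral_one; last exact: measurable_hcube.
  by rewrite (mu_hcube Hmu a (ltW l0)) -EFinM lexx.
have l2 : 0 < l / 2 by rewrite divr_gt0.
have ln2 : 0 < (l / 2) ^+ n by rewrite exprn_gt0.
have lnE : l ^+ n = 2 ^+ n * (l / 2) ^+ n by rewrite -exprMn mulrC divfK.
rewrite (ge0_integral_subdiv mu (M := 2) a (ltn0Sn 1) l0); [|
  by apply/measurable_EFinP; exact: measurable_dist_powR|
  by move=> x; rewrite lee_fin mulr_ge0 ?powR_ge0 ?indicE].
have card2 : \sum_(m : {ffun 'I_n -> 'I_2}) (l / 2) ^+ n = l ^+ n.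
  by rewrite sumr_const card_ffun !card_ord -[LHS]mulr_natl natrX -exprMn mulrC divfK.
apply: (@le_trans _ _ (\sum_(m : {ffun 'I_n -> 'I_2})
  (D0 * (l / 2) ^+ n + K * osc (subcorner a l m) (l / 2) c)%:E)%E); last first.
  rewrite sumEFin lee_fin big_split /= -mulr_sumr card2 -mulr_sumr -osc_subdiv //.
apply: lee_sum => m _; set a' := subcorner a l m.
have [om|om] := leP (osc a' (l / 2) c) (lam * (l / 2) ^+ n); first exact: IH (gE m) om.
pose c' := avg mu (cube a' (l / 2)) b.
have oc'1 : osc a' (l / 2) c' <= (l / 2) ^+ n by exact: osc1.
have oc' : osc a' (l / 2) c' <= lam * (l / 2) ^+ n.
  by apply: le_trans oc'1 _; rewrite ler_peMl ?ltW //; lra.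
have H' := IH _ _ l2 c' (gE m) oc'.
(* One child carries at most the whole integral over its parent, and [l^n = 2^n (l/2)^n]. *)
have omc : osc a' (l / 2) c <= 2 ^+ n * lam * (l / 2) ^+ n.
  rewrite mulrAC -lnE [leRHS]mulrC; apply: le_trans oc; rewrite [leRHS]osc_subdiv // (bigD1 m) //=.
  by rewrite lerDl sumr_ge0 // => *; exact: osc_ge0.
have cc' : `|c' - c| <= 2 ^+ n * lam.
  by rewrite -(ler_pM2r ln2); apply: le_trans omc; exact: avg_sub_le.
apply: (@le_trans _ _ (\int[mu]_(x in hcube a' (l / 2))
   (2 `^ s * (`|b x - c'| `^ s * \1_E x + (2 ^+ n * lam) `^ s * cst 1 x))%:E)%E).
  apply: le_integralR; [exact: measurable_hcube|exact: measurable_dist_powR| | |].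
  - apply: measurable_funM => //; apply: measurable_funD;
      [exact: measurable_dist_powR|exact: measurable_funM].
  - by move=> x; rewrite mulr_ge0 ?powR_ge0 ?indicE.
  move=> x _; rewrite mulr1 indicE; case: (x \in E); rewrite ?mulr1 ?mulr0; last first.
    by rewrite add0r mulr_ge0 ?powR_ge0.
  have h0 : 0 <= 2 ^+ n * lam by rewrite (le_trans _ cc').
  apply: le_trans (powR_add_le (normr_ge0 (b x - c')) h0 (ltW s0)).
  apply: ler_powRl => //; first exact: ltW.
  by apply: le_trans (ler_distD c' (b x) c) _; rewrite lerD2l.
rewrite ge0_integralZ; [|exact: measurable_hcube| | |exact: powR_ge0]; last 2 first.
- by apply: measurable_funD; [exact: measurable_dist_powR|exact: measurable_funM].
- by move=> x; rewrite addr_ge0 ?mulr_ge0 ?powR_ge0 ?indicE.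
rewrite ge0_integralDR; [|exact: measurable_hcube|exact: measurable_dist_powR| | |]; last 3 first.
- by apply: measurable_funM.
- by move=> x; rewrite mulr_ge0 ?powR_ge0 ?indicE.
- by move=> x; rewrite mulr_ge0 ?powR_ge0.
rewrite [X in (_ * (_ + X))%E]ge0_integralZ; [|exact: measurable_hcube|exact: measurable_cst
  |by move=> x|exact: powR_ge0].
rewrite integral_one; last exact: measurable_hcube.
rewrite (mu_hcube Hmu a' (ltW l2)).
apply: (@le_trans _ _ ((2 `^ s)%:E * ((D0 * (l / 2) ^+ n + K * osc a' (l / 2) c')%:E +
   ((2 ^+ n * lam) `^ s)%:E * ((l / 2) ^+ n)%:E))%E).
  by apply: lee_wpmul2l; [rewrite lee_fin powR_ge0|exact: leeD].
rewrite [leLHS](_ : _ = (2 `^ s * (D0 * (l / 2) ^+ n + K * osc a' (l / 2) c' +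
  (2 ^+ n * lam) `^ s * (l / 2) ^+ n))%:E) // lee_fin.
(* The child was stopped because its integral of [|b - c|] exceeds [lam (l/2)^n]; the term [K osc]
   for the old [c] therefore pays for the restart. *)
apply: (@le_trans _ _ (K * (lam * (l / 2) ^+ n))); last first.
  apply: (@le_trans _ _ (K * osc a' (l / 2) c)); first by rewrite ler_wpM2l // ltW.
  by rewrite lerDr mulr_ge0 // ltW.
have lamE : lam = 2 `^ s * 2.
  rewrite /lam powRD; first by rewrite powRr1.
  by apply/implyP => _; rewrite pnatr_eq0.
apply: (@le_trans _ _ (2 `^ s * (K * (l / 2) ^+ n + K * (l / 2) ^+ n))).
  rewrite ler_wpM2l ?powR_ge0 // addrAC -mulrDl -/K lerD2l.
  by rewrite ler_wpM2l.
by rewrite le_eqVlt lamE; apply/orP; left; apply/eqP; ring.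
Qed.
Lemma good_ext N a l (E E' : set (Rn R n)) : 0 < l ->
  (forall x, hcube a l x -> (E x <-> E' x)) -> good N a l E -> good N a l E'.
Proof.
elim: N a l => [|N IH] a l l0 EE' /=; last first.
  move=> H m; apply: IH (H m); first by rewrite divr_gt0.
  by move=> x /(sub_hcube_subdiv l0)/EE'.
case=> [E0|[v [vE vmu]]].
  left; rewrite -subset0 => x [xa xE']; have : (hcube a l `&` E) x by split => //; exact/EE'.
  by rewrite E0.
by right; exists v; split => // x xa /(EE' _ xa); exact: vE.
Qed.

Lemma measurable_far (g : Rn R n -> R) : measurable_fun setT g ->
  measurable [set x | (`|b x - g x| > 2)%R].
Proof.
move=> mg; rewrite (_ : [set x | _] = (fun x => `|b x - g x|) @^-1` `]2, +oo[%classic).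
  rewrite -[X in measurable X]setTI.
  by apply: measurable_abs_diff => //; exact: measurable_itv.
by apply/seteqP; split => x /=; rewrite in_itv /= andbT.
Qed.

(** [E] is chosen leaf by leaf, with [F] the set where [g] misses [b] by more than 2: the complement
    of [F] if that fills half of the leaf, nothing otherwise. In the second case [F] fills more than
    half of the leaf, so dropping the leaf loses at most a fixed multiple of the measure of [F] in
    it. *)
Lemma good_of_dstep N a l g : 0 < l -> measurable_fun setT g -> dstep N a l g ->
  exists E, [/\ measurable E, good N a l E &
    (\int[mu]_(x in hcube a l) (\1_(~` E) x)%:E <=
     3%:E * \int[mu]_(x in hcube a l) (\1_[set x | (`|b x - g x| > 2)%R] x)%:E)%E].
Proof.
move=> l0 mg; have mF := measurable_far mg; set F := [set x | _] in mF *.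
elim: N a l l0 => [|N IH] a l l0 /=.
  move=> [v gv]; have ln0 : 0 < l ^+ n by rewrite exprn_gt0.
  have mH := measurable_hcube a l; have mFc := measurableC mF.
  have muF : (mu (hcube a l `&` F) <= (l ^+ n)%:E)%E.
    rewrite -(mu_hcube Hmu a (ltW l0)); apply: le_measure; rewrite ?inE; [exact: measurableI|exact: mH|exact: subIsetl].
  have split_mu : (mu (hcube a l `&` ~` F) + mu (hcube a l `&` F) = (l ^+ n)%:E)%E.
    rewrite -(mu_hcube Hmu a (ltW l0)) -[in RHS](setIT (hcube a l)) -(setvU F) setIUr.
    symmetry; apply: measureU; [exact: measurableI|exact: measurableI|].
    by rewrite setIACA setICl setI0.
  have [h|h] := leP ((l ^+ n / 2)%:E) (mu (hcube a l `&` ~` F)).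
    exists (~` F); split => //.
      right; exists v; split.
        by move=> x xa; rewrite /F /= gv // => /negP; rewrite -leNgt.
      apply: le_trans h _; rewrite le_eqVlt; apply/orP; left; apply/eqP; congr (mu _).
      apply/seteqP; split=> x [xa] => [|/= xv]; last first.
        by split => //=; apply/negP; rewrite -leNgt gv.
      by rewrite /F /= gv // => /negP; rewrite -leNgt.
    rewrite setCK; rewrite -[leLHS]mul1e; apply: lee_wpmul2r; last by rewrite lee_fin; lra.
    by apply: integral_ge0 => x _; rewrite lee_fin indicE.
  exists set0; split; [exact: measurable0|by left; rewrite setI0|].
  rewrite setC0 !integral_indic ?setTI //; rewrite (mu_hcube Hmu a (ltW l0)) setIC.
  have [y yE] : exists y, mu (hcube a l `&` F) = y%:E.
    exists (fine (mu (hcube a l `&` F))); rewrite fineK // ge0_fin_numE //.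
    exact: le_lt_trans muF (ltry _).
  have [z zE] : exists z, mu (hcube a l `&` ~` F) = z%:E.
    exists (fine (mu (hcube a l `&` ~` F))); rewrite fineK // ge0_fin_numE //.
    exact: lt_trans h (ltry _).
  move: h split_mu; rewrite yE zE lte_fin => h [] split_mu.
  have y0 : 0 <= y by rewrite -lee_fin -yE.
  by rewrite lee_fin; lra.
move=> sg; have l2 : 0 < l / 2 by rewrite divr_gt0.
have [E_ HE] := choice (fun m => IH _ _ l2 (sg m)).
pose E := \bigcup_(m : {ffun 'I_n -> 'I_2}) (E_ m `&` hcube (subcorner a l m) (l / 2)).
have mE : measurable E.
  apply: fin_bigcup_measurable => // m _; apply: measurableI; first by have [] := HE m.
  exact: measurable_hcube.
have EE m x : hcube (subcorner a l m) (l / 2) x -> (E_ m x <-> E x).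
  move=> xm; split=> [xE|[m' _ [xE xm']]]; first by exists m.
  by have <- := hcube_subdiv_inj (M := 2) _ l0 xm' xm.
exists E; split => //.
  by move=> m; have [_ gm _] := HE m; apply: good_ext gm => // x /EE.
have nn (A : set (Rn R n)) x : (0%:E <= (\1_A x)%:E :> \bar R)%E by rewrite lee_fin indicE.
have mm (A : set (Rn R n)) : measurable A -> measurable_fun setT (EFin \o (\1_A : Rn R n -> R)).
  by move=> mA; apply/measurable_EFinP; exact: measurable_indic.
rewrite (ge0_integral_subdiv mu (M := 2) a (ltn0Sn 1) l0 (mm _ (measurableC mE)) (nn _)).
rewrite (ge0_integral_subdiv mu (M := 2) a (ltn0Sn 1) l0 (mm _ mF) (nn _)).
rewrite ge0_sume_distrr; last by move=> m _; apply: integral_ge0 => x _; exact: nn.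
apply: lee_sum => m _; have [_ _] := HE m; apply: le_trans.
rewrite le_eqVlt; apply/orP; left; apply/eqP; apply: eq_integral => x /set_mem xm.
congr EFin; rewrite !indicE; congr (_%:R); congr nat_of_bool.
by apply/idP/idP; rewrite !inE => xE /(EE _ _ xm).
Qed.

(** [|b - c|^s] is not known to be integrable. Truncated at height [k], its integral off [E] is at
    most [k] times a measure that a fine enough step function makes as small as needed; on [E] the
    recursion gives a bound free of [k] and of the depth [N]. *)
Lemma normalised_john_nirenberg a l : 0 < l ->
  (\int[mu]_(x in hcube a l) (`|b x - avg mu (cube a l) b| `^ s)%:E <=
   ((D0 + K) * l ^+ n)%:E)%E.
Proof.
move=> l0; set c := avg _ _ _; have ln0 : 0 < l ^+ n by rewrite exprn_gt0.
have L2 : 2 <= lam := lam2.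
have oc : osc a l c <= l ^+ n by exact: osc1.
have mH := measurable_hcube a l.
have mf : measurable_fun setT (fun x => `|b x - c| `^ s).
  exact: (measurableT_comp (measurable_powR _) (measurable_dist_cst c)).
apply: (le_integral_trunc mH) => [|x|k].
- by apply/measurable_EFinP.
- by rewrite lee_fin powR_ge0.
apply/lee_addgt0Pr => e e0.
pose d := e / (3 * k.+1%:R).
have d0 : 0 < d by rewrite divr_gt0 // mulr_gt0.
have [N [g [mg sg mug]]] := measurable_approx_dstep Hmu a l0 mb d0.
have [E [mE gE iE]] := good_of_dstep l0 mg sg.
have mt : measurable_fun setT (fun x => trunc_at k (`|b x - c| `^ s)%:E).
  by apply: (measurable_trunc_at k (F := fun x => (`|b x - c| `^ s)%:E)); apply/measurable_EFinP.
have t0 x : 0 <= trunc_at k (`|b x - c| `^ s)%:E by apply: trunc_at_ge0; rewrite lee_fin powR_ge0.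
have mCE : measurable_fun setT (\1_(~` E) : Rn R n -> R) by apply: measurable_indic; exact: measurableC.
apply: (@le_trans _ _ (\int[mu]_(x in hcube a l)
   (`|b x - c| `^ s * \1_E x + k%:R * \1_(~` E) x)%:E)%E).
  apply: le_integralR; [exact: mH|exact: mt| |exact: t0|].
    by apply: measurable_funD; [exact: measurable_dist_powR|exact: measurable_funM].
  move=> x _; rewrite !indicE in_setC; case: (x \in E); rewrite /= ?mulr1 ?mulr0 ?addr0 ?add0r.
    by rewrite -lee_fin; apply: trunc_at_le; rewrite lee_fin powR_ge0.
  by apply: trunc_at_leN; rewrite lee_fin powR_ge0.
rewrite ge0_integralDR; [|exact: mH|exact: measurable_dist_powR|exact: measurable_funM| |]; last 2 first.
- by move=> x; rewrite mulr_ge0 ?powR_ge0 ?indicE.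
- by move=> x; rewrite mulr_ge0 ?indicE.
apply: leeD.
  apply: le_trans (good_integral_le l0 mE gE _) _.
    by apply: le_trans oc _; rewrite ler_peMl ?(ltW ln0) //; lra.
  by rewrite lee_fin [leRHS]mulrDl; apply: lerD => //; rewrite ler_wpM2l.
rewrite ge0_integralZ; [|exact: mH|exact: mCE|by move=> x; rewrite indicE|exact: ler0n].
apply: (@le_trans _ _ (k%:R%:E * (3%:E * d%:E))%E).
  apply: lee_wpmul2l; first by rewrite lee_fin.
  apply: le_trans iE _; apply: lee_wpmul2l; first by rewrite lee_fin.
  rewrite integral_indic //; last exact: measurable_far.
  by rewrite setIC.
rewrite -!EFinM lee_fin /d.
have -> : k%:R * (3 * (e / (3 * k.+1%:R))) = e * (k%:R / k.+1%:R).
  have : k.+1%:R != 0 :> R by rewrite pnatr_eq0.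
  by move: (k.+1%:R) => y y0; field.
by rewrite ler_piMr ?(ltW e0) // ler_pdivrMr // mul1r ler_nat.
Qed.
End normalised.

(** The [L^s] form of the inequality. [b / M] satisfies the normalised hypothesis on every cube, and
    the factor [M^s] comes back by scaling. *)
Theorem john_nirenberg (s : R) : 1 <= s -> exists2 C : R, 0 < C &
  forall (b : Rn R n -> R) (M : R), 0 < M -> Defs.locally_integrable mu b ->
    (forall Q, is_cube Q -> mean_osc mu Q b <= M) ->
  forall a l, 0 < l ->
  (\int[mu]_(x in cube a l) (`|b x - avg mu (cube a l) b| `^ s)%:E <=
   (C * M `^ s * l ^+ n)%:E)%E.
Proof.
move=> s1; have s0 : 0 < s by lra.
pose D0 : R := (2 * 2 `^ (s + 1) + 4) `^ s.
exists (D0 + (D0 + (2 ^+ n * 2 `^ (s + 1)) `^ s)).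
  by rewrite !addr_gt0 ?powR_gt0 ?mulr_gt0 ?exprn_gt0 ?powR_gt0 // ?addr_gt0 ?mulr_gt0 ?powR_gt0.
move=> b M M0 ib ob a l l0.
have mb := locally_integrable_measurable ib.
pose b' x := M^-1 * b x.
have ib' : Defs.locally_integrable mu b'.
  move=> Q cQ; have mQ : measurable Q by have [a' [l' [_ ->]]] := cQ; exact: measurable_cube.
  apply: (eq_integrable mQ (fun x => (M^-1)%:E * (b x)%:E)%E) => //.
  by apply: integrableZl => //; exact: ib.
have avg' a' l' : 0 < l' -> avg mu (cube a' l') b' = M^-1 * avg mu (cube a' l') b.
  move=> l'0; have mQ := measurable_cube a' l'.
  have i : mu.-integrable (cube a' l') (EFin \o b) by apply: ib; exists a', l'.
  rewrite /avg mulrCA; congr (_ * _).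
  rewrite (eq_integral (fun x => (M^-1)%:E * (EFin \o b) x)%E) //.
  rewrite integralZl //= fineM //; exact: integrable_fin_num.
have osc' a' l' : 0 < l' -> osc b' a' l' (avg mu (cube a' l') b') <= l' ^+ n.
  move=> l'0; have ln0 : 0 < l' ^+ n by rewrite exprn_gt0.
  have cQ : is_cube (cube a' l' : set (Rn R n)) by exists a', l'.
  have := ob _ cQ; rewrite /mean_osc mu_cube ?(ltW l'0) //=.
  rewrite mulrC ler_pdivrMr // => H.
  rewrite /osc ge0_integral_hcube ?(ltW l'0) //; last first.
    by apply/measurable_EFinP; apply: measurable_dist_cst.
  rewrite avg' // (eq_integral (fun x => (M^-1 * `|b x - avg mu (cube a' l') b|)%:E)); last first.
    by move=> x _; rewrite /b' -mulrBr normrM ger0_norm // invr_ge0 ltW.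
  rewrite ge0_integralZ; [|exact: measurable_cube|exact: measurable_dist_cst
    |by move=> x; exact: normr_ge0|by rewrite invr_ge0 ltW].
  have /integrableP[_ fin] := integrable_cube_subr ib a' (avg mu (cube a' l') b) l'0.
  rewrite fineM //; last by rewrite ge0_fin_numE //; apply: integral_ge0 => x _; rewrite lee_fin.
  by rewrite /= mulrC ler_pdivrMr // mulrC.
have := normalised_john_nirenberg ib' osc' s1 a l0.
rewrite ge0_integral_hcube ?(ltW l0) //; last first.
  apply/measurable_EFinP; apply: (measurableT_comp (measurable_powR _)).
  exact: measurable_dist_cst.
rewrite (eq_integral (fun x => ((M^-1) `^ s * `|b x - avg mu (cube a l) b| `^ s)%:E)); last first.
  move=> x _; rewrite avg' // /b' -mulrBr normrM powRM //.
  by rewrite ger0_norm // invr_ge0 ltW.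
rewrite ge0_integralZ; [|exact: measurable_cube| |by move=> x; exact: powR_ge0|exact: powR_ge0]; last first.
  by apply: (measurableT_comp (measurable_powR _)); exact: measurable_dist_cst.
move=> /(lee_wpmul2l (_ : (0 <= (M `^ s)%:E)%E)); rewrite lee_fin powR_ge0 => /(_ isT).
rewrite muleA -EFinM -powRM ?invr_ge0 ?(ltW M0) // divff ?gt_eqF // powR1 mul1e => /le_trans; apply.
by rewrite -EFinM lee_fin le_eqVlt; apply/orP; left; apply/eqP; rewrite mulrA [_ * M `^ s]mulrC.
Qed.
End john_nirenberg.

(** * Geometric sums and averages *)

Section geometric_sums.
Context {R : realType}.

(** Read downwards, the terms that count are at most [1, 1/r, 1/r^2, ...]. The induction carries a
    second bound, the next term divided by [r - 1], which absorbs the new term as long as that is at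
    most 1. *)
Lemma sum_geometric_le1 (x r : R) (m : nat) : 0 < x -> 1 < r ->
  \sum_(j < m) (if x * r ^+ j <= 1 then x * r ^+ j else 0) <= r / (r - 1).
Proof.
move=> x0 r1; have r0 : 0 < r by lra.
have r10 : 0 < r - 1 by lra.
suff [] : \sum_(j < m) (if x * r ^+ j <= 1 then x * r ^+ j else 0) <= r / (r - 1) /\
   \sum_(j < m) (if x * r ^+ j <= 1 then x * r ^+ j else 0) <= x * r ^+ m / (r - 1) by [].
elim: m => [|m [IH1 IH2]].
  by rewrite !big_ord0 expr0 mulr1 !divr_ge0 // ltW.
rewrite !big_ord_recr /=; set S := \sum_(_ < m) _ in IH1 IH2 *.
have E : x * r ^+ m / (r - 1) + x * r ^+ m = x * r ^+ m.+1 / (r - 1).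
  by rewrite exprS; field; rewrite gt_eqF.
have xm0 : 0 < x * r ^+ m by rewrite mulr_gt0 ?exprn_gt0.
case: ifP => xm.
  have : S + x * r ^+ m <= x * r ^+ m.+1 / (r - 1) by rewrite -E lerD2r.
  move=> H; split => //; apply: le_trans H _; rewrite ler_pM2r ?invr_gt0 // exprS mulrCA.
  by rewrite ler_piMr // ltW.
rewrite addr0; split => //; apply: le_trans IH2 _.
by rewrite -E lerDl ltW.
Qed.

Lemma sum_geometric_ge1 (x r : R) (m : nat) : 0 < x -> 1 < r ->
  \sum_(j < m) (if x * r ^- j <= 1 then x * r ^- j else 0) <= r / (r - 1).
Proof.
move=> x0 r1; have r0 : 0 < r by lra.
case: m => [|m]; first by rewrite big_ord0; apply: divr_ge0; lra.
have x'0 : 0 < x * r ^- m by rewrite mulr_gt0 ?invr_gt0 ?exprn_gt0.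
rewrite (reindex_inj rev_ord_inj) /=; apply: le_trans (sum_geometric_le1 m.+1 x'0 r1).
apply: ler_sum => j _; rewrite subSS.
have -> : x * r ^- (m - j) = x * r ^- m * r ^+ j; last by [].
rewrite -mulrA; congr (_ * _).
have jm : (j <= m)%N by rewrite -ltnS.
move: (j : nat) jm => k km; rewrite -[in RHS](subnK km) exprD invfM mulfVK //.
by rewrite gt_eqF // exprn_gt0.
Qed.

(** With [w j = tau0 rho^j v] the terms are [v^p min (w^(s-p), w^(a-p))]. As [s < p < a], this
    decays geometrically in both directions from [w = 1], so the bound depends neither on [m] nor on
    the first scale [tau0]. *)
Lemma sum_dyadic_min (s p a rho : R) : 0 < s -> s < p -> p < a -> 1 < rho ->
  exists2 C : R, 0 < C & forall (m : nat) (tau0 v : R), 0 < tau0 -> 0 <= v ->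
  \sum_(j < m) (tau0 * rho ^+ j) `^ (- p) *
     Num.min ((tau0 * rho ^+ j * v) `^ s) ((tau0 * rho ^+ j * v) `^ a) <= C * v `^ p.
Proof.
move=> s0 sp pa rho1; have rho0 : 0 < rho by lra.
pose r1 := rho `^ (a - p); pose r2 := rho `^ (p - s).
have gt1 e : 0 < e -> 1 < rho `^ e.
  move=> e0; rewrite [ltLHS](_ : 1 = 1 `^ e); last by rewrite powR1.
  by apply: gt0_ltr_powR; rewrite // nnegrE ltW.
have r11 : 1 < r1 by apply: gt1; lra.
have r21 : 1 < r2 by apply: gt1; lra.
exists (r1 / (r1 - 1) + r2 / (r2 - 1)).
  by rewrite addr_gt0 // divr_gt0 //; lra.
move=> m tau0 v tau00; rewrite le_eqVlt => /predU1P[<-|v0].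
  rewrite big1; first by rewrite mulr_ge0 ?powR_ge0 // addr_ge0 // divr_ge0; lra.
  by move=> j _; rewrite mulr0 !powR0 ?minxx ?mulr0 //; rewrite gt_eqF //; lra.
pose w j := tau0 * rho ^+ j * v.
have tj0 j : 0 < tau0 * rho ^+ j by rewrite mulr_gt0 ?exprn_gt0.
have w0 j : 0 < w j by rewrite mulr_gt0.
pose x := (tau0 * v) `^ (a - p); pose y := (tau0 * v) `^ (s - p).
have x0 : 0 < x by rewrite powR_gt0 // mulr_gt0.
have y0 : 0 < y by rewrite powR_gt0 // mulr_gt0.
have powX e j : (rho ^+ j) `^ e = (rho `^ e) ^+ j by rewrite powR_exprn // ltW.
have wE e j : w j `^ e = (tau0 * v) `^ e * (rho `^ e) ^+ j.
  have tv0 : 0 <= tau0 * v by rewrite ltW // mulr_gt0.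
  have rj0 : 0 <= rho ^+ j by rewrite exprn_ge0 // ltW.
  by rewrite /w (mulrAC tau0) (powRM e tv0 rj0) powX.
have xE j : x * r1 ^+ j = w j `^ (a - p) by rewrite wE.
have yE j : y * r2 ^- j = w j `^ (s - p).
  by rewrite wE -/y -exprVn -[in LHS]powRN opprB.
apply: (@le_trans _ _ (v `^ p * \sum_(j < m) ((if x * r1 ^+ j <= 1 then x * r1 ^+ j else 0) +
   (if y * r2 ^- j <= 1 then y * r2 ^- j else 0)))); last first.
  rewrite mulrC ler_wpM2r ?powR_ge0 // big_split /=.
  by apply: lerD; [exact: sum_geometric_le1|exact: sum_geometric_ge1].
rewrite mulr_sumr; apply: ler_sum => j _; rewrite xE yE -/(w j).
have -> : (tau0 * rho ^+ j) `^ (- p) = v `^ p * w j `^ (- p).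
  rewrite /w (powRM (- p) (ltW (tj0 j)) (ltW v0)) mulrCA [v `^ (- p)]powRN.
  by rewrite divff ?mulr1 // gt_eqF // powR_gt0.
rewrite -mulrA ler_wpM2l ?powR_ge0 //.
have D e : w j `^ (- p) * w j `^ e = w j `^ (e - p).
  by rewrite -powRD ?(gt_eqF (w0 j)) ?implybT // addrC.
have le1 e : 0 <= e -> w j <= 1 -> w j `^ e <= 1.
  move=> e0 wj; rewrite [leRHS](_ : 1 = 1 `^ e); last by rewrite powR1.
  by apply: ler_powRl => //; rewrite ltW.
have [wj|wj] := leP (w j) 1.
  apply: (@le_trans _ _ (w j `^ (a - p))).
    by rewrite -D ler_wpM2l ?powR_ge0 // ge_min lexx orbT.
  rewrite le1 ?wj //; last by lra.
  by rewrite lerDl; case: ifP => // _; rewrite powR_ge0.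
apply: (@le_trans _ _ (w j `^ (s - p))).
  by rewrite -D ler_wpM2l ?powR_ge0 // ge_min lexx.
have -> : w j `^ (s - p) <= 1.
  rewrite -opprB powRN invf_le1 ?powR_gt0 //.
  rewrite [leLHS](_ : 1 = 1 `^ (p - s)); last by rewrite powR1.
  by apply: ler_powRl; rewrite ?ler01 ?ltW //; lra.
by rewrite lerDr; case: ifP => // _; rewrite powR_ge0.
Qed.

End geometric_sums.

(** * Products of powers in the unit interval *)

Section interpolation_products.
Context {R : realType}.

(** Replace both bases by the larger one: as it is at most 1 and [c + e >= 1], its power [c + e] is
    at most itself. *)
Lemma powR_prod_le (U V c e : R) : 0 <= U <= 1 -> 0 <= V <= 1 -> 0 < c -> 0 < e ->
  1 <= c + e -> U `^ c * V `^ e <= U + V.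
Proof.
move=> /andP[U0 U1] /andP[V0 V1] c0 e0 ce.
wlog UV : U V c e U0 U1 V0 V1 c0 e0 ce / U <= V.
  move=> H; have [UV|VU] := leP U V; first exact: H.
  by rewrite mulrC [U + V]addrC; apply: H => //; [rewrite addrC|exact: ltW].
apply: (@le_trans _ _ V); last by rewrite lerDr.
apply: (@le_trans _ _ (V `^ c * V `^ e)).
  by rewrite ler_wpM2r ?powR_ge0 //; apply: ler_powRl => //; rewrite ltW.
rewrite -powRD; last by apply/implyP => /eqP; lra.
rewrite -[leRHS]powRr1 //; apply: powR_le_exp => //; first by rewrite V0.
Qed.

(** Of the four products in the expansion, the one with the smallest total exponent has [1/a + 1/b],
    still at least 1. *)
Lemma powR_prod_sum_le (U V s a b : R) : 0 <= U <= 1 -> 0 <= V <= 1 ->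
  0 < s -> s <= a -> s <= b -> 1 <= a^-1 + b^-1 ->
  (U `^ s^-1 + U `^ a^-1) * (V `^ s^-1 + V `^ b^-1) <= 4 * (U + V).
Proof.
move=> U1 V1 s0 sa sb ab.
have a0 : 0 < a by lra.
have b0 : 0 < b by lra.
have sa' : a^-1 <= s^-1 by rewrite lef_pV2 ?posrE.
have sb' : b^-1 <= s^-1 by rewrite lef_pV2 ?posrE.
have [is0 ia0 ib0] : [/\ 0 < s^-1, 0 < a^-1 & 0 < b^-1] by rewrite !invr_gt0.
rewrite mulrDl !mulrDr.
have h1 := @powR_prod_le U V s^-1 s^-1 U1 V1 is0 is0.
have h2 := @powR_prod_le U V s^-1 b^-1 U1 V1 is0 ib0.
have h3 := @powR_prod_le U V a^-1 s^-1 U1 V1 ia0 is0.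
have h4 := @powR_prod_le U V a^-1 b^-1 U1 V1 ia0 ib0.
have {}h1 := h1 ltac:(lra). have {}h2 := h2 ltac:(lra).
have {}h3 := h3 ltac:(lra). have {}h4 := h4 ltac:(lra).
lra.
Qed.

End interpolation_products.

(** * Averages over a single cube *)

Section cube_averages.
Context d (T : measurableType d) (R : realType) (mu : {measure set T -> \bar R}).

(** [U] is the mean over [B] of [min ((tau f)^s, (tau f)^a)]; it is at most 1 because the minimum is
    below [(tau f)^p] and [tau^p <= V]. Where [tau f > 1] the minimum is [(tau f)^s] itself; where
    [tau f <= 1] it is [(tau f)^a], and Hoelder's inequality with exponent [a / s] bounds the mean
    of [(tau f)^s] by [U^(s/a)]. *)
Lemma avg_power_le (B : set T) (f : T -> R) (V tau p s a : R) :
  measurable B -> measurable_fun setT f -> (forall x, 0 <= f x) ->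
  0 < V -> mu B = V%:E -> 0 < tau -> tau `^ p <= V ->
  1 < s -> s < p -> p < a -> (\int[mu]_x (f x `^ p)%:E <= 1)%E ->
  exists U : R, [/\ 0 <= U <= 1,
    (\int[mu]_(x in B) (Num.min ((tau * f x) `^ s) ((tau * f x) `^ a))%:E = (V * U)%:E)%E &
    (\int[mu]_(x in B) (f x `^ s)%:E <= ((tau^-1 * (U `^ s^-1 + U `^ a^-1)) `^ s * V)%:E)%E].
Proof.
move=> mB mf f0 V0 muB tau0 tauV s1 sp pa fp.
have s0 : 0 < s by lra.
have p0 : 0 < p by lra.
have a0 : 0 < a by lra.
have mtf : measurable_fun setT (fun x => tau * f x) by exact: measurable_funM.
have mpow (g : T -> R) e : measurable_fun setT g -> measurable_fun setT (fun x => g x `^ e).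
  by move=> mg; exact: (measurableT_comp (measurable_powR _)).
pose Psi x := Num.min ((tau * f x) `^ s) ((tau * f x) `^ a).
have mPsi : measurable_fun setT Psi by apply: measurable_minr; exact: mpow.
have Psi0 x : 0 <= Psi x by rewrite le_min !powR_ge0.
have tf0 x : 0 <= tau * f x by rewrite mulr_ge0 // ltW.
have one (y : R) e : 0 <= e -> 1 <= y -> 1 <= y `^ e.
  move=> e0 y1; rewrite [leLHS](_ : 1 = 1 `^ e); last by rewrite powR1.
  exact: ler_powRl.
have Psip x : Psi x <= (tau * f x) `^ p.
  have [h|h] := leP (tau * f x) 1.
    apply: (@le_trans _ _ ((tau * f x) `^ a)); first by rewrite ge_min lexx orbT.
    by apply: powR_le_exp; rewrite ?tf0 // ltW.
  apply: (@le_trans _ _ ((tau * f x) `^ s)); first by rewrite ge_min lexx.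
  by apply: ler_powR; rewrite ltW.
have iPsi : (\int[mu]_(x in B) (Psi x)%:E <= V%:E)%E.
  apply: (@le_trans _ _ (\int[mu]_x ((tau `^ p) * (f x `^ p))%:E)%E).
    apply: (@le_trans _ _ (\int[mu]_x (Psi x)%:E)%E).
      apply: ge0_subset_integral; [exact: mB|exact: measurableT|exact/measurable_EFinP
        |by move=> x _; rewrite lee_fin|exact: subsetT].
    apply: le_integralR; [exact: measurableT|exact: mPsi| |exact: Psi0|].
      by apply: measurable_funM => //; exact: mpow.
    by move=> x _; rewrite -powRM // ltW.
  rewrite ge0_integralZ; [|exact: measurableT|exact: mpow|by move=> x; exact: powR_ge0|exact: powR_ge0].
  apply: (@le_trans _ _ (V%:E * 1)%E); last by rewrite mule1.
  apply: lee_pmul => //; rewrite ?lee_fin ?powR_ge0 //.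
  by apply: integral_ge0 => x _; rewrite lee_fin powR_ge0.
have iPsi0 : (0 <= \int[mu]_(x in B) (Psi x)%:E)%E by apply: integral_ge0 => x _; rewrite lee_fin.
pose U := V^-1 * fine (\int[mu]_(x in B) (Psi x)%:E)%E.
have UE : (\int[mu]_(x in B) (Psi x)%:E = (V * U)%:E)%E.
  rewrite /U mulrA divff ?gt_eqF // mul1r fineK // ge0_fin_numE //.
  exact: le_lt_trans iPsi (ltry _).
have U0 : 0 <= U.
  by apply: mulr_ge0; [rewrite invr_ge0 ltW|exact: fine_ge0].
have U1 : U <= 1 by move: iPsi; rewrite UE lee_fin ger_pMr.
exists U; split => //; first by rewrite U0.
pose psi1 x := if tau * f x <= 1 then (tau * f x) `^ s else 0.
have mpsi1 : measurable_fun setT psi1.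
  apply: measurable_fun_if => //; first exact: measurable_fun_ler.
    by apply: measurable_funTS; exact: mpow.
have psi10 x : 0 <= psi1 x by rewrite /psi1; case: ifP => // _; exact: powR_ge0.
have th0 : 0 < a / s by rewrite divr_gt0.
have th1 : 1 < a / s by rewrite ltr_pdivlMr // mul1r; lra.
have i1 : (\int[mu]_(x in B) (psi1 x)%:E <= (V * U `^ (s / a))%:E)%E.
  pose th' := (1 - (a / s)^-1)^-1.
  have th'0 : 0 < 1 - (a / s)^-1 by rewrite subr_gt0 invf_lt1.
  under eq_integral => x _ do rewrite -[psi1 x]mulr1 -[X in psi1 x * X]/(cst 1 x).
  have -> : V * U `^ (s / a) = (V * U) `^ (a / s)^-1 * V `^ th'^-1.
    rewrite /th' invrK powRM ?(ltW V0) // mulrAC invf_div -powRD ?(gt_eqF V0) ?implybT //.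
    by rewrite addrCA subrr addr0 powRr1 // ltW.
  apply: (@ge0_holder _ _ _ mu B psi1 (cst 1) (a / s) th'); [exact: mB|exact: mpsi1
    |exact: measurable_cst|exact: psi10|by move=> x; exact: ler01|exact: th0|by rewrite invr_gt0
    |by rewrite /th' invrK addrC subrK|exact: powR_ge0|exact: powR_ge0| |].
  - have VU0 : 0 <= V * U by rewrite mulr_ge0 // ltW.
    rewrite (powRVK VU0 (lt0r_neq0 th0)) -UE.
    apply: le_integralR; [exact: mB|exact: mpow|exact: mPsi|by move=> x; exact: powR_ge0|].
    move=> x _; rewrite /psi1; case: ifP => h; last by rewrite powR0 ?gt_eqF.
    rewrite -powRrM mulrCA divff ?gt_eqF // mulr1 le_min lexx andbT.
    by apply: powR_le_exp; rewrite ?tf0 //; lra.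
  - rewrite powRVK ?(ltW V0) //; last by rewrite /th' invr_neq0 // gt_eqF.
    rewrite (eq_integral (fun x => (cst 1%E x))); last by move=> x _; rewrite /= powR1.
    by rewrite integral_cst // mul1e muB.
have -> : (\int[mu]_(x in B) (f x `^ s)%:E = (tau^-1 `^ s)%:E * \int[mu]_(x in B) ((tau * f x) `^ s)%:E)%E.
  rewrite -ge0_integralZ; [|exact: mB|exact: mpow|by move=> x; exact: powR_ge0|exact: powR_ge0].
  apply: eq_integral => x _; rewrite -powRM ?invr_ge0 ?(ltW tau0) //.
  by rewrite mulrA mulVf ?gt_eqF // mul1r.
rewrite powRM ?invr_ge0 ?(ltW tau0) //; last by rewrite addr_ge0 ?powR_ge0.
rewrite -mulrA EFinM; apply: lee_wpmul2l; first by rewrite lee_fin powR_ge0.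
apply: (@le_trans _ _ (\int[mu]_(x in B) (Psi x + psi1 x)%:E)%E).
  apply: le_integralR; [exact: mB|exact: mpow|exact: measurable_funD|by move=> x; exact: powR_ge0|].
  move=> x _; rewrite /psi1; case: ifP => h; first by rewrite lerDr.
  rewrite addr0 le_min lexx /=; apply: ler_powR; last by lra.
  by rewrite ltW // ltNge h.
rewrite ge0_integralDR // UE.
apply: (@le_trans _ _ ((V * U)%:E + (V * U `^ (s / a))%:E)%E); first exact: leeD2l.
rewrite -EFinD lee_fin -mulrDr mulrC ler_pM2r //.
(* [U + U^(s/a)] is the sum of the [s]-th powers of [U^(1/s)] and [U^(1/a)]. *)
apply: le_trans (powR_superadd _ _ (ltW s1)); rewrite ?powR_ge0 //.
by rewrite powRVK ?gt_eqF // -powRrM mulrC.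
Qed.

End cube_averages.

(** * Weights on cubes *)

Section neighbourhoods.
Context {R : realType} {n : nat}.
Implicit Types (t : R) (x y u : Rn R n).

(** The closed ball of radius [t] for the sup norm, written as a cube so that the results on cubes
    apply. *)
Definition nbh t u : set (Rn R n) := cube (\row_i (tov u ord0 i - t)) (2 * t).

Lemma nbhP t u x : nbh t u x <-> forall i, `|tov x ord0 i - tov u ord0 i| <= t.
Proof.
by split=> H i; move: (H i); rewrite ?mxE ler_norml => /andP[? ?]; apply/andP; split; lra.
Qed.

Lemma nbh_sym t u x : nbh t u x <-> nbh t x u.
Proof. by rewrite !nbhP; split=> H i; rewrite distrC. Qed.

Lemma measurable_nbh t u : measurable (nbh t u).
Proof. exact: measurable_cube. Qed.

Definition nbh_graph t : set (Rn R n * Rn R n) := [set z | nbh t z.2 z.1].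

Lemma measurable_nbh_graph t : measurable (nbh_graph t).
Proof.
rewrite (_ : nbh_graph t = \bigcap_i
    ((fun z : Rn R n * Rn R n => `|tov z.1 ord0 i - tov z.2 ord0 i|) @^-1` `]-oo, t]%classic)).
  apply: fin_bigcap_measurable => // i _; rewrite -[X in measurable X]setTI.
  have mh : measurable_fun setT (fun z : Rn R n * Rn R n => `|tov z.1 ord0 i - tov z.2 ord0 i|).
    apply: measurableT_comp => //; apply: measurable_funB.
    - exact: (measurableT_comp (measurable_coord i) measurable_fst).
    - exact: (measurableT_comp (measurable_coord i) measurable_snd).
  by apply: mh => //; exact: measurable_itv.
apply/seteqP; split=> z /=.
  by move=> /nbhP H i _ /=; rewrite in_itv /=; exact: H.
by move=> H; apply/nbhP => i; have := H i I; rewrite /= in_itv.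
Qed.

Lemma measurable_indic_nbh d (T : measurableType d) t (f g : T -> Rn R n) :
  measurable_fun setT f -> measurable_fun setT g ->
  measurable_fun setT (fun w => \1_(nbh t (g w)) (f w) : R).
Proof.
move=> mf mg.
have -> : (fun w => \1_(nbh t (g w)) (f w) : R) = \1_(nbh_graph t) \o (fun w => (f w, g w)).
  by apply/funext => w /=; rewrite !indicE; congr (_%:R); congr nat_of_bool; apply/idP/idP; rewrite !inE.
apply: measurableT_comp; last exact: measurable_fun_pair.
by apply: measurable_indic; exact: measurable_nbh_graph.
Qed.

Lemma measurable_enorm d (T : measurableType d) (f g : T -> Rn R n) :
  measurable_fun setT f -> measurable_fun setT g ->
  measurable_fun setT (fun w => enorm (tov (f w) - tov (g w))).
Proof.
move=> mf mg; apply: (@measurableT_comp _ _ _ _ _ _ (@Num.sqrt R)).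
  by apply: continuous_measurable_fun; exact: sqrt_continuous.
apply: (@measurable_sum _ _ _ _ _ _ (fun i w => (tov (f w) - tov (g w)) ord0 i ^+ 2)) => i.
have -> : (fun w => (tov (f w) - tov (g w)) ord0 i ^+ 2) =
    (fun w => (tov (f w) ord0 i - tov (g w) ord0 i) ^+ 2).
  by apply/funext => w; rewrite !mxE.
apply: measurable_funX; apply: measurable_funB.
- exact: (measurableT_comp (measurable_coord i) mf).
- exact: (measurableT_comp (measurable_coord i) mg).
Qed.

Lemma enorm_ge0 (x : 'rV[R]_n) : 0 <= enorm x.
Proof. exact: sqrtr_ge0. Qed.

Lemma coord_le_enorm (x : 'rV[R]_n) i : `|x ord0 i| <= enorm x.
Proof.
rewrite -sqrtr_sqr /enorm ler_wsqrtr // (bigD1 i) //= lerDl.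
by apply: sumr_ge0 => j _; exact: sqr_ge0.
Qed.

End neighbourhoods.

Section cube_bounds.
Context {R : realType} {n : nat} (mu : {sigma_finite_measure set (Rn R n) -> \bar R})
  (Hmu : is_lebesgue mu).
Local Notation E := (Rn R n).
Local Notation mu2 := (mu \x mu)%E.

Lemma mu_nbh t (u : E) : 0 < t -> mu (nbh t u) = ((2 * t) ^+ n)%:E.
Proof. by move=> t0; rewrite mu_cube // ltW // mulr_gt0. Qed.

Lemma integral_prod (F G : E -> R) : measurable_fun setT F -> measurable_fun setT G ->
  (forall x, 0 <= F x) -> (forall x, 0 <= G x) ->
  (\int[mu2]_z (F z.1 * G z.2)%:E = (\int[mu]_x (F x)%:E) * (\int[mu]_x (G x)%:E))%E.
Proof.
move=> mF mG F0 G0.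
have mFG : measurable_fun setT (fun z : E * E => (F z.1 * G z.2)%:E).
  apply/measurable_EFinP/measurable_funM.
  - exact: (measurableT_comp mF measurable_fst).
  - exact: (measurableT_comp mG measurable_snd).
rewrite fubini_tonelli1 //; last by move=> z; rewrite lee_fin mulr_ge0.
rewrite /fubini_F /=.
have iG : (0 <= \int[mu]_x (G x)%:E)%E by apply: integral_ge0 => x _; rewrite lee_fin.
rewrite (eq_integral (fun x => (F x)%:E * \int[mu]_y (G y)%:E)%E); last first.
  by move=> x _; rewrite ge0_integralZ.
rewrite ge0_integralZr //; first exact/measurable_EFinP.
by move=> x _; rewrite lee_fin.
Qed.

Lemma integral_mul_indic (D : set E) (f : E -> R) :
  (\int[mu]_x (f x * \1_D x)%:E = \int[mu]_(x in D) (f x)%:E)%E.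
Proof.
rewrite [RHS]integral_mkcond; apply: eq_integral => x _; rewrite patchE indicE.
by case: ifPn => _; rewrite ?mulr1 ?mulr0.
Qed.

(* The only information on the weight [w] that enters the estimate of the
   potential with kernel [w(x, y) |x - y|^(alpha - n)]. *)
Definition cube_bound (s : R) (w : E * E -> R) (Bw : R) :=
  forall (t : R) (u : E) (f h : E -> R) (X Y : R), 0 < t ->
    measurable_fun setT f -> measurable_fun setT h ->
    (forall x, 0 <= f x) -> (forall x, 0 <= h x) -> 0 <= X -> 0 <= Y ->
    (\int[mu]_(x in nbh t u) (f x `^ s)%:E <= (X `^ s * (2 * t) ^+ n)%:E)%E ->
    (\int[mu]_(x in nbh t u) (h x `^ s)%:E <= (Y `^ s * (2 * t) ^+ n)%:E)%E ->
    (\int[mu2]_z (w z * ((h z.1 * \1_(nbh t u) z.1) * (f z.2 * \1_(nbh t u) z.2)))%:E <=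
     (Bw * (X * Y) * ((2 * t) ^+ n) ^+ 2)%:E)%E.

Lemma holder_average (D : set E) (V : R) (f g : E -> R) (s s' X G : R) :
  measurable D -> 0 <= V -> measurable_fun setT f -> measurable_fun setT g ->
  (forall x, 0 <= f x) -> (forall x, 0 <= g x) -> 0 < s -> 0 < s' -> s^-1 + s'^-1 = 1 ->
  0 <= X -> 0 <= G ->
  (\int[mu]_(x in D) (f x `^ s)%:E <= (X `^ s * V)%:E)%E ->
  (\int[mu]_(x in D) (g x `^ s')%:E <= (G `^ s' * V)%:E)%E ->
  (\int[mu]_(x in D) (f x * g x)%:E <= (X * G * V)%:E)%E.
Proof.
move=> mD V0 mf mg f0 g0 s0 s'0 ss' X0 G0 fX gG.
have -> : X * G * V = (X * V `^ s^-1) * (G * V `^ s'^-1).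
  rewrite mulrACA -powRD; last by rewrite ss' oner_eq0.
  by rewrite ss' powRr1.
apply: (ge0_holder mD mf mg f0 g0 s0 s'0 ss'); rewrite ?mulr_ge0 ?powR_ge0 //.
- by rewrite powRM ?powR_ge0 // powRVK ?gt_eqF.
- by rewrite powRM ?powR_ge0 // powRVK ?gt_eqF.
Qed.

Lemma conjugate_exponent (s : R) : 1 < s -> exists2 s', 1 < s' & s^-1 + s'^-1 = 1.
Proof.
move=> s1; have s0 : 0 < s by lra.
have i1 : s^-1 < 1 by rewrite invf_lt1.
have i0 : 0 < s^-1 by rewrite invr_gt0.
by exists (1 - s^-1)^-1; [rewrite invf_gt1; lra|rewrite invrK addrC subrK].
Qed.

Lemma integral_le_average (t : R) u (f : E -> R) (s X : R) : 0 < t -> 1 < s ->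
  measurable_fun setT f -> (forall x, 0 <= f x) -> 0 <= X ->
  (\int[mu]_(x in nbh t u) (f x `^ s)%:E <= (X `^ s * (2 * t) ^+ n)%:E)%E ->
  (\int[mu]_(x in nbh t u) (f x)%:E <= (X * (2 * t) ^+ n)%:E)%E.
Proof.
move=> t0 s1 mf f0 X0 fX; have [s' s'1 ss'] := conjugate_exponent s1.
have V0 : 0 <= (2 * t) ^+ n by rewrite exprn_ge0 // mulr_ge0 // ltW.
have one_le : (\int[mu]_(x in nbh t u) ((cst (1 : R) x) `^ s')%:E <= (1 `^ s' * (2 * t) ^+ n)%:E)%E.
  rewrite (eq_integral (fun x => (cst (1 : R) x)%:E)); last by move=> x _; rewrite /= powR1.
  by rewrite integral_one; [rewrite [leLHS](mu_nbh u t0) powR1 mul1r|exact: measurable_nbh].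
have s0 : 0 < s by lra.
have s'0 : 0 < s' by lra.
have := @holder_average (nbh t u) _ f (cst 1) s s' X 1 (measurable_nbh t u) V0 mf (measurable_cst _)
  f0 (fun=> ler01) s0 s'0 ss' X0 ler01 fX one_le.
rewrite mulr1; apply: le_trans; rewrite le_eqVlt; apply/orP; left; apply/eqP.
by apply: eq_integral => x _; rewrite mulr1.
Qed.

Lemma cube_bound1 (s : R) : 1 < s -> cube_bound s (cst 1) 1.
Proof.
move=> s1 t u f h X Y t0 mf mh f0 h0 X0 Y0 fX hY.
have mi : measurable_fun setT (\1_(nbh t u) : E -> R) by apply: measurable_indic; exact: measurable_nbh.
under eq_integral do rewrite /= mul1r.
rewrite (integral_prod (F := fun x => h x * \1_(nbh t u) x) (G := fun x => f x * \1_(nbh t u) x));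
  [|exact: measurable_funM|exact: measurable_funM|by move=> x; rewrite mulr_ge0|by move=> x; rewrite mulr_ge0].
rewrite !integral_mul_indic.
rewrite (_ : (1 * _ * _)%:E = (Y * (2 * t) ^+ n)%:E * (X * (2 * t) ^+ n)%:E)%E; last first.
  by rewrite -EFinM; congr EFin; ring.
by apply: lee_pmul; [apply: integral_ge0 => x _; rewrite lee_fin|apply: integral_ge0 => x _; rewrite lee_fin
  |exact: integral_le_average hY|exact: integral_le_average fX].
Qed.

(** Through the average [c] of [b] over the cube, [|b x - b y| <= |b x - c| + |b y - c|] splits the
    form into two products of single integrals. John-Nirenberg puts the factor [|b - c|] in [L^s'],
    which is why the functions enter through [L^s] averages with [s > 1]. *)
Lemma cube_bound_BMO (s : R) : 1 < s -> exists2 C : R, 0 < C &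
  forall (b : E -> R) (M : R), 0 < M -> Defs.locally_integrable mu b ->
    (forall Q, is_cube Q -> mean_osc mu Q b <= M) ->
    cube_bound s (fun z => `|b z.1 - b z.2|) (C * M).
Proof.
move=> s1; have [s' s'1 ss'] := conjugate_exponent s1.
have s0 : 0 < s by lra.
have s'0 : 0 < s' by lra.
have [C C0 HC] := john_nirenberg Hmu (ltW s'1).
exists (2 * C `^ s'^-1); first by rewrite mulr_gt0 // powR_gt0.
move=> b M M0 ib ob t u f h X Y t0 mf mh f0 h0 X0 Y0 fX hY.
have mb := locally_integrable_measurable ib.
pose c := avg mu (nbh t u) b.
pose g x := `|b x - c|.
have mg : measurable_fun setT g by apply: measurableT_comp => //; exact: measurable_funB.
have g0 x : 0 <= g x by exact: normr_ge0.
pose V := (2 * t) ^+ n.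
have V0 : 0 <= V by rewrite exprn_ge0 // mulr_ge0 // ltW.
pose G := C `^ s'^-1 * M.
have G0 : 0 <= G by rewrite mulr_ge0 ?powR_ge0 // ltW.
have gG : (\int[mu]_(x in nbh t u) (g x `^ s')%:E <= (G `^ s' * V)%:E)%E.
  rewrite /G powRM ?powR_ge0 ?(ltW M0) // powRVK ?(ltW C0) ?gt_eqF //.
  by apply: HC => //; rewrite mulr_gt0.
have mi : measurable_fun setT (\1_(nbh t u) : E -> R) by apply: measurable_indic; exact: measurable_nbh.
have hg (k : E -> R) Z : measurable_fun setT k -> (forall x, 0 <= k x) -> 0 <= Z ->
    (\int[mu]_(x in nbh t u) (k x `^ s)%:E <= (Z `^ s * V)%:E)%E ->
    (\int[mu]_x (k x * g x * \1_(nbh t u) x)%:E <= (Z * G * V)%:E)%E.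
  move=> mk k0 Z0 kZ; rewrite (integral_mul_indic (nbh t u) (fun x => k x * g x)).
  by apply: (holder_average (s := s) (s' := s')) => //; exact: measurable_nbh.
have h1 (k : E -> R) Z : measurable_fun setT k -> (forall x, 0 <= k x) -> 0 <= Z ->
    (\int[mu]_(x in nbh t u) (k x `^ s)%:E <= (Z `^ s * V)%:E)%E ->
    (\int[mu]_x (k x * \1_(nbh t u) x)%:E <= (Z * V)%:E)%E.
  by move=> mk k0 Z0 kZ; rewrite integral_mul_indic; exact: integral_le_average kZ.
pose F1 x := h x * g x * \1_(nbh t u) x. pose F2 x := f x * \1_(nbh t u) x.
pose F3 x := h x * \1_(nbh t u) x. pose F4 x := f x * g x * \1_(nbh t u) x.
have [mF1 mF2 mF3 mF4] : [/\ measurable_fun setT F1, measurable_fun setT F2,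
    measurable_fun setT F3 & measurable_fun setT F4].
  by split; do ?apply: measurable_funM.
have [F10 F20 F30 F40] : [/\ forall x, 0 <= F1 x, forall x, 0 <= F2 x,
    forall x, 0 <= F3 x & forall x, 0 <= F4 x].
  by split=> x; do ?apply: mulr_ge0.
have m1 (k : E -> R) : measurable_fun setT k -> measurable_fun setT (fun z : E * E => k z.1).
  by move=> mk; exact: (measurableT_comp mk measurable_fst).
have m2 (k : E -> R) : measurable_fun setT k -> measurable_fun setT (fun z : E * E => k z.2).
  by move=> mk; exact: (measurableT_comp mk measurable_snd).
apply: (@le_trans _ _ (\int[mu2]_z (F1 z.1 * F2 z.2 + F3 z.1 * F4 z.2)%:E)%E).
  apply: le_integralR; [exact: measurableT| | | |].
  - apply: measurable_funM.
      by apply: measurableT_comp => //; apply: measurable_funB; [exact: m1|exact: m2].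
    by apply: measurable_funM; [exact: (m1 F3)|exact: (m2 F2)].
  - by apply: measurable_funD; apply: measurable_funM; [exact: m1|exact: m2|exact: m1|exact: m2].
  - by move=> z; rewrite mulr_ge0 // mulr_ge0 ?(F30 z.1) ?(F20 z.2).
  move=> z _; rewrite /F1 /F4 -/(F3 z.1) -/(F2 z.2).
  have -> : h z.1 * g z.1 * \1_(nbh t u) z.1 * F2 z.2 +
     F3 z.1 * (f z.2 * g z.2 * \1_(nbh t u) z.2) = (g z.1 + g z.2) * (F3 z.1 * F2 z.2).
    by rewrite /F2 /F3; ring.
  rewrite ler_wpM2r ?mulr_ge0 // /g [`|b z.2 - c|]distrC.
  exact: ler_distD.
rewrite ge0_integralDR; [|exact: measurableT| | | |]; last 4 first.
- by apply: measurable_funM; [exact: m1|exact: m2].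
- by apply: measurable_funM; [exact: m1|exact: m2].
- by move=> z; rewrite mulr_ge0.
- by move=> z; rewrite mulr_ge0.
rewrite !integral_prod //.
rewrite (_ : (_ * _ * _)%:E = (Y * G * V)%:E * (X * V)%:E + (Y * V)%:E * (X * G * V)%:E)%E; last first.
  by rewrite -!EFinM -EFinD; congr EFin; rewrite /G -/V; ring.
by apply: leeD; (apply: lee_pmul; [apply: integral_ge0 => x _; rewrite lee_fin
  |apply: integral_ge0 => x _; rewrite lee_fin| |]);
  [exact: F10|exact: F20|exact: hg|exact: h1|exact: F30|exact: F40|exact: h1|exact: hg].
Qed.
End cube_bounds.

(** * Weighted Riesz potentials *)

(** The measure of the theorem is not bundled as sigma-finite, which Fubini's theorem asks for; the
    bundle is rebuilt on the same underlying function, and the equality lets results pass from one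
    to the other. *)
Lemma sigma_finite_pack d (T : measurableType d) (R : realType) (mu : {measure set T -> \bar R}) :
  sigma_finite setT mu ->
  exists nu : {sigma_finite_measure set T -> \bar R}, (nu : {measure set T -> \bar R}) = mu.
Proof.
case: mu => m [c1 c2] H.
pose mm : {measure set T -> \bar R} := Measure.Pack (Measure.Class c2).
pose h1 := isSFinite.Build _ _ _ m (sfinite_measure_sigma_finite (mu := mm) H).
pose h2 := isSigmaFinite.Build _ _ _ m H.
by exists (SigmaFiniteMeasure.Pack (SigmaFiniteMeasure.Class c2 h1 h2)).
Qed.

Section tonelli.
Context d1 d2 d3 (T1 : measurableType d1) (T2 : measurableType d2) (T3 : measurableType d3)
  (R : realType) (m1 : {sigma_finite_measure set T1 -> \bar R})
  (m2 : {sigma_finite_measure set T2 -> \bar R}) (m3 : {sigma_finite_measure set T3 -> \bar R}).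
Local Open Scope ereal_scope.

(** Allows a third variable to be exchanged with a pair of variables. *)
Lemma sigma_finite_prod : exists nu : {sigma_finite_measure set (T1 * T2)%type -> \bar R},
  (nu : set (T1 * T2) -> \bar R) = m1 \x m2.
Proof.
suff H : sigma_finite setT (m1 \x m2).
  have [nu nuE] := sigma_finite_pack (mu := [the {measure set (T1 * T2)%type -> \bar R} of m1 \x m2]) H.
  by exists nu; exact: (congr1 (fun m : {measure set (T1 * T2)%type -> \bar R} =>
    (m : set (T1 * T2) -> \bar R)) nuE).
have /sigma_finiteP[F [TF ndF Foo]] := sigma_finiteT m1.
have /sigma_finiteP[G [TG ndG Goo]] := sigma_finiteT m2.
exists (fun n => F n `*` G n).
  rewrite -setXTT TF TG predeqE => -[x y]; split=> [[/= [k _ Fx] [l _ Gy]]|[k _ [/= ? ?]]].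
    exists (maxn k l) => //; split.
    - by move: x Fx; exact/subsetPset/ndF/leq_maxl.
    - by move: y Gy; exact/subsetPset/ndG/leq_maxr.
  by split; exists k.
move=> k; have [? ?] := Foo k; have [? ?] := Goo k.
by split; [exact: measurableX|rewrite product_measure1E// lte_mul_pinfty// ge0_fin_numE].
Qed.

Lemma tonelli_prod_swap (G : (T1 * T2) * T3 -> R) : measurable_fun setT G ->
  (forall v, 0 <= G v)%R ->
  \int[m1 \x m2]_z \int[m3]_u (G (z, u))%:E = \int[m3]_u \int[m1 \x m2]_z (G (z, u))%:E.
Proof.
move=> mG G0; have [nu <-] := sigma_finite_prod.
apply: (@fubini_tonelli _ _ _ _ _ nu m3 (EFin \o G)); first exact/measurable_EFinP.
by move=> v; rewrite lee_fin.
Qed.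

Lemma measurable_tonelli_prodr (G : (T1 * T2) * T3 -> R) : measurable_fun setT G ->
  (forall v, 0 <= G v)%R ->
  measurable_fun setT (fun u => \int[m1 \x m2]_z (G (z, u))%:E).
Proof.
move=> mG G0; have [nu <-] := sigma_finite_prod.
apply: (@measurable_fun_fubini_tonelli_G _ _ _ _ _ nu (EFin \o G)); first exact/measurable_EFinP.
by move=> v; rewrite lee_fin.
Qed.

Lemma measurable_tonelli_prodl (G : T3 * (T1 * T2) -> \bar R) : measurable_fun setT G ->
  (forall v, 0 <= G v) ->
  measurable_fun setT (fun u => \int[m1 \x m2]_z (G (u, z))).
Proof.
move=> mG G0; have [nu <-] := sigma_finite_prod.
exact: (@measurable_fun_fubini_tonelli_F _ _ _ _ _ nu G).
Qed.

End tonelli.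

Section riesz_potential.
Context {R : realType} {n : nat} (mu : {sigma_finite_measure set (Rn R n) -> \bar R})
  (Hmu : is_lebesgue mu).
Local Notation E := (Rn R n).
Local Notation mu2 := (mu \x mu)%E.

(** The centres [u] whose cube contains both points include a cube of side [t], with upper corner
    the coordinatewise maximum of [x] and [y]. Averaging over centres thus sees every pair at
    distance at most [t]. *)
Lemma mu_nbh_inter t (x y : E) : 0 < t -> nbh t y x ->
  ((t ^+ n)%:E <= \int[mu]_u (\1_(nbh t u) x * \1_(nbh t u) y)%:E)%E.
Proof.
move=> t0 /nbhP xy.
pose a : 'rV[R]_n := \row_i (Num.max (tov x ord0 i) (tov y ord0 i) - t).
have <- : (\int[mu]_u (\1_(cube a t : set E) u)%:E = (t ^+ n)%:E)%E.
  rewrite integral_indic //; last exact: measurable_cube.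
  by rewrite setIT; exact: (mu_cube Hmu a (ltW t0)).
apply: le_integralR; [exact: measurableT| | |by move=> u; rewrite indicE|].
- by apply: measurable_indic; exact: measurable_cube.
- by apply: measurable_funM; apply: measurable_indic_nbh => //; exact: measurable_cst.
move=> u _; rewrite !indicE; case: (boolP (u \in cube a t)) => [|_]; last by rewrite mulr_ge0.
rewrite inE => ua; rewrite !mem_set ?mulr1 //; apply/nbhP => i.
  have := ua i; rewrite mxE => /andP[]; have := xy i; rewrite !ler_norml => /andP[].
  by case: (leP (tov x ord0 i) (tov y ord0 i)) => ? *; apply/andP; split; lra.
have := ua i; rewrite mxE => /andP[]; have := xy i; rewrite !ler_norml => /andP[].
by case: (leP (tov x ord0 i) (tov y ord0 i)) => ? *; apply/andP; split; lra.
Qed.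

Lemma integral_nbh_average t (F : E -> R) : 0 < t -> measurable_fun setT F ->
  (forall x, 0 <= F x) ->
  (\int[mu]_u \int[mu]_(x in nbh t u) (F x)%:E =
   ((2 * t) ^+ n)%:E * \int[mu]_x (F x)%:E)%E.
Proof.
move=> t0 mF F0.
rewrite (eq_integral (fun u => \int[mu]_x (F x * \1_(nbh t u) x)%:E)%E); last first.
  by move=> u _; rewrite integral_mul_indic.
have mG : measurable_fun setT (fun z : E * E => (F z.2 * \1_(nbh t z.1) z.2)%:E).
  apply/measurable_EFinP/measurable_funM; first exact: (measurableT_comp mF measurable_snd).
  by apply: measurable_indic_nbh; [exact: measurable_snd|exact: measurable_fst].
rewrite (@fubini_tonelli _ _ _ _ _ mu mu (fun z : E * E => (F z.2 * \1_(nbh t z.1) z.2)%:E));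
  [|exact: mG|by move=> z; rewrite lee_fin mulr_ge0 // indicE].
rewrite -ge0_integralZ; [|exact: measurableT|exact: mF|exact: F0|by rewrite exprn_ge0 // mulr_ge0 // ltW].
apply: eq_integral => x _ /=.
rewrite (eq_integral (fun u => (F x * \1_(nbh t x) u)%:E)); last first.
  move=> u _; rewrite !indicE; congr (_ * _%:R)%:E; congr nat_of_bool.
  by apply/idP/idP; rewrite !inE => /nbh_sym.
rewrite ge0_integralZ; [|exact: measurableT|by apply: measurable_indic; exact: measurable_nbh
  |by move=> u; rewrite indicE|exact: F0].
rewrite integral_indic //; last exact: measurable_nbh.
by rewrite setIT [X in (_ * X)%E](mu_nbh Hmu x t0) -EFinM mulrC.
Qed.

Lemma measurable_nbh_integral t (F : E -> R) : measurable_fun setT F ->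
  (forall x, 0 <= F x) ->
  measurable_fun setT (fun u => \int[mu]_(x in nbh t u) (F x)%:E)%E.
Proof.
move=> mF F0.
have mG : measurable_fun setT (fun z : E * E => (F z.2 * \1_(nbh t z.1) z.2)%:E).
  apply/measurable_EFinP/measurable_funM; first exact: (measurableT_comp mF measurable_snd).
  by apply: measurable_indic_nbh; [exact: measurable_snd|exact: measurable_fst].
have -> : (fun u => \int[mu]_(x in nbh t u) (F x)%:E)%E =
    fubini_F mu (fun z : E * E => (F z.2 * \1_(nbh t z.1) z.2)%:E).
  by apply/funext => u; rewrite /fubini_F /= integral_mul_indic.
apply: measurable_fun_fubini_tonelli_F; first exact: mG.
by move=> z; rewrite lee_fin mulr_ge0 ?indicE.
Qed.

(** For [s < p < a] this lies below [v^p], by a power of [v] when [v < 1] and of [1/v] when [v > 1];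
    that margin makes sums over scales converge. *)
Definition cut (s a v : R) : R := Num.min (v `^ s) (v `^ a).

Lemma cut_ge0 s a v : 0 <= cut s a v.
Proof. by rewrite le_min !powR_ge0. Qed.

Lemma measurable_cut d (T : measurableType d) s a (f : T -> R) : measurable_fun setT f ->
  measurable_fun setT (fun x => cut s a (f x)).
Proof.
by move=> mf; apply: measurable_minr; exact: (measurableT_comp (measurable_powR _)).
Qed.

(* On the diagonal [riesz] is [0], since [0^-1 = 0], instead of infinity. *)
Definition riesz (alpha : R) (z : E * E) : R :=
  (enorm (tov z.1 - tov z.2) `^ (n%:R - alpha))^-1.

Lemma riesz_ge0 alpha z : 0 <= riesz alpha z.
Proof. by rewrite invr_ge0 powR_ge0. Qed.

Lemma measurable_riesz alpha : measurable_fun setT (riesz alpha).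
Proof.
rewrite (_ : riesz alpha = (fun z => enorm (tov z.1 - tov z.2) `^ (alpha - n%:R))).
  apply: (measurableT_comp (measurable_powR _)).
  exact: (measurable_enorm measurable_fst measurable_snd).
by apply/funext => z; rewrite /riesz -powRN opprB.
Qed.

(** * The bilinear form dual to the weighted potential *)

Section form.
Variables (alpha p q s a b Bw : R) (w : E * E -> R) (f h : E -> R).
Hypotheses (n0 : (0 < n)%N) (alpha0 : 0 < alpha) (s1 : 1 < s) (sp : s < p) (sq : s < q)
  (pa : p < a) (qb : q < b) (pq : p^-1 + q^-1 = 1 + alpha / n%:R) (ab : 1 <= a^-1 + b^-1)
  (Bw0 : 0 <= Bw) (mw : measurable_fun setT w) (w0 : forall z, 0 <= w z)
  (Hw : cube_bound mu s w Bw)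
  (mf : measurable_fun setT f) (f0 : forall x, 0 <= f x)
  (mh : measurable_fun setT h) (h0 : forall x, 0 <= h x)
  (fp : (\int[mu]_x (f x `^ p)%:E <= 1)%E) (hq : (\int[mu]_x (h x `^ q)%:E <= 1)%E).

Let tauf t := t `^ (n%:R / p).
Let tauh t := t `^ (n%:R / q).

(** Multiplied by [tauf t = t^(n/p)] and [tauh t = t^(n/q)], the functions have local integrals of
    powers at most the volume of the cube. By the relation between the exponents,
    [t^n / (tauf t tauh t) = t^(-alpha)], the factor that the potential kernel needs;
    [powR_prod_sum_le] turns the product of averages into a sum. *)
Lemma cube_form_le t (u : E) : 0 < t ->
  (\int[mu2]_z (w z * ((h z.1 * \1_(nbh t u) z.1) * (f z.2 * \1_(nbh t u) z.2)))%:E <=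
   (4 * 2 ^+ n * Bw * t `^ (- alpha))%:E *
   (\int[mu]_(x in nbh t u) (cut s a (tauf t * f x))%:E +
    \int[mu]_(x in nbh t u) (cut s b (tauh t * h x))%:E))%E.
Proof.
move=> t0; pose V := (2 * t) ^+ n.
have [s1_ sp_ sq_ pa_ qb_] : [/\ 1 < s, s < p, s < q, p < a & q < b] by [].
have V0 : 0 < V by rewrite exprn_gt0 // mulr_gt0.
have tV : t ^+ n <= V by rewrite /V exprMn ler_peMl ?exprn_ge0 ?(ltW t0) // exprn_ege1 // ler1n.
have tau_pow e : 0 < e -> (t `^ (n%:R / e)) `^ e <= V.
  by move=> e0; rewrite -powRrM divfK ?gt_eqF // powR_mulrn ?(ltW t0).
have p0 : 0 < p by lra.
have q0 : 0 < q by lra.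
have tf : 0 < tauf t by exact: powR_gt0.
have th : 0 < tauh t by exact: powR_gt0.
have [U [U01 UE Uf]] := avg_power_le (measurable_nbh t u) mf f0 V0 (mu_nbh Hmu u t0) tf
   (tau_pow p p0) s1 sp pa fp.
have [W [W01 WE Wh]] := avg_power_le (measurable_nbh t u) mh h0 V0 (mu_nbh Hmu u t0) th
   (tau_pow q q0) s1 sq qb hq.
have [U0 W0] : 0 <= U /\ 0 <= W by move: U01 W01 => /andP[? _] /andP[? _].
set X := (tauf t)^-1 * _ in Uf; set Y := (tauh t)^-1 * _ in Wh.
have X0 : 0 <= X by rewrite mulr_ge0 ?invr_ge0 ?(ltW tf) // addr_ge0 ?powR_ge0.
have Y0 : 0 <= Y by rewrite mulr_ge0 ?invr_ge0 ?(ltW th) // addr_ge0 ?powR_ge0.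
apply: le_trans (Hw t0 mf mh f0 h0 X0 Y0 Uf Wh) _.
rewrite -/V [X in (_ <= _ * (X + _))%E]UE [X in (_ <= _ * (_ + X))%E]WE -EFinD -EFinM lee_fin.
have XY : X * Y <= (tauf t)^-1 * (tauh t)^-1 * (4 * (U + W)).
  rewrite /X /Y mulrACA ler_wpM2l ?mulr_ge0 ?invr_ge0 ?(ltW tf) ?(ltW th) //.
  by apply: powR_prod_sum_le => //; lra.
have tauE : (tauf t)^-1 * (tauh t)^-1 * V = 2 ^+ n * t `^ (- alpha).
  have tn : t `^ (- alpha) = t ^+ n * (tauf t)^-1 * (tauh t)^-1.
    rewrite /tauf /tauh -!powRN -powR_mulrn ?ltW // -!powRD ?(gt_eqF t0) ?implybT //.
    congr powR; have n0' : n%:R != 0 :> R by rewrite pnatr_eq0 -lt0n.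
    have : n%:R * (p^-1 + q^-1) = n%:R + alpha by rewrite pq; field.
    by lra.
  by rewrite tn /V exprMn; ring.
apply: (@le_trans _ _ (Bw * ((tauf t)^-1 * (tauh t)^-1 * (4 * (U + W))) * V ^+ 2)).
  by apply: ler_wpM2r; [rewrite exprn_ge0 // ltW|exact: ler_wpM2l].
rewrite le_eqVlt; apply/orP; left; apply/eqP.
transitivity (4 * Bw * ((tauf t)^-1 * (tauh t)^-1 * V) * (V * U + V * W)); first by ring.
by rewrite tauE; ring.
Qed.

(** The estimate on one cube is integrated over all centres. On the left a pair at distance at most
    [t] is seen by a set of centres of measure at least [t^n]; on the right each point is seen by
    measure [(2 t)^n]. The quotient turns [2^n] into [4^n]. *)
Lemma scale_form_le t : 0 < t ->
  (\int[mu2]_z (w z * (h z.1 * f z.2) * \1_(nbh_graph t) z)%:E <=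
   (4 * 4 ^+ n * Bw * t `^ (- alpha))%:E *
   (\int[mu]_x (cut s a (tauf t * f x))%:E + \int[mu]_x (cut s b (tauh t * h x))%:E))%E.
Proof.
move=> t0; have tn0 : 0 < t ^+ n by rewrite exprn_gt0.
rewrite -(@lee_pmul2l _ (t ^+ n)%:E) ?lte_fin //.
have ci (c : R) (k : E -> R) (D : set E) : (0 <= \int[mu]_(x in D) (cut s c (k x))%:E)%E.
  by apply: integral_ge0 => x _; rewrite lee_fin cut_ge0.
have mci (c tau : R) (k : E -> R) : measurable_fun setT k ->
    measurable_fun setT (fun u => \int[mu]_(x in nbh t u) (cut s c (tau * k x))%:E)%E.
  move=> mk; apply: measurable_nbh_integral; last by move=> x; exact: cut_ge0.
  by apply: measurable_cut; exact: measurable_funM.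
have m1 (k : E -> R) : measurable_fun setT k -> measurable_fun setT (fun z : E * E => k z.1).
  by move=> mk; exact: (measurableT_comp mk measurable_fst).
have m2 (k : E -> R) : measurable_fun setT k -> measurable_fun setT (fun z : E * E => k z.2).
  by move=> mk; exact: (measurableT_comp mk measurable_snd).
pose F (z : E * E) := w z * (h z.1 * f z.2).
have mF : measurable_fun setT F.
  by apply: measurable_funM => //; apply: measurable_funM; [exact: m1|exact: m2].
have F0 z : 0 <= F z by rewrite !mulr_ge0.
pose G (v : (E * E) * E) := F v.1 * (\1_(nbh t v.2) v.1.1 * \1_(nbh t v.2) v.1.2).
have mG : measurable_fun setT G.
  apply: measurable_funM; first exact: (measurableT_comp mF measurable_fst).
  apply: measurable_funM; apply: measurable_indic_nbh; try exact: measurable_snd.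
  - exact: (measurableT_comp measurable_fst measurable_fst).
  - exact: (measurableT_comp measurable_snd measurable_fst).
have G0 v : 0 <= G v by rewrite mulr_ge0 ?mulr_ge0 ?indicE.
have mgr : measurable_fun setT (\1_(nbh_graph t) : E * E -> R).
  by apply: measurable_indic; exact: measurable_nbh_graph.
rewrite -ge0_integralZ; [|exact: measurableT|exact: measurable_funM
   |by move=> z; apply: mulr_ge0; [exact: F0|rewrite indicE]|exact: ltW].
apply: (@le_trans _ _ (\int[mu2]_z \int[mu]_u (G (z, u))%:E)%E).
  apply: ge0_le_integral; [exact: measurableT| | | |].
  - move=> z _; rewrite lee_fin; apply: mulr_ge0; first exact: ltW.
    by apply: mulr_ge0; [exact: F0|rewrite indicE].
  - by apply/measurable_EFinP/measurable_funM => //; exact: measurable_funM.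
  - apply: (@measurable_fun_fubini_tonelli_F _ _ _ _ _ mu (EFin \o G)).
      exact/measurable_EFinP.
    by move=> v; rewrite lee_fin.
  move=> z _; rewrite /G /= ge0_integralZ; [|exact: measurableT| |by move=> u; rewrite mulr_ge0 ?indicE|exact: F0]; last first.
    by apply: measurable_funM; apply: measurable_indic_nbh => //; exact: measurable_cst.
  rewrite mulrCA EFinM; apply: lee_wpmul2l; first by rewrite lee_fin; exact: F0.
  rewrite indicE; case: (boolP (z \in nbh_graph t)); last first.
    by move=> _; rewrite mulr0; apply: integral_ge0 => u _; rewrite lee_fin mulr_ge0 ?indicE.
  rewrite inE mulr1 => zt; exact: mu_nbh_inter.
have swap : (\int[mu2]_z \int[mu]_u (G (z, u))%:E = \int[mu]_u \int[mu2]_z (G (z, u))%:E)%E.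
  exact: tonelli_prod_swap.
rewrite swap.
apply: (@le_trans _ _ (\int[mu]_u ((4 * 2 ^+ n * Bw * t `^ (- alpha))%:E *
   (\int[mu]_(x in nbh t u) (cut s a (tauf t * f x))%:E +
    \int[mu]_(x in nbh t u) (cut s b (tauh t * h x))%:E)))%E).
  have cc : (0 <= (4 * 2 ^+ n * Bw * t `^ (- alpha))%:E :> \bar R)%E.
    by rewrite lee_fin !mulr_ge0 ?powR_ge0 ?exprn_ge0.
  apply: ge0_le_integral; [exact: measurableT| | | |].
  - by move=> u _; apply: integral_ge0 => z _; rewrite lee_fin.
  - exact: measurable_tonelli_prodr.
  - by apply: emeasurable_funM => //; apply: emeasurable_funD; exact: mci.
  move=> u _; apply: le_trans (cube_form_le u t0).
  rewrite le_eqVlt; apply/orP; left; apply/eqP; apply: eq_integral => z _.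
  by congr EFin; rewrite /G /F /=; ring.
rewrite ge0_integralZl; [|exact: measurableT|by apply: emeasurable_funD; exact: mci
  |by move=> u _; apply: adde_ge0; exact: ci
  |by rewrite lee_fin !mulr_ge0 ?powR_ge0 ?exprn_ge0].
rewrite ge0_integralD; [|exact: measurableT
  |by move=> u _; exact: ci
  |exact: mci
  |by move=> u _; exact: ci
  |exact: mci].
have mcf : measurable_fun setT (fun x => cut s a (tauf t * f x)).
  by apply: measurable_cut; exact: measurable_funM.
have mch : measurable_fun setT (fun x => cut s b (tauh t * h x)).
  by apply: measurable_cut; exact: measurable_funM.
rewrite (integral_nbh_average t0 mcf (fun x => cut_ge0 _ _ _)).
rewrite (integral_nbh_average t0 mch (fun x => cut_ge0 _ _ _)).
set I1 := (\int[mu]_x _)%E; set I2 := (\int[mu]_x _)%E.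
have I10 : (0 <= I1)%E by apply: integral_ge0 => x _; rewrite lee_fin cut_ge0.
have I20 : (0 <= I2)%E by apply: integral_ge0 => x _; rewrite lee_fin cut_ge0.
rewrite -ge0_muleDr // !muleA -!EFinM le_eqVlt; apply/orP; left; apply/eqP; congr (_ * _)%E.
congr EFin; rewrite exprMn (_ : 4 ^+ n = 2 ^+ n * 2 ^+ n); first by ring.
by rewrite -exprMn -natrM.
Qed.
(** The constants of [sum_dyadic_min] are parameters because they must be fixed before [w], [f] and
    [h] for the bound of [riesz_op] to be uniform. *)
Variables (C1 C2 : R) (alphan : alpha < n%:R) (C10 : 0 < C1) (C20 : 0 < C2).
Hypothesis H1 : forall (m : nat) (tau0 v : R), 0 < tau0 -> 0 <= v ->
  \sum_(j < m) (tau0 * (2 `^ (n%:R / p)) ^+ j) `^ (- p) *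
     cut s a (tau0 * (2 `^ (n%:R / p)) ^+ j * v) <= C1 * v `^ p.
Hypothesis H2 : forall (m : nat) (tau0 v : R), 0 < tau0 -> 0 <= v ->
  \sum_(j < m) (tau0 * (2 `^ (n%:R / q)) ^+ j) `^ (- q) *
     cut s b (tau0 * (2 `^ (n%:R / q)) ^+ j * v) <= C2 * v `^ q.

(** The scales from [2^-N] to [2^N], for [j] from 0 to [2 N]. *)
Let tt (N j : nat) : R := 2 ^- N * 2 ^+ j.
Let K : R := 2 `^ (n%:R - alpha) * (4 * 4 ^+ n * Bw).

Let tt0 N j : 0 < tt N j.
Proof. by rewrite mulr_gt0 ?invr_gt0 ?exprn_gt0. Qed.

(** The least scale [tt N j] that contains the pair is not the first one, so the pair is further
    apart than half of it, and that single term of the sum dominates the kernel. *)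
Lemma riesz_le_dyadic_sum N (z : E * E) :
  nbh_graph (2 ^+ N) z -> ~ nbh_graph (2 ^- N) z ->
  riesz alpha z <= \sum_(j < (2 * N).+1)
    2 `^ (n%:R - alpha) * tt N j `^ (alpha - n%:R) * \1_(nbh_graph (tt N j)) z.
Proof.
move=> zN zN'.
have ex : exists j, (j <= 2 * N)%N && `[< nbh_graph (tt N j) z >].
  exists (2 * N)%N; rewrite leqnn /=; apply/asboolP.
  by rewrite /tt mul2n -addnn exprD mulrA mulVf ?mul1r // expf_neq0 ?pnatr_eq0.
case: (ex_minnP ex) => -[|j] /andP[jN /asboolP zj] minj.
  by exfalso; apply: zN'; move: zj; rewrite /tt expr0 mulr1.
have jN' : (j.+1 < (2 * N).+1)%N by [].
rewrite (bigD1 (Ordinal jN')) //= indicE mem_set // mulr1.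
apply: (@le_trans _ _ (2 `^ (n%:R - alpha) * tt N j.+1 `^ (alpha - n%:R))); last first.
  by rewrite lerDl; apply: sumr_ge0 => i _; rewrite !mulr_ge0 ?powR_ge0 ?indicE.
have [i hi] : exists i, tt N j < `|tov z.1 ord0 i - tov z.2 ord0 i|.
  apply: contrapT => /forallNP H; suff : (j.+1 <= j)%N by rewrite ltnn.
  apply: minj; rewrite (leq_trans _ jN) //=; apply/asboolP/nbhP => i.
  by rewrite leNgt; apply/negP/H.
have hd : tt N j <= enorm (tov z.1 - tov z.2).
  by apply: le_trans (coord_le_enorm _ i); rewrite !mxE ltW.
have E2 : tt N j = 2^-1 * tt N j.+1 by rewrite /tt exprS; field; rewrite expf_neq0 ?pnatr_eq0.
have -> : 2 `^ (n%:R - alpha) * tt N j.+1 `^ (alpha - n%:R) = (tt N j `^ (n%:R - alpha))^-1.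
  have i2 : 0 <= 2^-1 :> R by rewrite invr_ge0.
  rewrite [in RHS]E2 (powRM (n%:R - alpha) i2 (ltW (tt0 N j.+1))) invfM -!powRN opprB; congr (_ * _).
  by rewrite -powR_inv1 // -powRrM mulN1r opprB.
rewrite /riesz lef_pV2 ?posrE ?powR_gt0 //; last exact: lt_le_trans (tt0 N j) hd.
by apply: ler_powRl => //; rewrite ?ltW ?subr_gt0.
Qed.

(** The powers of the scale combine to [t^(alpha - n) t^(-alpha) = t^(-n)], which equals both
    [tauf t ^ (-p)] and [tauh t ^ (-q)]. The sum over scales can then be taken pointwise inside the
    integral, with a bound independent of [N]. *)
Lemma riesz_form_N_le N :
  (\int[mu2]_(z in nbh_graph (2 ^+ N) `\` nbh_graph (2 ^- N))
     (w z * riesz alpha z * (h z.1 * f z.2))%:E <= (K * (C1 + C2))%:E)%E.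
Proof.
have n0' : n%:R != 0 :> R by rewrite pnatr_eq0 -lt0n.
have p0 : 0 < p by move: s1 sp; lra.
have q0 : 0 < q by move: s1 sq; lra.
have m1 (k : E -> R) : measurable_fun setT k -> measurable_fun setT (fun z : E * E => k z.1).
  by move=> mk; exact: (measurableT_comp mk measurable_fst).
have m2 (k : E -> R) : measurable_fun setT k -> measurable_fun setT (fun z : E * E => k z.2).
  by move=> mk; exact: (measurableT_comp mk measurable_snd).
pose F (z : E * E) := w z * (h z.1 * f z.2).
have mF : measurable_fun setT F.
  by apply: measurable_funM => //; apply: measurable_funM; [exact: m1|exact: m2].
have F0 z : 0 <= F z by rewrite !mulr_ge0.
have mA : measurable (nbh_graph (2 ^+ N) `\` nbh_graph (2 ^- N) : set (E * E)).
  by apply: measurableD; exact: measurable_nbh_graph.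
pose c j := 2 `^ (n%:R - alpha) * tt N j `^ (alpha - n%:R).
have c0 j : 0 <= c j by rewrite mulr_ge0 ?powR_ge0.
have mG j : measurable_fun setT (fun z => F z * \1_(nbh_graph (tt N j)) z).
  by apply: measurable_funM => //; apply: measurable_indic; exact: measurable_nbh_graph.
have G0 j z : 0 <= F z * \1_(nbh_graph (tt N j)) z by rewrite mulr_ge0 ?indicE.
apply: (@le_trans _ _ (\sum_(j < (2 * N).+1) (c j)%:E *
    \int[mu2]_z (F z * \1_(nbh_graph (tt N j)) z)%:E)%E).
  have -> : (\sum_(j < (2 * N).+1) (c j)%:E * \int[mu2]_z (F z * \1_(nbh_graph (tt N j)) z)%:E =
     \int[mu2]_z (\sum_(j < (2 * N).+1) (c j * (F z * \1_(nbh_graph (tt N j)) z)))%:E)%E.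
    under [RHS]eq_integral do rewrite -sumEFin.
    rewrite ge0_integral_sum; [|exact: measurableT
      |by move=> j; apply/measurable_EFinP; exact: measurable_funM
      |by move=> j z _; rewrite lee_fin mulr_ge0].
    by apply: eq_bigr => j _; rewrite ge0_integralZ.
  apply: (@le_trans _ _ (\int[mu2]_(z in nbh_graph (2 ^+ N) `\` nbh_graph (2 ^- N))
      (\sum_(j < (2 * N).+1) (c j * (F z * \1_(nbh_graph (tt N j)) z)))%:E)%E); last first.
    apply: ge0_subset_integral; [exact: mA|exact: measurableT| | |exact: subsetT].
    - by apply/measurable_EFinP/measurable_sum => j; exact: measurable_funM.
    - by move=> z _; rewrite lee_fin sumr_ge0 // => j _; rewrite mulr_ge0.
  apply: le_integralR; [exact: mA| | | |].
  - apply: measurable_funM; last by apply: measurable_funM; [exact: m1|exact: m2].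
    by apply: measurable_funM => //; exact: measurable_riesz.
  - by apply: measurable_sum => j; exact: measurable_funM.
  - by move=> z; rewrite !mulr_ge0 // riesz_ge0.
  move=> z [zN zN'].
  rewrite [leLHS](_ : _ = F z * riesz alpha z); last by rewrite /F; ring.
  rewrite [leRHS](_ : _ = F z * \sum_(j < (2 * N).+1) (c j * \1_(nbh_graph (tt N j)) z)); last first.
    by rewrite mulr_sumr; apply: eq_bigr => j _; ring.
  by rewrite ler_wpM2l //; exact: riesz_le_dyadic_sum.
pose A j := (\int[mu]_x (tauf (tt N j) `^ (- p) * cut s a (tauf (tt N j) * f x))%:E)%E.
pose B j := (\int[mu]_x (tauh (tt N j) `^ (- q) * cut s b (tauh (tt N j) * h x))%:E)%E.
have mcf j : measurable_fun setT (fun x => cut s a (tauf (tt N j) * f x)).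
  by apply: measurable_cut; exact: measurable_funM.
have mch j : measurable_fun setT (fun x => cut s b (tauh (tt N j) * h x)).
  by apply: measurable_cut; exact: measurable_funM.
have A0 j : (0 <= A j)%E.
  by apply: integral_ge0 => x _; rewrite lee_fin mulr_ge0 ?powR_ge0 ?cut_ge0.
have B0 j : (0 <= B j)%E.
  by apply: integral_ge0 => x _; rewrite lee_fin mulr_ge0 ?powR_ge0 ?cut_ge0.
have K0 : 0 <= K by rewrite !mulr_ge0 ?powR_ge0 ?exprn_ge0.
apply: (@le_trans _ _ (\sum_(j < (2 * N).+1) K%:E * (A j + B j))%E).
  apply: lee_sum => j _.
  apply: (@le_trans _ _ ((c j)%:E * ((4 * 4 ^+ n * Bw * tt N j `^ (- alpha))%:E *
   (\int[mu]_x (cut s a (tauf (tt N j) * f x))%:E +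
     \int[mu]_x (cut s b (tauh (tt N j) * h x))%:E)))%E).
    by apply: lee_wpmul2l; [rewrite lee_fin|exact: scale_form_le].
  rewrite muleA -EFinM.
  have tn : tt N j `^ (alpha - n%:R) * tt N j `^ (- alpha) = tt N j `^ (- n%:R).
    rewrite -powRD ?(gt_eqF (tt0 N j)) ?implybT //; congr powR; lra.
  have tp : tauf (tt N j) `^ (- p) = tt N j `^ (- n%:R).
    by rewrite -powRrM; congr powR; field; rewrite gt_eqF.
  have tq : tauh (tt N j) `^ (- q) = tt N j `^ (- n%:R).
    by rewrite -powRrM; congr powR; field; rewrite gt_eqF.
  rewrite (_ : c j * _ = K * tt N j `^ (- n%:R)); last by rewrite -tn /c /K; ring.
  rewrite EFinM -muleA; apply: lee_wpmul2l; first by rewrite lee_fin.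
  rewrite /A /B tp tq.
  rewrite ge0_integralZ; [|exact: measurableT|exact: mcf|by move=> x; exact: cut_ge0|exact: powR_ge0].
  rewrite ge0_integralZ; [|exact: measurableT|exact: mch|by move=> x; exact: cut_ge0|exact: powR_ge0].
  by rewrite ge0_muleDr // integral_ge0 // => x _; rewrite lee_fin cut_ge0.
rewrite -ge0_sume_distrr; last by move=> j _; rewrite adde_ge0.
rewrite [leRHS]EFinM; apply: lee_wpmul2l; first by rewrite lee_fin.
rewrite big_split /= EFinD.
have tautt e j : (tt N j) `^ e = (2 ^- N) `^ e * (2 `^ e) ^+ j.
  rewrite /tt powRM ?invr_ge0 ?exprn_ge0 //; congr (_ * _).
  exact: powR_exprn.
have bnd (C r e : R) (k : E -> R) (I : 'I_(2 * N).+1 -> \bar R) : 0 <= C -> 0 < r ->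
    measurable_fun setT k -> (forall x, 0 <= k x) ->
    (\int[mu]_x (k x `^ r)%:E <= 1)%E ->
    (forall j : 'I_(2 * N).+1, I j = \int[mu]_x ((tt N j `^ (n%:R / r)) `^ (- r) *
        cut s e (tt N j `^ (n%:R / r) * k x))%:E)%E ->
    (forall (m : nat) (tau0 v : R), 0 < tau0 -> 0 <= v ->
      \sum_(j < m) (tau0 * (2 `^ (n%:R / r)) ^+ j) `^ (- r) *
       cut s e (tau0 * (2 `^ (n%:R / r)) ^+ j * v) <= C * v `^ r) ->
    (\sum_(j < (2 * N).+1) I j <= C%:E)%E.
  move=> C0 r0 mk k0 ik IE HC; rewrite (eq_bigr _ (fun j _ => IE j)).
  have mc j : measurable_fun setT (fun x => (tt N j `^ (n%:R / r)) `^ (- r) *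
        cut s e (tt N j `^ (n%:R / r) * k x)).
    by apply: measurable_funM => //; apply: measurable_cut; exact: measurable_funM.
  rewrite -ge0_integral_sum; [|exact: measurableT|by move=> j; apply/measurable_EFinP; exact: mc
    |by move=> j x _; rewrite lee_fin mulr_ge0 ?powR_ge0 ?cut_ge0].
  under eq_integral do rewrite sumEFin.
  apply: (@le_trans _ _ (\int[mu]_x (C * k x `^ r)%:E)%E).
    apply: le_integralR; [exact: measurableT|by apply: measurable_sum => j; exact: mc| | |].
    - by apply: measurable_funM => //; exact: (measurableT_comp (measurable_powR _)).
    - by move=> x; apply: sumr_ge0 => j _; rewrite mulr_ge0 ?powR_ge0 ?cut_ge0.
    move=> x _; rewrite (eq_bigr (fun j : 'I_(2 * N).+1 =>
      ((2 ^- N) `^ (n%:R / r) * (2 `^ (n%:R / r)) ^+ j) `^ (- r) *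
      cut s e ((2 ^- N) `^ (n%:R / r) * (2 `^ (n%:R / r)) ^+ j * k x))); last first.
      by move=> j _; rewrite !tautt.
    by apply: HC => //; rewrite powR_gt0 // invr_gt0 exprn_gt0.
  rewrite ge0_integralZ; [|exact: measurableT|exact: (measurableT_comp (measurable_powR _))
    |by move=> x; exact: powR_ge0|exact: C0].
  by rewrite -[leRHS]mule1; apply: lee_wpmul2l; rewrite ?lee_fin.
apply: leeD.
- exact: (bnd C1 p a f A (ltW C10) p0 mf f0 fp (fun j => erefl) H1).
- exact: (bnd C2 q b h B (ltW C20) q0 mh h0 hq (fun j => erefl) H2).
Qed.

(** The annuli [A N] exhaust the complement of the diagonal, and on the diagonal [riesz] is 0 by
    convention, so monotone convergence applies. *)
Lemma riesz_form_le :
  (\int[mu2]_z (w z * riesz alpha z * (h z.1 * f z.2))%:E <= (K * (C1 + C2))%:E)%E.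
Proof.
pose A (N : nat) : set (E * E) := nbh_graph (2 ^+ N) `\` nbh_graph (2 ^- N).
have mA N : measurable (A N) by apply: measurableD; exact: measurable_nbh_graph.
have m1 (k : E -> R) : measurable_fun setT k -> measurable_fun setT (fun z : E * E => k z.1).
  by move=> mk; exact: (measurableT_comp mk measurable_fst).
have m2 (k : E -> R) : measurable_fun setT k -> measurable_fun setT (fun z : E * E => k z.2).
  by move=> mk; exact: (measurableT_comp mk measurable_snd).
pose F (z : E * E) := w z * riesz alpha z * (h z.1 * f z.2).
have mF : measurable_fun setT (EFin \o F).
  apply/measurable_EFinP; apply: measurable_funM; last by apply: measurable_funM; [exact: m1|exact: m2].
  by apply: measurable_funM => //; exact: measurable_riesz.
have F0 z : (0 <= (EFin \o F) z)%E by rewrite lee_fin !mulr_ge0 // riesz_ge0.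
have ndA : {homo A : N M / (N <= M)%N >-> (N <= M)%O}.
  move=> N M NM; apply/subsetPset => z [/nbhP zN zN']; split.
    by apply/nbhP => i; rewrite (le_trans (zN i)) // ler_weXn2l // ler1n.
  move=> /nbhP zM; apply: zN'; apply/nbhP => i; rewrite (le_trans (zM i)) //.
  by rewrite lef_pV2 ?posrE ?exprn_gt0 // ler_weXn2l // ler1n.
have -> : (\int[mu2]_z (EFin \o F) z = \int[mu2]_(z in \bigcup_N A N) (EFin \o F) z)%E.
  rewrite [RHS]integral_mkcond; apply: eq_integral => z _; rewrite patchE.
  case: ifPn => // /negP zA; rewrite /= /F.
  suff -> : riesz alpha z = 0 by rewrite mulr0 mul0r.
  have : tov z.1 = tov z.2.
    apply/rowP => i; apply/eqP; rewrite -subr_eq0 -normr_eq0; apply: contrapT => /negP zi.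
    apply: zA; rewrite inE.
    pose d := `|tov z.1 ord0 i - tov z.2 ord0 i|.
    have d0 : 0 < d by rewrite /d lt0r zi normr_ge0.
    pose B := \sum_i `|tov z.1 ord0 i - tov z.2 ord0 i|.
    (* [2^N] exceeds both the largest coordinate distance and [1 / d]. *)
    pose N := (Num.truncn (B + d^-1)).+1.
    have B0 : 0 <= B by apply: sumr_ge0.
    have dV : 0 < d^-1 by rewrite invr_gt0.
    have NB : B + d^-1 < 2 ^+ N.
      apply: (@lt_trans _ _ N%:R); first exact: truncnS_gt.
      by rewrite -natrX ltr_nat ltn_expl.
    exists N => //; split.
      apply/nbhP => k; apply: (@le_trans _ _ B); last by rewrite (le_trans _ (ltW NB)) // lerDl ltW.
      by rewrite /B (bigD1 k) //= lerDl; apply: sumr_ge0.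
    move=> /nbhP /(_ i); rewrite -/d leNgt => /negP; apply.
    rewrite -[ltRHS]invrK ltf_pV2 ?posrE ?invr_gt0 ?exprn_gt0 //.
    by rewrite (le_lt_trans _ NB) // lerDr.
  move=> zE; rewrite /riesz zE subrr.
  have -> : enorm (0 : 'rV[R]_n) = 0.
    by rewrite /enorm big1 ?sqrtr0 // => i _; rewrite mxE expr0n.
  by rewrite powR0 ?invr0 // subr_eq0 gt_eqF.
have cv := ge0_nondecreasing_set_cvg_integral (mu := [the {measure set (E * E)%type -> \bar R} of mu2])
  ndA mA (fun N => measurable_funTS mF) (fun N z _ => F0 z).
rewrite -(cvg_lim _ cv) //; apply: lime_le; last by apply: nearW => N; exact: riesz_form_N_le.
by apply/cvg_ex; eexists; exact: cv.
Qed.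
End form.

(** The Hardy-Littlewood-Sobolev inequality with a weight, obtained from the form by duality. [s]
    and [C] depend only on [n] and the exponents, so that they serve all weights at once. *)
Theorem riesz_op (alpha p p1 : R) : (0 < n)%N -> 0 < alpha -> 1 < p -> 0 < p1 ->
  p1^-1 = p^-1 - alpha / n%:R ->
  exists s C : R, [/\ 1 < s, 0 < C & forall (w : E * E -> R) (Bw : R), 0 <= Bw ->
    measurable_fun setT w -> (forall z, 0 <= w z) -> cube_bound mu s w Bw ->
    forall f : E -> R, measurable_fun setT f -> (forall x, 0 <= f x) ->
    (\int[mu]_x (f x `^ p)%:E <= 1)%E ->
    (\int[mu]_x ((\int[mu]_y (w (x, y) * riesz alpha (x, y) * f y)%:E) `^ p1) <=
     ((C * Bw) `^ p1)%:E)%E].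
Proof.
move=> n0 alpha0 p1_ p10 p1E.
have n0' : 0 < n%:R :> R by rewrite ltr0n.
have p0 : 0 < p by lra.
have an0 : 0 < alpha / n%:R by rewrite divr_gt0.
have ip : p^-1 < 1 by rewrite invf_lt1.
have ip1 : 0 < p1^-1 by rewrite invr_gt0.
pose q := (1 - p1^-1)^-1.
have iq : q^-1 = 1 - p1^-1 by rewrite invrK.
have iq0 : 0 < 1 - p1^-1 by lra.
have q1 : 1 < q by rewrite invf_gt1 //; lra.
have p11 : 1 < p1 by rewrite -[p1]invrK invf_gt1 //; lra.
pose s := (1 + Num.min p q) / 2.
have m1 : 1 < Num.min p q by rewrite lt_min p1_ q1.
have mp : Num.min p q <= p by rewrite ge_min lexx.
have mq : Num.min p q <= q by rewrite ge_min lexx orbT.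
have s1 : 1 < s by rewrite /s; lra.
have sp : s < p by rewrite /s; lra.
have sq : s < q by rewrite /s; lra.
(* The surplus of [1/p + 1/q] over 1 is [alpha / n]; each of [a] and [b] takes half of it, so that
   [1/a + 1/b = 1] while still [p < a] and [q < b]. *)
pose a := (p^-1 - alpha / n%:R / 2)^-1. pose b := (q^-1 - alpha / n%:R / 2)^-1.
have pa : p < a by rewrite -[p]invrK ltf_pV2 ?posrE; lra.
have qb : q < b by rewrite -[q]invrK ltf_pV2 ?posrE; rewrite iq; lra.
have ab : 1 <= a^-1 + b^-1 by rewrite !invrK; lra.
have pq : p^-1 + q^-1 = 1 + alpha / n%:R by rewrite iq; lra.
have alphan : alpha < n%:R by rewrite -[ltRHS]mul1r -ltr_pdivrMr //; lra.
have rho1 e : 0 < e -> 1 < 2 `^ (n%:R / e) :> R.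
  move=> e0; rewrite [ltLHS](_ : 1 = 1 `^ (n%:R / e)); last by rewrite powR1.
  by apply: gt0_ltr_powR; rewrite ?divr_gt0 ?nnegrE // ltr1n.
have s0 : 0 < s by lra.
have q0 : 0 < q by lra.
have [C1 C10 H1] := sum_dyadic_min s0 sp pa (rho1 p p0).
have [C2 C20 H2] := sum_dyadic_min s0 sq qb (rho1 q q0).
pose C := 2 `^ (n%:R - alpha) * (4 * 4 ^+ n) * (C1 + C2).
exists s, C; split => //.
  by rewrite !mulr_gt0 ?powR_gt0 ?exprn_gt0 ?addr_gt0.
move=> w Bw Bw0 mw w0 Hw f mf f0 fp.
pose k (z : E * E) := w z * riesz alpha z * f z.2.
have mk : measurable_fun setT k.
  apply: measurable_funM; last exact: (measurableT_comp mf measurable_snd).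
  by apply: measurable_funM => //; exact: measurable_riesz.
have k0 z : 0 <= k z by rewrite !mulr_ge0 // riesz_ge0.
pose F x := (\int[mu]_y (k (x, y))%:E)%E.
have mF : measurable_fun setT F.
  apply: (measurable_fun_fubini_tonelli_F (EFin \o k)); first exact/measurable_EFinP.
  by move=> z; rewrite lee_fin.
have F0 x : (0 <= F x)%E by apply: integral_ge0 => y _; rewrite lee_fin.
have C0 : 0 <= C * Bw.
  by rewrite mulr_ge0 // ltW // !mulr_gt0 ?powR_gt0 ?exprn_gt0 ?addr_gt0.
have pq1 : p1^-1 + q^-1 = 1 by rewrite iq; lra.
have /sigma_finiteP[S [ST ndS Sfin]] := sigma_finiteT mu.
apply: (Lp_duality (S := S) (F := F) (q := q) Sfin _ _ mF F0 p11 q1 pq1 C0).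
- by move=> i j /ndS/subsetPset.
- by rewrite ST.
move=> h mh h0 hq.
have := @riesz_form_le alpha p q s a b Bw w f h n0 s1 sp sq pa qb pq ab Bw0 mw w0 Hw
  mf f0 mh h0 fp hq C1 C2 alphan C10 C20 H1 H2.
rewrite (_ : (_ * _)%:E = (C * Bw)%:E); last by congr EFin; rewrite /C; ring.
apply: le_trans; rewrite le_eqVlt; apply/orP; left; apply/eqP; symmetry.
rewrite (@fubini_tonelli1 _ _ _ _ _ mu mu (fun z : E * E => (w z * riesz alpha z * (h z.1 * f z.2))%:E)); [| |].
- apply: eq_integral => x _; rewrite /fubini_F /F muleC -ge0_integralZ;
    [|exact: measurableT|by apply: (measurableT_comp mk); exact: measurable_fun_pair|by move=> y|exact: h0].
  by apply: eq_integral => y _; rewrite /k /=; congr EFin; ring.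
- apply/measurable_EFinP; apply: measurable_funM; first by apply: measurable_funM => //; exact: measurable_riesz.
  apply: measurable_funM; first exact: (measurableT_comp mh measurable_fst).
  exact: (measurableT_comp mf measurable_snd).
- by move=> z; rewrite lee_fin !mulr_ge0 // riesz_ge0.
Qed.
End riesz_potential.

(** * Test functions *)

Section test_functions.
Context {R : realType} {n : nat}.
Implicit Types (f : 'rV[R]_n -> R) (x y : 'rV[R]_n).

Lemma coord_le_norm x i : `|x ord0 i| <= `|x|.
Proof. by rewrite [leRHS]/Num.norm /= mx_normrE; apply: (le_bigmax _ _ (ord0, i)). Qed.

Lemma bounded_of_compact_support (K : set 'rV[R]_n) f : compact K -> continuous f ->
  (forall x, ~ K x -> f x = 0) -> exists2 M : R, 0 < M & forall x, `|f x| <= M.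
Proof.
move=> cK cf f0.
have /compact_bounded [M [_ HM]] : compact (f @` K).
  by apply: continuous_compact => //; exact: continuous_subspaceT.
exists (`|M| + 1); first by rewrite ltr_wpDl.
move=> x; have [Kx|Kx] := pselect (K x); last by rewrite f0 // normr0 addr_ge0.
apply: HM; last by exists x.
by rewrite (le_lt_trans (ler_norm M)) // ltrDl.
Qed.

Lemma mean_value_coord f (i : 'I_n) (M : R) :
  (forall x, derivable f x (delta_mx ord0 i)) -> continuous f ->
  (forall x, `|'D_(delta_mx ord0 i) f x| <= M) ->
  forall x (t : R), `|f (x + t *: delta_mx ord0 i) - f x| <= M * `|t|.
Proof.
move=> df cf fM.
suff pos x (t : R) : 0 <= t -> `|f (x + t *: delta_mx ord0 i) - f x| <= M * t.
  move=> x t; have [t0|t0] := leP 0 t; first by rewrite (ger0_norm t0) pos.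
  have := pos (x + t *: delta_mx ord0 i) (- t).
  by rewrite scaleNr addrK distrC (ltr0_norm t0); apply; rewrite oppr_ge0 ltW.
move=> t0.
pose e : 'rV[R]_n := delta_mx ord0 i.
pose g (u : R) := f (x + u *: e).
have dg (u : R) : is_derive u 1 g ('D_e f (x + u *: e)).
  have E : (fun h : R => h^-1 *: ((g \o shift u) (h *: 1) - g u)) =
           (fun h : R => h^-1 *: ((f \o shift (x + u *: e)) (h *: e) - f (x + u *: e))).
    apply/funext => h; congr (_ *: (_ - _)); rewrite /g /= /shift.
    by congr f; rewrite scalerDl [h *: 1]mulr1 addrCA.
  by split; [rewrite /derivable E; exact: df|rewrite /derive E].
have cg : continuous g.
  by move=> u; apply: differentiable_continuous; apply/derivable1_diffP; case: (dg u).
have [c _ E] := @MVT_segment R g (fun u => 'D_e f (x + u *: e)) 0 t t0 (fun u _ => dg u)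
  (continuous_subspaceT cg).
have <- : g 0 = f x by rewrite /g scale0r addr0.
by rewrite -/(g t) E subr0 normrM (ger0_norm t0) ler_wpM2r.
Qed.

(** Derivatives of [f] vanish off the closed support and so are bounded. One [L] serves as sup bound
    and as Lipschitz constant. *)
Lemma test_function_bounds f : smooth f -> compact_support f ->
  exists L A : R, [/\ 0 < L, 0 < A, forall x y, `|f x - f y| <= L * enorm (x - y),
    forall x, `|f x| <= L & forall x, f x != 0 -> forall i, `|x ord0 i| <= A].
Proof.
move=> sf cf; pose S := closure [set x | f x != 0].
have f0 x : ~ S x -> f x = 0.
  by move=> Sx; apply/eqP; apply/negPn/negP => fx; apply: Sx; exact: subset_closure.
have df0 v x : ~ S x -> 'D_v f x = 0.
  move=> Sx; have oS : open (~` S) by apply: closed_openC; exact: closed_closure.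
  have : \forall y \near x, f y = (cst 0 : 'rV[R]_n -> R) y.
    have : nbhs x (~` S) by exact: open_nbhs_nbhs.
    by apply: filterS => y Sy; exact: f0.
  by move=> /(near_eq_derive v) ->; rewrite derive_cst.
have [M M0 fM] := bounded_of_compact_support cf (proj1 (sf [::])) f0.
have HD i : exists D : R, 0 < D /\ forall x, `|'D_(delta_mx ord0 i) f x| <= D.
  by have [D D0 HD] := (bounded_of_compact_support cf (proj1 (sf [:: delta_mx ord0 i])) (df0 _)); exists D.
have [D D0 HD'] : exists2 D : R, 0 < D & forall i x, `|'D_(delta_mx ord0 i) f x| <= D.
  have [g Hg] := choice HD.
  exists (1 + \sum_i g i).
    by rewrite ltr_pwDl // sumr_ge0 // => i _; case: (Hg i) => /ltW.
  move=> i x; case: (Hg i) => _ /(_ x) /le_trans; apply.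
  rewrite (bigD1 i) //= addrCA lerDl addr_ge0 // sumr_ge0 // => j _.
  by case: (Hg j) => /ltW.
have [A [_ HA]] := compact_bounded cf.
exists (M + n%:R * D), (`|A| + 1); split.
- by rewrite ltr_pwDl // mulr_ge0 // ltW.
- by rewrite ltr_wpDl.
(* [w k] has the first [k] coordinates of [y] and the others of [x]: a path from [x] to [y] that
   changes one coordinate at a time. *)
- move=> x y; pose w k : 'rV[R]_n := \row_j (if (j < k)%N then y ord0 j else x ord0 j).
  have wS k (kn : (k < n)%N) : w k.+1 = w k + (y ord0 (Ordinal kn) - x ord0 (Ordinal kn)) *:
      delta_mx ord0 (Ordinal kn).
    apply/rowP => j; rewrite !mxE eqxx /= ltnS leq_eqVlt.
    have -> : (nat_of_ord j == k) = (j == Ordinal kn) by [].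
    have [->|jk] := eqVneq j (Ordinal kn); first by rewrite /= ltnn mulr1 addrC subrK.
    by rewrite mulr0 addr0.
  have H k : (k <= n)%N -> `|f (w k) - f x| <= k%:R * (D * enorm (x - y)).
    elim: k => [_|k IH kn].
      by rewrite (_ : w 0%N = x) ?subrr ?normr0 ?mul0r //; apply/rowP => j; rewrite mxE.
    rewrite (_ : _ - _ = (f (w k.+1) - f (w k)) + (f (w k) - f x)); last by rewrite addrA subrK.
    rewrite (le_trans (ler_normD _ _)) // mulrS mulrDl mul1r lerD // ?IH ?(ltnW kn) //.
    rewrite wS (le_trans (mean_value_coord _ _ (HD' _) _ _)) //.
    + by move=> z; exact: (proj2 (sf [::])).
    + exact: (proj1 (sf [::])).
    rewrite ler_wpM2l ?(ltW D0) // distrC.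
    by have := coord_le_enorm (x - y) (Ordinal kn); rewrite !mxE.
  have wn : w n = y by apply/rowP => j; rewrite mxE ltn_ord.
  rewrite distrC -[X in f X - _]wn (le_trans (H _ (leqnn n))) // mulrA ler_wpM2r ?enorm_ge0 //.
  by rewrite lerDr ltW.
- by move=> x; rewrite (le_trans (fM x)) // lerDl mulr_ge0 // ltW.
- move=> x fx i; rewrite (le_trans (coord_le_norm x i)) //.
  apply: HA; last exact: subset_closure.
  by rewrite (le_lt_trans (ler_norm A)) // ltrDl.
Qed.

End test_functions.

(** * Products of potentials *)

Section domination.
Context {R : realType} {n : nat} (mu : {sigma_finite_measure set (Rn R n) -> \bar R})
  (Hmu : is_lebesgue mu) (n0 : (0 < n)%N).
Local Notation E := (Rn R n).
Local Notation mu2 := (mu \x mu)%E.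

Lemma measurable_point (x : E) : measurable [set x].
Proof.
rewrite (_ : [set x] = cube (tov x) 0); first exact: measurable_cube.
apply/seteqP; split=> y /=; first by move=> -> i; rewrite addr0 lexx.
by move=> H; apply/rowP => i; apply/eqP; rewrite eq_le andbC; move: (H i); rewrite addr0.
Qed.

(** The product of two potential kernels is a bound only for [y <> x] and [z <> x]; the remaining
    pairs form a null set since points have measure 0. *)
Lemma integral2_le (x : E) (F : E * E -> R) (A B : E -> R) :
  measurable_fun setT F -> measurable_fun setT A -> measurable_fun setT B ->
  (forall y, 0 <= A y) -> (forall y, 0 <= B y) ->
  (forall y z, x <> y -> x <> z -> `|F (y, z)| <= A y * B z) ->
  (\int[mu2]_z (`|F z|)%:E <= (\int[mu]_y (A y)%:E) * (\int[mu]_z (B z)%:E))%E.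
Proof.
move=> mF mA mB A0 B0 FAB; rewrite -integral_prod //.
apply: ae_ge0_le_integral.
- exact: measurableT.
- by move=> z _; rewrite lee_fin.
- by apply/measurable_EFinP; exact: measurableT_comp.
- by move=> z _; rewrite lee_fin mulr_ge0.
- apply/measurable_EFinP/measurable_funM.
  + exact: (measurableT_comp mA measurable_fst).
  + exact: (measurableT_comp mB measurable_snd).
have mx := measurable_point x.
exists (([set x] `*` setT) `|` (setT `*` [set x])); split.
- by apply: measurableU; apply: measurableX.
- apply: null_set_setU.
  + exact: measurableX.
  + exact: measurableX.
  + by apply: (etrans (product_measure1E mu mu mx measurableT)); rewrite [X in (X * _)%E](mu_point Hmu x n0) mul0e.
  + by apply: (etrans (product_measure1E mu mu measurableT mx)); rewrite [X in (_ * X)%E](mu_point Hmu x n0) mule0.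
- move=> [y z] /= H.
  have [xy|xy] := pselect (x = y); first by left; split.
  have [xz|xz] := pselect (x = z); first by right; split.
  by exfalso; apply: H => _; rewrite lee_fin; exact: FAB.
Qed.

Lemma ae_fin_of_poweR (G : E -> \bar R) (p c : R) : 0 < p -> measurable_fun setT G ->
  (forall x, 0 <= G x)%E -> (\int[mu]_x (G x `^ p) <= c%:E)%E ->
  {ae mu, forall x, G x \is a fin_num}.
Proof.
move=> p0 mG G0 Gc.
have iG : mu.-integrable setT (fun x => G x `^ p)%E.
  apply/integrableP; split; first exact: (measurableT_comp (measurable_poweR _)).
  under eq_integral do rewrite gee0_abs ?poweR_ge0 //.
  by rewrite (le_lt_trans Gc) // ltry.
apply: filterS (integrable_ae measurableT iG) => x /(_ I).
case: (G x) (G0 x) => [g| |] // _.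
by rewrite poweRyr // gt_eqF.
Qed.

Definition potential (w : E * E -> R) (a : R) (f : E -> R) (x : E) : \bar R :=
  (\int[mu]_y (w (x, y) * riesz a (x, y) * `|f y|)%:E)%E.

Implicit Types (w : E * E -> R) (f g : E -> R).

Lemma potential_ge0 w a f x : (forall z, 0 <= w z) -> (0 <= potential w a f x)%E.
Proof. by move=> w0; apply: integral_ge0 => y _; rewrite lee_fin !mulr_ge0 ?riesz_ge0. Qed.

Lemma measurable_potential_integrand w (a : R) f x :
  measurable_fun setT w -> measurable_fun setT f ->
  measurable_fun setT (fun y : E => w (x, y) * riesz a (x, y) * `|f y|).
Proof.
move=> mw mf; apply: measurable_funM; last exact: measurableT_comp.
by apply: measurable_funM; apply: (measurableT_comp _ (measurable_pair1 x)) => //; exact: measurable_riesz.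
Qed.

Lemma measurable_potential w a f :
  measurable_fun setT w -> (forall z, 0 <= w z) -> measurable_fun setT f ->
  measurable_fun setT (potential w a f).
Proof.
move=> mw w0 mf.
apply: (@measurable_fun_fubini_tonelli_F _ _ _ _ _ mu
  (fun z : E * E => (w z * riesz a z * `|f z.2|)%:E)); last first.
  by move=> z; rewrite lee_fin !mulr_ge0 ?riesz_ge0.
apply/measurable_EFinP/measurable_funM; first by apply: measurable_funM => //; exact: measurable_riesz.
by apply: measurableT_comp => //; exact: (measurableT_comp mf measurable_snd).
Qed.

Lemma potentialZ w a f x (c : R) : measurable_fun setT w -> (forall z, 0 <= w z) ->
  measurable_fun setT f -> 0 <= c ->
  potential w a (fun y => c * f y) x = (c%:E * potential w a f x)%E.
Proof.
move=> mw w0 mf c0; rewrite /potential.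
rewrite -(@ge0_integralZ _ _ _ mu setT (fun y : E => w (x, y) * riesz a (x, y) * `|f y|) c);
  [|exact: measurableT|exact: measurable_potential_integrand|by move=> y; rewrite !mulr_ge0 ?riesz_ge0|exact: c0].
by apply: eq_integral => y _; congr EFin; rewrite normrM (ger0_norm c0); ring.
Qed.

(** Potentials are extended real and finite only almost everywhere. The product of their finite
    parts gives a real function [h] to dominate with, and Hoelder's inequality is applied to the
    [r]-th powers with exponents [p / r] and [q / r]. *)
Lemma holder_ereal (G H : E -> \bar R) (p q r A B : R) : 0 < p -> 0 < q -> 0 < r ->
  r^-1 = p^-1 + q^-1 -> 0 <= A -> 0 <= B ->
  measurable_fun setT G -> measurable_fun setT H ->
  (forall x, 0 <= G x)%E -> (forall x, 0 <= H x)%E ->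
  (\int[mu]_x (G x `^ p) <= (A `^ p)%:E)%E -> (\int[mu]_x (H x `^ q) <= (B `^ q)%:E)%E ->
  exists h : E -> R, [/\ measurable_fun setT h, forall x, 0 <= h x,
    (\int[mu]_x (h x `^ r)%:E <= ((A * B) `^ r)%:E)%E &
    {ae mu, forall x, G x \is a fin_num /\ H x \is a fin_num /\ (G x * H x)%E = (h x)%:E}].
Proof.
move=> p0 q0 r0 rpq A0 B0 mG mH G0 H0 GA HB.
have finG := ae_fin_of_poweR p0 mG G0 GA; have finH := ae_fin_of_poweR q0 mH H0 HB.
have mfG : measurable_fun setT (fine \o G) by exact: measurableT_comp.
have mfH : measurable_fun setT (fine \o H) by exact: measurableT_comp.
have fG0 x : 0 <= fine (G x) by exact: fine_ge0.
have fH0 x : 0 <= fine (H x) by exact: fine_ge0.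
exists (fun x => fine (G x) * fine (H x)); split.
- exact: measurable_funM.
- by move=> x; exact: mulr_ge0.
- have le_fine (F : E -> \bar R) (e c : R) : 0 < e -> measurable_fun setT F -> (forall x, 0 <= F x)%E ->
      (\int[mu]_x (F x `^ e) <= (c `^ e)%:E)%E ->
      (\int[mu]_x ((fine (F x) `^ r) `^ (e / r))%:E <= ((c `^ r) `^ (e / r))%:E)%E.
    move=> e0 mF F0 Fc; rewrite -powRrM mulrCA divff ?mulr1 ?gt_eqF //.
    apply: le_trans Fc; apply: ge0_le_integral => //.
    + by move=> x _; rewrite lee_fin powR_ge0.
    + apply/measurable_EFinP; apply: (measurableT_comp (measurable_powR _)).
      by apply: (measurableT_comp (measurable_powR _)); exact: measurableT_comp.
    + exact: (measurableT_comp (measurable_poweR _)).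
    + move=> x _; rewrite -powRrM mulrCA divff ?mulr1 ?gt_eqF //.
      move: (F0 x); case: (F x) => [g| |] // _.
      by rewrite poweRyr ?gt_eqF // leey.
  have := @ge0_holder _ _ _ mu setT (fun x => fine (G x) `^ r) (fun x => fine (H x) `^ r)
    (p / r) (q / r) (A `^ r) (B `^ r) measurableT.
  rewrite (powRM r A0 B0) => HO.
  under eq_integral => x _ do rewrite (powRM r (fG0 x) (fH0 x)).
  apply: HO; rewrite ?divr_gt0 ?powR_ge0 //.
  + exact: (measurableT_comp (measurable_powR _)).
  + exact: (measurableT_comp (measurable_powR _)).
  + by move=> x; exact: powR_ge0.
  + by move=> x; exact: powR_ge0.
  + by rewrite !invf_div -mulrDr -rpq divff // gt_eqF.
  + exact: le_fine.
  + exact: le_fine.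
- apply: filterS2 finG finH => x Gx Hx; split=> //; split=> //.
  by rewrite EFinM !fineK.
Qed.

(** The weighted bound for the factor with [f] and the unweighted one for the factor with [g],
    combined by Hoelder's inequality. The size [X] of [f] is left free because [f] cut to a box will
    be measured in another exponent, where its norm need not be at most 1. *)
Lemma potential_product (a p p1 a2 q q1 r : R) : 0 < a -> 1 < p -> 0 < p1 ->
  p1^-1 = p^-1 - a / n%:R -> 0 < a2 -> 1 < q -> 0 < q1 -> q1^-1 = q^-1 - a2 / n%:R ->
  0 < r -> r^-1 = p1^-1 + q1^-1 ->
  exists s c : R, [/\ 1 < s, 0 < c & forall (w : E * E -> R) (Bw X : R), 0 <= Bw -> 0 < X ->
    measurable_fun setT w -> (forall z, 0 <= w z) -> cube_bound mu s w Bw ->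
    forall f g : E -> R, measurable_fun setT f -> measurable_fun setT g ->
    (\int[mu]_x (`|f x| `^ p)%:E <= (X `^ p)%:E)%E -> (\int[mu]_x (`|g x| `^ q)%:E <= 1)%E ->
    exists h : E -> R, [/\ measurable_fun setT h, forall x, 0 <= h x,
      (\int[mu]_x (h x `^ r)%:E <= ((c * Bw * X) `^ r)%:E)%E &
      {ae mu, forall x, (potential w a f x * potential (cst 1%R) a2 g x)%E = (h x)%:E}]].
Proof.
move=> a0 p1_ p10 p1E a20 q1_ q10 q1E r0 rE.
have [s [c [s1 c0 Hc]]] := riesz_op Hmu n0 a0 p1_ p10 p1E.
have [s' [c' [s'1 c'0 Hc']]] := riesz_op Hmu n0 a20 q1_ q10 q1E.
exists s, (c * c'); split; [exact: s1|exact: mulr_gt0|].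
move=> w Bw X Bw0 X0 mw w0 Hw f g mf mg fX gX.
pose f' y := X^-1 * f y.
have mf' : measurable_fun setT f' by exact: measurable_funM.
have p0 : 0 < p by lra.
have f'1 : (\int[mu]_x (`|f' x| `^ p)%:E <= 1)%E.
  have -> : (\int[mu]_x (`|f' x| `^ p)%:E = ((X `^ p)^-1)%:E * \int[mu]_x (`|f x| `^ p)%:E)%E.
    rewrite -ge0_integralZ;
      [|exact: measurableT|exact: measurable_norm_powR|by move=> x; exact: powR_ge0|by rewrite invr_ge0 powR_ge0].
    apply: eq_integral => x _; congr EFin; rewrite /f' normrM ger0_norm ?invr_ge0 ?(ltW X0) //.
    by rewrite powRM ?invr_ge0 ?(ltW X0) // -powR_inv1 ?(ltW X0) // -powRrM mulN1r powRN.
  rewrite -[leRHS](_ : ((X `^ p)^-1)%:E * (X `^ p)%:E = 1%E)%E; last first.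
    by rewrite -EFinM mulVf // gt_eqF // powR_gt0.
  by apply: lee_wpmul2l fX; rewrite lee_fin invr_ge0 powR_ge0.
have mnf : measurable_fun setT (fun x => `|f' x|) by exact: measurableT_comp.
have mng : measurable_fun setT (fun x => `|g x|) by exact: measurableT_comp.
have mc1 : measurable_fun setT (cst 1 : E * E -> R) by exact: measurable_cst.
have c10 (z : E * E) : 0 <= cst 1 z :> R by rewrite /= ler01.
have H1 := Hc w Bw Bw0 mw w0 Hw (fun x => `|f' x|) mnf (fun x => normr_ge0 _) f'1.
have H2 := Hc' (cst 1) 1 ler01 mc1 c10 (cube_bound1 Hmu s'1) (fun x => `|g x|) mng (fun x => normr_ge0 _) gX.
rewrite mulr1 in H2.
have [h [mh h0 hr hE]] := holder_ereal p10 q10 r0 rE (mulr_ge0 (ltW c0) Bw0) (ltW c'0)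
  (measurable_potential a mw w0 mf') (measurable_potential a2 mc1 c10 mg)
  (fun x => potential_ge0 a f' x w0) (fun x => potential_ge0 a2 g x c10) H1 H2.
exists (fun x => X * h x); split.
- exact: measurable_funM.
- by move=> x; rewrite mulr_ge0 ?(ltW X0).
- under eq_integral => x _ do rewrite (powRM r (ltW X0) (h0 x)).
  rewrite ge0_integralZ;
    [|exact: measurableT|exact: (measurableT_comp (measurable_powR _))|by move=> x; exact: powR_ge0|exact: powR_ge0].
  rewrite (_ : c * c' * Bw * X = X * (c * Bw * c')); last by ring.
  rewrite (powRM r (ltW X0)) ?mulr_ge0 ?(ltW c0) ?(ltW c'0) // EFinM.
  by apply: lee_wpmul2l hr; rewrite lee_fin powR_ge0.
- apply: filterS hE => x [_ [_ hE]].
  rewrite (_ : f = (fun y => X * f' y)).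
    by rewrite (potentialZ _ _ mw w0 mf' (ltW X0)) -muleA hE.
  by apply/funext => y; rewrite /f' mulVKf // gt_eqF.
Qed.

End domination.

(** * Kernels *)

Section kernels.
Context {R : realType} {n : nat} (n0 : (0 < n)%N).
Local Notation E := (Rn R n).

Lemma norm_le_enorm (x : 'rV[R]_n) : `|x| <= enorm x.
Proof.
rewrite [leLHS]/Num.norm /= mx_normrE; apply: bigmax_le => [|[i j] _]; first exact: enorm_ge0.
by rewrite (ord1 i) coord_le_enorm.
Qed.

Lemma enorm_le_norm (x : 'rV[R]_n) : enorm x <= n%:R * `|x|.
Proof.
rewrite -[leRHS]ger0_norm ?mulr_ge0 // -sqrtr_sqr /enorm ler_wsqrtr //.
have n1 : 1 <= n%:R :> R by rewrite ler1n.
apply: (@le_trans _ _ (\sum_(i < n) `|x| ^+ 2)).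
  by apply: ler_sum => i _; rewrite -real_normK ?num_real // lerXn2r ?nnegrE // coord_le_norm.
rewrite sumr_const card_ord -[leLHS]mulr_natl exprMn ler_wpM2r ?exprn_ge0 //.
by rewrite expr2 ler_peMl.
Qed.

Lemma enorm_gt0 (x y : E) : x <> y -> 0 < enorm (tov x - tov y).
Proof.
move=> xy; rewrite (lt_le_trans _ (norm_le_enorm _)) // normr_gt0 subr_eq0.
by apply/eqP.
Qed.

(** [dist3] is at least each of the two distances, and both exponents [n - a1] and [n - a2] are
    nonnegative. *)
Lemma kernel_split (a1 a2 : R) (x y z : E) : a1 <= n%:R -> a2 <= n%:R -> x <> y -> x <> z ->
  (dist3 x y z `^ (2 * n%:R - (a1 + a2)))^-1 <= riesz a1 (x, y) * riesz a2 (x, z).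
Proof.
move=> a1n a2n /enorm_gt0 xy /enorm_gt0 xz; rewrite /riesz /= /dist3 -invfM.
rewrite lef_pV2 ?posrE ?mulr_gt0 ?powR_gt0 ?addr_gt0 //.
rewrite (_ : 2 * _ - _ = (n%:R - a1) + (n%:R - a2)); last by ring.
rewrite [leRHS]powRD; last by apply/implyP => _; rewrite gt_eqF ?addr_gt0.
by rewrite ler_pM ?powR_ge0 //; apply: ler_powRl; rewrite ?subr_ge0 ?lerDl ?lerDr // ltW.
Qed.

Definition clamp (t : R) : R := Num.min 1 (Num.max 0 t).

Lemma clamp_itv t : 0 <= clamp t <= 1.
Proof. by rewrite /clamp /Num.min /Num.max; do 2!case: ifPn; rewrite -?leNgt => ? ?; lra. Qed.

Lemma clamp_lip s t : `|clamp s - clamp t| <= `|s - t|.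
Proof.
rewrite ler_norml; apply/andP; have := ler_norm (s - t); have := lerNnormlW (lexx `|s - t|).
by rewrite /clamp /Num.min /Num.max; split; do 4!case: ifPn; rewrite -?leNgt; lra.
Qed.

Lemma clamp_eq0 t : t <= 0 -> clamp t = 0.
Proof. by move=> t0; rewrite /clamp max_l // min_r // ler01. Qed.

Lemma clamp_eq1 t : 1 <= t -> clamp t = 1.
Proof. by move=> t1; rewrite /clamp min_l // le_max t1 orbT. Qed.

(** The sup-norm version of [dist3], since moves of [x] inside a grid cell are measured in the sup
    norm. *)
Definition ndist3 (x y z : E) : R := `|tov x - tov y| + `|tov x - tov z|.

Lemma ndist3_le x y z : ndist3 x y z <= dist3 x y z.
Proof. by rewrite lerD ?norm_le_enorm. Qed.

Lemma ndist3_near x x' y z : `|ndist3 x y z - ndist3 x' y z| <= 2 * `|tov x - tov x'|.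
Proof.
have H u : `| (`|tov x - tov u| - `|tov x' - tov u|) | <= `|tov x - tov x'|.
  by rewrite (le_trans (ler_dist_dist _ _)) // opprB addrA subrK.
rewrite /ndist3 opprD addrACA (le_trans (ler_normD _ _)) // mulr_natl mulr2n lerD //; exact: H.
Qed.

Lemma measurable_ndist3 (x : E) : measurable_fun setT (fun u : E * E => ndist3 x u.1 u.2).
Proof.
have mx : measurable_fun setT (fun y : E => `|tov x - tov y|).
  apply: (@measurable_continuous R n (fun v => `|tov x - v|)) => y.
  apply: (@cvg_norm R 'rV[R]_n 'rV[R]_n (nbhs y) _ (fun v => tov x - v)).
  have idc : id @ (nbhs y) --> (y : 'rV[R]_n) by exact: cvg_id.
  have cstc : (fun=> tov x) @ (nbhs y) --> (tov x : 'rV[R]_n) by apply: cvg_cst.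
  exact: (@cvgB R 'rV[R]_n 'rV[R]_n (nbhs y) _ _ _ _ _ cstc idc).
apply: measurable_funD.
- exact: (measurableT_comp mx measurable_fst).
- exact: (measurableT_comp mx measurable_snd).
Qed.

(* The cutoff [chi] vanishes near the diagonal, where the Lipschitz bound on [phi]
   makes the kernel small; elsewhere the smoothness of [K] in [x] applies. *)
Lemma kernel_discretise (alpha C L : R) (K : E -> E -> E -> R) (phi : E -> R) :
  0 < alpha < 2 * n%:R -> 0 < C -> 0 < L -> frac_kernel alpha C K ->
  (forall x y, `|phi x - phi y| <= L * enorm (tov x - tov y)) -> (forall x, `|phi x| <= L) ->
  forall eta : R, 0 < eta -> exists delta (chi : E -> E * E -> R), [/\ 0 < delta,
    forall x, measurable_fun setT (chi x) &
    forall x x', `|tov x - tov x'| <= delta -> forall y z, offdiag x y z ->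
      `|K x y z * (phi y - phi x) - chi x' (y, z) * K x' y z * (phi y - phi x')|
        <= eta * (dist3 x y z `^ (2 * n%:R - alpha))^-1].
Proof.
move=> /andP[alpha0 alphan] C0 L0 [Kb [Kx _]] phiL phib eta eta0.
have n1 : 1 <= n%:R :> R by rewrite ler1n.
have nR0 : 0 < n%:R :> R by lra.
have CL0 : 0 < C * L by exact: mulr_gt0.
(* [eps] is the width of the cutoff, which rises from 0 to 1 as [ndist3] goes from [eps] to [2 eps].
   The part near the diagonal then costs [2 n eps C L = eta / 2]. *)
pose eps := eta / (4 * n%:R * (C * L)).
have eps0 : 0 < eps by rewrite divr_gt0 // !mulr_gt0.
have epsE : 2 * n%:R * eps * (C * L) = eta / 2.
  by rewrite /eps; field; rewrite !gt_eqF.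
(* Total coefficient of [tau] in the errors from moving the cutoff, the kernel and [phi]: twice
   [4 C L / eps], and [2 C L]. *)
pose c1 := 8 * (C * L) / eps + 2 * (C * L).
have c10 : 0 < c1 by rewrite addr_gt0 ?divr_gt0 ?mulr_gt0.
(* Where the smoothness of [K] is used, [dist3] is at least [eps / 2], so [maxd / 2] is at least
   [eps / 8] and a displacement up to [tau] is allowed. *)
pose tau := Num.min (eps / 8) (eta / (2 * c1)).
have tau0 : 0 < tau by rewrite lt_min !divr_gt0 ?mulr_gt0.
have tau1 : tau <= eps / 8 by rewrite ge_min lexx.
have tau2 : tau * c1 <= eta / 2.
  rewrite -ler_pdivlMr // (le_trans (_ : _ <= eta / (2 * c1))) ?ge_min ?lexx ?orbT //.
  by rewrite invfM mulrA.
(* The factor [n] passes from the sup norm to the Euclidean one. *)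
exists (tau / n%:R), (fun x u => clamp (ndist3 x u.1 u.2 / eps - 1)); split.
- exact: divr_gt0.
- move=> x; apply: measurable_minr; first exact: measurable_cst.
  apply: measurable_maxr; first exact: measurable_cst.
  apply: measurable_funB; last exact: measurable_cst.
  by apply: measurable_funM; [exact: measurable_ndist3|exact: measurable_cst].
move=> x x' xx' y z xyz.
have K1 := Kb x y z xyz; rewrite -[C / _]/(C * _^-1) in K1.
set N := (dist3 x y z `^ (2 * n%:R - alpha))^-1 in K1 *.
have N0 : 0 <= N by rewrite invr_ge0 powR_ge0.
have nt : `|tov x - tov x'| <= tau.
  by rewrite (le_trans xx') // ler_pdivrMr // ler_peMr // ltW.
have et : enorm (tov x - tov x') <= tau.
  by rewrite (le_trans (enorm_le_norm _)) // mulrC -ler_pdivlMr.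
pose d1 := ndist3 x y z; pose d2 := ndist3 x' y z; rewrite -/d2.
have dd : `|d1 - d2| <= 2 * tau.
  by rewrite (le_trans (ndist3_near _ _ _ _)) // ler_pM2l.
have exy : enorm (tov x - tov y) <= n%:R * d1.
  by rewrite (le_trans (enorm_le_norm _)) // ler_pM2l // lerDl.
pose P1 := phi y - phi x; pose P2 := phi y - phi x'; rewrite -/P1 -/P2.
have hP1 : `|P1| <= 2 * L.
  by rewrite (le_trans (ler_normB _ _)) //; have := phib x; have := phib y; lra.
have hP1' : `|P1| <= L * (n%:R * d1).
  by rewrite distrC (le_trans (phiL _ _)) // ler_pM2l.
(* So near the diagonal the cutoff at [x'] vanishes, and [|phi y - phi x|] is at most a multiple of
   [d1]. *)
have [dlt|dge] := ltP d1 (eps / 2).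
  have d2e : d2 <= eps by move: dd; rewrite ler_norml => /andP[? ?]; lra.
  rewrite clamp_eq0 ?mul0r ?subr0; last by rewrite subr_le0 ler_pdivrMr // mul1r.
  rewrite normrM (le_trans (ler_pM _ _ K1 hP1')) //.
  rewrite (_ : C * N * (L * (n%:R * d1)) = (n%:R * d1 * (C * L)) * N); last by ring.
  rewrite ler_wpM2r //.
  apply: (@le_trans _ _ (n%:R * (2 * eps) * (C * L))); last by lra.
  by rewrite ler_pM2r // ler_pM2l //; lra.
pose D := dist3 x y z.
have dD : d1 <= D by exact: ndist3_le.
have D0 : 0 < D by lra.
have maxD : D / 2 <= maxd x y z.
  by rewrite /D /dist3 /maxd le_max; case: (leP (enorm (tov x - tov y)) (enorm (tov x - tov z))) => ?; apply/orP; [right|left]; lra.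
have K2 : `|K x y z - K x' y z| <= C * tau * (2 / eps) * N.
  have := Kx x y z (tov x' - tov x) xyz.
  rewrite (_ : ofv _ = x'); last by rewrite /ofv addrC subrK.
  have eE : enorm (tov x' - tov x) = enorm (tov x - tov x').
    by rewrite /enorm; congr Num.sqrt; apply: eq_bigr => i _; rewrite !mxE -sqrrN opprB.
  rewrite eE => H; apply: le_trans (H _) _; first by lra.
  rewrite -/D [D `^ (_ + 1)]powRD; last by apply/implyP => _; rewrite gt_eqF.
  rewrite invfM -/N powRr1 ?(ltW D0) // [N * _]mulrC mulrA ler_wpM2r //.
  apply: ler_pM; rewrite ?invr_ge0 ?mulr_ge0 ?enorm_ge0 ?(ltW C0) ?(ltW D0) //.
    by rewrite ler_pM2l.
  by rewrite -[2 / eps]invf_div lef_pV2 ?posrE ?(divr_gt0 eps0) // (le_trans dge).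
have te : tau * (2 / eps) <= 1 by rewrite mulrA ler_pdivrMr // mul1r; lra.
have K3 : `|K x' y z| <= 2 * C * N.
  have -> : K x' y z = K x y z - (K x y z - K x' y z) by rewrite subKr.
  rewrite (le_trans (ler_normB _ _)) // (_ : 2 * C * N = C * N + C * N); last by ring.
  rewrite lerD // (le_trans K2) // ler_wpM2r // -mulrA -[leRHS]mulr1 ler_pM2l //.
set k1 := K x y z in K1 K2 K3 *; set k2 := K x' y z in K2 K3 *.
set c2 := clamp (d2 / eps - 1).
pose c := clamp (d1 / eps - 1).
have c2i : `|c2| <= 1.
  by have /andP[? ?] := clamp_itv (d2 / eps - 1); rewrite ger0_norm.
have cc : `|c - c2| <= tau * (2 / eps).
  rewrite (le_trans (clamp_lip _ _)) // opprB addrA subrK -mulrBl normrM.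
  rewrite [`|eps^-1|]gtr0_norm ?invr_gt0 // mulrCA mulrA ler_pM2r ?invr_gt0 //; lra.
(* [1 - c] vanishes once [d1 >= 2 eps]; below that, the Lipschitz bound makes [phi y - phi x]
   small. *)
have c1P : `|1 - c| * `|P1| <= 2 * n%:R * eps * L.
  have [d1e|d1e] := leP (2 * eps) d1.
    rewrite /c clamp_eq1; last by rewrite lerBrDr ler_pdivlMr //; lra.
    by rewrite subrr normr0 mul0r ltW // (mulr_gt0 _ L0) // (mulr_gt0 _ eps0) // mulr_gt0.
  have /andP[? ?] := clamp_itv (d1 / eps - 1).
  rewrite ger0_norm ?subr_ge0 // (le_trans (_ : _ <= 1 * `|P1|)) ?ler_wpM2r //; first by rewrite /c; lra.
  rewrite mul1r (le_trans hP1') // mulrC ler_pM2r // mulrC -mulrA [n%:R * _]mulrC mulrA ler_pM2r //.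
  exact: ltW.
have PP : `|P1 - P2| <= L * tau.
  rewrite (_ : P1 - P2 = - (phi x - phi x')); last by rewrite /P1 /P2; ring.
  by rewrite normrN (le_trans (phiL _ _)) // ler_pM2l.
have -> : k1 * P1 - c2 * k2 * P2 = (1 - c) * P1 * k1 + (c - c2) * k1 * P1 +
    c2 * (k1 - k2) * P1 + c2 * k2 * (P1 - P2) by ring.
have b1 : `|(1 - c) * P1 * k1| <= 2 * n%:R * eps * L * (C * N).
  by rewrite !normrM ler_pM ?mulr_ge0.
have b2 : `|(c - c2) * k1 * P1| <= tau * (2 / eps) * (C * N) * (2 * L).
  by rewrite !normrM !ler_pM ?mulr_ge0.
have b3 : `|c2 * (k1 - k2) * P1| <= 1 * (C * tau * (2 / eps) * N) * (2 * L).
  by rewrite !normrM !ler_pM ?mulr_ge0.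
have b4 : `|c2 * k2 * (P1 - P2)| <= 1 * (2 * C * N) * (L * tau).
  by rewrite !normrM !ler_pM ?mulr_ge0.
apply: (@le_trans _ _ (2 * n%:R * eps * L * (C * N) + tau * (2 / eps) * (C * N) * (2 * L) +
  1 * (C * tau * (2 / eps) * N) * (2 * L) + 1 * (2 * C * N) * (L * tau))).
  do 3!(apply: le_trans (ler_normD _ _) _; apply: lerD => //).
apply: (@le_trans _ _ ((2 * n%:R * eps * (C * L) + tau * c1) * N)).
  by rewrite le_eqVlt; apply/orP; left; apply/eqP; rewrite /c1; ring.
by rewrite ler_wpM2r // epsE; lra.
Qed.

End kernels.

Section bounded_integral.
Context d (T : measurableType d) (R : realType) (m : {measure set T -> \bar R}).
Variables (F : T -> R) (c : R).
Hypotheses (mF : measurable_fun setT F) (Fc : (\int[m]_z (`|F z|)%:E <= c%:E)%E).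

Lemma integrable_of_norm_le : m.-integrable setT (EFin \o F).
Proof.
apply/integrableP; split; first exact/measurable_EFinP.
by rewrite (le_lt_trans Fc) // ltry.
Qed.

Lemma normr_fine_integral_le : `|fine (\int[m]_z (F z)%:E)%E| <= c.
Proof.
have iF := integrable_of_norm_le.
rewrite (le_trans (le_normr_Rintegral measurableT iF)) // -lee_fin (le_trans _ Fc) // fineK //.
exact: (integrable_fin_num measurableT (integrable_norm iF)).
Qed.

End bounded_integral.

Lemma ler_regroup (R : realDomainType) (k c w r1 r2 F G : R) : 0 <= F -> 0 <= G ->
  k <= c * w * (r1 * r2) -> k * F * G <= c * (w * r1 * F) * (r2 * G).
Proof.
move=> F0 G0 kc; rewrite (_ : c * _ * _ = c * w * (r1 * r2) * F * G); last by ring.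
by rewrite !ler_wpM2r.
Qed.

(** * Pointwise domination of the commutator *)

Section pointwise.
Context {R : realType} {n : nat} (mu : {sigma_finite_measure set (Rn R n) -> \bar R})
  (Hmu : is_lebesgue mu) (n0 : (0 < n)%N).
Local Notation E := (Rn R n).
Local Notation mu2 := (mu \x mu)%E.
Implicit Types (f g : E -> R).

Lemma measurable_tensor (k : E * E -> R) f g : measurable_fun setT k ->
  measurable_fun setT f -> measurable_fun setT g ->
  measurable_fun setT (fun z : E * E => k z * f z.1 * g z.2).
Proof.
move=> mk mf mg; apply: measurable_funM.
  by apply: measurable_funM => //; exact: (measurableT_comp mf measurable_fst).
exact: (measurableT_comp mg measurable_snd).
Qed.

Lemma integral_potential_le (x : E) (F : E * E -> R) (w : E * E -> R) (a a2 c : R) f g :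
  measurable_fun setT F -> measurable_fun setT w -> (forall z, 0 <= w z) ->
  measurable_fun setT f -> measurable_fun setT g -> 0 <= c ->
  (forall y z, x <> y -> x <> z -> `|F (y, z)| <=
     c * (w (x, y) * riesz a (x, y) * `|f y|) * (riesz a2 (x, z) * `|g z|)) ->
  (\int[mu2]_z (`|F z|)%:E <=
     c%:E * (potential mu w a f x * potential mu (cst 1%R) a2 g x))%E.
Proof.
move=> mF mw w0 mf mg c0 FB.
have mi := measurable_potential_integrand a x mw mf.
have mi2 := @measurable_potential_integrand _ _ (cst 1) a2 g x (measurable_cst _) mg.
rewrite muleA -(ge0_integralZ mu measurableT mi);
  [|by move=> y; rewrite !mulr_ge0 ?riesz_ge0|exact: c0].
apply: (integral2_le Hmu n0 (x := x)).
- exact: mF.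
- exact: measurable_funM.
- exact: mi2.
- by move=> y; rewrite !mulr_ge0 ?riesz_ge0.
- by move=> y; rewrite !mulr_ge0 ?riesz_ge0 //= ler01.
- by move=> y z xy xz; rewrite /= mul1r; exact: FB.
Qed.

Lemma kernel_integral_le (alpha a1 a2 c : R) (x : E) (k w : E * E -> R) f g :
  a1 + a2 = alpha -> a1 <= n%:R -> a2 <= n%:R -> measurable_fun setT k ->
  measurable_fun setT w -> (forall z, 0 <= w z) ->
  measurable_fun setT f -> measurable_fun setT g -> 0 <= c ->
  (forall y z, x <> y -> x <> z ->
    `|k (y, z)| <= c * w (x, y) * (dist3 x y z `^ (2 * n%:R - alpha))^-1) ->
  (\int[mu2]_z (`|k z * f z.1 * g z.2|)%:E <=
     c%:E * (potential mu w a1 f x * potential mu (cst 1%R) a2 g x))%E.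
Proof.
move=> aE a1n a2n mk mw w0 mf mg c0 kB.
apply: integral_potential_le => //; first exact: measurable_tensor.
move=> y z xy xz /=; rewrite !normrM.
apply: ler_regroup => //; apply: le_trans (kB _ _ xy xz) _.
by apply: ler_wpM2l; [exact: mulr_ge0|rewrite -aE; exact: kernel_split].
Qed.

Lemma measurable_kernel_at (K : E -> E -> E -> R) (x : E) :
  measurable_fun setT (fun t : E * (E * E) => K t.1 t.2.1 t.2.2) ->
  measurable_fun setT (fun z : E * E => K x z.1 z.2).
Proof. by move=> mK; exact: (measurableT_comp mK (measurable_pair1 x)). Qed.

(** The commutator has kernel [K (b y - b x)], split here into the part of [beta], the error of
    replacing the part of [phi] by [G], and [G]. [Top] is [fine] of an integral, so linearity is
    applied only where all pieces converge absolutely: [H0] and [H3] provide that, [H1] and [H2]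
    also the bound. *)
Lemma comm1_at (K : E -> E -> E -> R) (b beta phi f g : E -> R) (x : E) (G : E * E -> R)
    (h0 h1 h2 h3 : R) :
  measurable_fun setT (fun t : E * (E * E) => K t.1 t.2.1 t.2.2) ->
  measurable_fun setT beta -> measurable_fun setT phi -> measurable_fun setT f ->
  measurable_fun setT g -> measurable_fun setT G -> (forall y, b y = beta y + phi y) ->
  (\int[mu2]_z (`|K x z.1 z.2 * f z.1 * g z.2|)%:E <= h0%:E)%E ->
  (\int[mu2]_z (`|K x z.1 z.2 * (beta z.1 - beta x) * f z.1 * g z.2|)%:E <= h1%:E)%E ->
  (\int[mu2]_z (`|(K x z.1 z.2 * (phi z.1 - phi x) - G z) * f z.1 * g z.2|)%:E <= h2%:E)%E ->
  (\int[mu2]_z (`|G z * f z.1 * g z.2|)%:E <= h3%:E)%E ->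
  `|comm1 mu K b f g x - fine (\int[mu2]_z (G z * f z.1 * g z.2)%:E)%E| <= h1 + h2.
Proof.
move=> mK mbeta mphi mf mg mG bE H0 H1 H2 H3.
have mKx := measurable_kernel_at x mK.
have m1 (u : E -> R) : measurable_fun setT u -> measurable_fun setT (fun z : E * E => u z.1 - u x).
  by move=> mu_; apply: measurable_funB => //; exact: (measurableT_comp mu_ measurable_fst).
have mF0 := measurable_tensor mKx mf mg.
have mF1 := measurable_tensor (measurable_funM mKx (m1 _ mbeta)) mf mg.
have mF2 := measurable_tensor (measurable_funB (measurable_funM mKx (m1 _ mphi)) mG) mf mg.
have mF3 := measurable_tensor mG mf mg.
have i0 := integrable_of_norm_le mF0 H0.
have i1 := integrable_of_norm_le mF1 H1.
have i2 := integrable_of_norm_le mF2 H2.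
have i3 := integrable_of_norm_le mF3 H3.
have n1 := normr_fine_integral_le mF1 H1.
have n2 := normr_fine_integral_le mF2 H2.
have i12 := integrableD measurableT i1 i2.
have i123 := integrableD measurableT i12 i3.
have ib0 := integrableZl measurableT (b x) i0.
suff -> : comm1 mu K b f g x =
    fine (\int[mu2]_z (K x z.1 z.2 * (beta z.1 - beta x) * f z.1 * g z.2)%:E)%E +
    fine (\int[mu2]_z ((K x z.1 z.2 * (phi z.1 - phi x) - G z) * f z.1 * g z.2)%:E)%E +
    fine (\int[mu2]_z (G z * f z.1 * g z.2)%:E)%E.
  by rewrite addrK (le_trans (ler_normD _ _)) // lerD.
rewrite /comm1 /Top.
pose F1 (z : E * E) := K x z.1 z.2 * (beta z.1 - beta x) * f z.1 * g z.2.
pose F2 (z : E * E) := (K x z.1 z.2 * (phi z.1 - phi x) - G z) * f z.1 * g z.2.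
pose F3 (z : E * E) := G z * f z.1 * g z.2.
pose F0 (z : E * E) := K x z.1 z.2 * f z.1 * g z.2.
rewrite (_ : (\int[mu2]_z (K x z.1 z.2 * (b z.1 * f z.1) * g z.2)%:E)%E =
    (\int[mu2]_z (((F1 z + F2 z) + F3 z) + b x * F0 z)%:E)%E); last first.
  by apply: eq_integral => z _; congr EFin; rewrite /F1 /F2 /F3 /F0 !bE; ring.
have R1 := RintegralD measurableT i123 ib0.
have R2 := RintegralD measurableT i12 i3.
have R3 := RintegralD measurableT i1 i2.
have R4 := RintegralZl (b x) measurableT i0.
rewrite /Rintegral in R1 R2 R3 R4.
rewrite [X in X - _]R1 R2 R3 R4.
by rewrite addrK.
Qed.

End pointwise.

Section commutators.
Context {R : realType} {n : nat} (mu : {sigma_finite_measure set (Rn R n) -> \bar R})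
  (Hmu : is_lebesgue mu) (n0 : (0 < n)%N).
Local Notation E := (Rn R n).
Local Notation mu2 := (mu \x mu)%E.
Implicit Types (f g : E -> R).

Lemma measurable_Top (K : E -> E -> E -> R) f g :
  measurable_fun setT (fun t : E * (E * E) => K t.1 t.2.1 t.2.2) ->
  measurable_fun setT f -> measurable_fun setT g -> measurable_fun setT (Top mu K f g).
Proof.
move=> mK mf mg.
pose F (t : E * (E * E)) := (K t.1 t.2.1 t.2.2 * f t.2.1 * g t.2.2)%:E.
have mF : measurable_fun setT F.
  apply/measurable_EFinP; apply: measurable_funM; first apply: measurable_funM => //.
  - exact: (measurableT_comp mf (measurableT_comp measurable_fst measurable_snd)).
  - exact: (measurableT_comp mg (measurableT_comp measurable_snd measurable_snd)).
apply: (measurableT_comp (f := fine)) => //.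
rewrite (_ : (fun x => \int[mu2]_z (K x z.1 z.2 * f z.1 * g z.2)%:E)%E =
  (fun x => \int[mu2]_z (F^\+ (x, z)) - \int[mu2]_z (F^\- (x, z)))%E); last first.
  by apply/funext => x; rewrite [LHS]integralE; congr (_ - _)%E; apply: eq_integral => z _;
    rewrite ?funeposE ?funenegE.
apply: emeasurable_funB; apply: measurable_tonelli_prodl => //.
- exact: measurable_funepos.
- exact: measurable_funeneg.
Qed.

Lemma measurable_comm1 (K : E -> E -> E -> R) (b : E -> R) f g :
  measurable_fun setT (fun t : E * (E * E) => K t.1 t.2.1 t.2.2) ->
  measurable_fun setT b -> measurable_fun setT f -> measurable_fun setT g ->
  measurable_fun setT (comm1 mu K b f g).
Proof.
move=> mK mb mf mg; apply: measurable_funB.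
  by apply: measurable_Top => //; exact: measurable_funM.
by apply: measurable_funM => //; exact: measurable_Top.
Qed.

(** [alpha / n] is divided in proportion to [1/p] and [1/q]: with [t = (alpha/n) / (1/p + 1/q)] one
    gets [1/p1 = (1 - t)/p] and [1/q1 = (1 - t)/q]. Both are positive because [t < 1], which amounts
    to [1/r > 0], and both orders are below [n] because [t/p] and [t/q] are below 1. *)
Lemma split_exponents (alpha p q r : R) : 0 < alpha -> 1 < p -> 1 < q -> 0 < r ->
  r^-1 = p^-1 + q^-1 - alpha / n%:R ->
  exists a1 a2 p1 q1 : R, [/\ [/\ 0 < a1, 0 < a2, a1 + a2 = alpha, a1 <= n%:R & a2 <= n%:R],
    0 < p1 /\ 0 < q1, p1^-1 = p^-1 - a1 / n%:R, q1^-1 = q^-1 - a2 / n%:R & r^-1 = p1^-1 + q1^-1].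
Proof.
move=> alpha0 p1 q1 r0 rE.
have nR : 0 < n%:R :> R by rewrite ltr0n.
have [ip iq ir] : [/\ 0 < p^-1, 0 < q^-1 & 0 < r^-1] by rewrite !invr_gt0; split; lra.
have [ip1 iq1] : p^-1 < 1 /\ q^-1 < 1 by rewrite !invf_lt1; lra.
pose t := alpha / n%:R / (p^-1 + q^-1).
have pq0 : 0 < p^-1 + q^-1 by rewrite addr_gt0.
have t0 : 0 < t by rewrite !divr_gt0.
have t1 : t < 1 by rewrite ltr_pdivrMr // mul1r; lra.
have tE : t * p^-1 + t * q^-1 = alpha / n%:R by rewrite -mulrDr divfK // gt_eqF.
clearbody t.
have tp : t * p^-1 < 1 by rewrite -[ltRHS]mulr1 ltr_pM // ltW.
have tq : t * q^-1 < 1 by rewrite -[ltRHS]mulr1 ltr_pM // ltW.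
have nK (u : R) : n%:R * u / n%:R = u by rewrite mulrAC divff ?mul1r // gt_eqF.
exists (n%:R * (t * p^-1)), (n%:R * (t * q^-1)), ((1 - t) * p^-1)^-1, ((1 - t) * q^-1)^-1.
rewrite !nK !invrK !invr_gt0; split.
- split; rewrite ?mulr_gt0 ?ler_piMr ?(ltW nR) ?(ltW tp) ?(ltW tq) //.
  by rewrite -mulrDr tE mulrC divfK // gt_eqF.
- by rewrite !mulr_gt0 ?subr_gt0.
- by ring.
- by ring.
- by rewrite rE -tE; ring.
Qed.

End commutators.

(** * Boundedness of the commutator *)

Section powers_of_dominated.
Context d (T : measurableType d) (R : realType) (m : {measure set T -> \bar R}).
Implicit Types (u h : T -> R).

Lemma ae_integral_powR_le u h (r : R) : 0 <= r -> measurable_fun setT u ->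
  measurable_fun setT h -> (forall x, 0 <= h x) -> {ae m, forall x, `|u x| <= h x} ->
  (\int[m]_x (`|u x| `^ r)%:E <= \int[m]_x (h x `^ r)%:E)%E.
Proof.
move=> r0 mu_ mh h0 uh; apply: ae_ge0_le_integral.
- exact: measurableT.
- by move=> x _; rewrite lee_fin powR_ge0.
- by apply/measurable_EFinP; exact: measurable_norm_powR.
- by move=> x _; rewrite lee_fin powR_ge0.
- by apply/measurable_EFinP; exact: (measurableT_comp (measurable_powR _)).
- by apply: filterS uh => x uh _; rewrite lee_fin ler_powRl.
Qed.

Lemma integral_powR_scale h (r t A : R) : measurable_fun setT h -> (forall x, 0 <= h x) ->
  0 <= t -> 0 <= A -> (\int[m]_x (h x `^ r)%:E <= (A `^ r)%:E)%E ->
  (\int[m]_x ((t * h x) `^ r)%:E <= ((t * A) `^ r)%:E)%E.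
Proof.
move=> mh h0 t0 A0 hA.
under eq_integral => x _ do rewrite (powRM r t0 (h0 x)).
rewrite ge0_integralZ;
  [|exact: measurableT|exact: (measurableT_comp (measurable_powR _))|by move=> x; exact: powR_ge0|exact: powR_ge0].
rewrite (powRM r t0 A0) EFinM.
by apply: lee_wpmul2l hA; rewrite lee_fin powR_ge0.
Qed.

End powers_of_dominated.

(** * Step functions on a grid *)

Section grid.
Context {R : realType} {n : nat} (M : nat) (a : 'rV[R]_n) (l : R).
Hypotheses (M0 : (0 < M)%N) (l0 : 0 < l).
Local Notation cell m := (hcube (subcorner a l m) (l / M%:R)).

Lemma grid_sum (c : {ffun 'I_n -> 'I_M} -> R) m (x : Rn R n) : cell m x ->
  \sum_i c i * \1_(cell i) x = c m.
Proof.
move=> xm; rewrite (bigD1 m) //= indicE mem_set // mulr1 big1 ?addr0 // => i im.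
rewrite indicE memNset ?mulr0 // => xi; move/eqP: im; apply.
exact: (hcube_subdiv_inj M0 l0 xi xm).
Qed.

Lemma grid_sum0 (c : {ffun 'I_n -> 'I_M} -> R) (x : Rn R n) : ~ hcube a l x ->
  \sum_i c i * \1_(cell i) x = 0.
Proof.
move=> xa; apply: big1 => i _; rewrite indicE memNset ?mulr0 // => xi; apply: xa.
by apply/(hcube_subdiv _ _ M0 l0); exists i.
Qed.

Lemma grid_dist (m : {ffun 'I_n -> 'I_M}) (x : Rn R n) : cell m x -> `|tov x - subcorner a l m| <= l / M%:R.
Proof.
move=> xm; have lM : 0 <= l / M%:R by rewrite divr_ge0 // ltW.
rewrite [leLHS]/Num.norm /= mx_normrE; apply: bigmax_le => // -[i j] _ /=.
rewrite (ord1 i); have := xm j; rewrite !mxE /= => /andP[h1 h2].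
by rewrite ger0_norm ?subr_ge0 // lerBlDl ltW.
Qed.

End grid.

Section boundedness.
Context {R : realType} {n : nat} (mu : {sigma_finite_measure set (Rn R n) -> \bar R})
  (Hmu : is_lebesgue mu) (n0 : (0 < n)%N).
Local Notation E := (Rn R n).
Local Notation mu2 := (mu \x mu)%E.
Implicit Types (f g : E -> R).
Variables (alpha p q r C : R) (K : E -> E -> E -> R).
Hypotheses (alpha0 : 0 < alpha) (alphan : alpha < 2 * n%:R) (p1 : 1 < p) (q1 : 1 < q)
  (r1 : 1 <= r) (rE : r^-1 = p^-1 + q^-1 - alpha / n%:R)
  (mK : measurable_fun setT (fun t : E * (E * E) => K t.1 t.2.1 t.2.2))
  (C0 : 0 < C) (HK : frac_kernel alpha C K).

Lemma offdiag_ne (x y z : E) : x <> y -> offdiag x y z.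
Proof. by move=> xy []. Qed.

Lemma kernel_mul_integral_le a1 a2 (u : E -> R) f g (x : E) : a1 + a2 = alpha -> a1 <= n%:R ->
  a2 <= n%:R -> measurable_fun setT u -> measurable_fun setT f -> measurable_fun setT g ->
  (\int[mu2]_z (`|K x z.1 z.2 * (u z.1 - u x) * f z.1 * g z.2|)%:E <=
   C%:E * (potential mu (fun z => `|u z.1 - u z.2|%R) a1 f x * potential mu (cst 1%R) a2 g x))%E.
Proof.
move=> aE a1n a2n mu_ mf mg.
apply: (kernel_integral_le Hmu n0 (alpha := alpha)
  (k := fun z : E * E => K x z.1 z.2 * (u z.1 - u x))) => //.
- apply: measurable_funM; first exact: measurable_kernel_at.
  by apply: measurable_funB => //; exact: (measurableT_comp mu_ measurable_fst).
- apply: measurableT_comp => //; apply: measurable_funB.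
  + exact: (measurableT_comp mu_ measurable_fst).
  + exact: (measurableT_comp mu_ measurable_snd).
- exact: ltW.
- move=> y z xy xz /=; rewrite normrM distrC mulrAC ler_wpM2r //.
  exact: (proj1 HK _ _ _ (offdiag_ne xy)).
Qed.

Lemma kernel_abs_integral_le a1 a2 f g (x : E) : a1 + a2 = alpha -> a1 <= n%:R ->
  a2 <= n%:R -> measurable_fun setT f -> measurable_fun setT g ->
  (\int[mu2]_z (`|K x z.1 z.2 * f z.1 * g z.2|)%:E <=
   C%:E * (potential mu (cst 1%R) a1 f x * potential mu (cst 1%R) a2 g x))%E.
Proof.
move=> aE a1n a2n mf mg.
apply: (kernel_integral_le Hmu n0 (alpha := alpha) (k := fun z : E * E => K x z.1 z.2)) => //.
- exact: measurable_kernel_at.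
- exact: ltW.
- move=> y z xy xz /=; rewrite mulr1.
  exact: (proj1 HK _ _ _ (offdiag_ne xy)).
Qed.

Lemma comm1_bounded (b : E -> R) : BMO mu b -> exists2 B : R, 0 <= B & forall f g,
  measurable_fun setT f -> measurable_fun setT g ->
  (\int[mu]_x (`|f x| `^ p)%:E <= 1)%E -> (\int[mu]_x (`|g x| `^ q)%:E <= 1)%E ->
  (\int[mu]_x (`|comm1 mu K b f g x| `^ r)%:E <= (B `^ r)%:E)%E.
Proof.
move=> [lb [M0 HM0]].
have r0 : 0 < r by move: r1; lra.
have mb := locally_integrable_measurable lb.
have [a1 [a2 [p2 [q2 [[a10 a20 aE a1n a2n] [p20 q20] p2E q2E rE2]]]]] :=
  split_exponents n0 alpha0 p1 q1 r0 rE.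
have [s [c [s1 c0 Hc]]] := potential_product Hmu n0 a10 p1 p20 p2E a20 q1 q20 q2E r0 rE2.
have [CB CB0 HCB] := cube_bound_BMO Hmu s1.
(* The bound on the mean oscillation may be 0, while John-Nirenberg is stated for a positive one. *)
pose M := Num.max 1 M0.
have M1 : 0 < M by rewrite lt_max ltr01.
have Hb : cube_bound mu s (fun z => `|b z.1 - b z.2|) (CB * M).
  by apply: HCB => // Q /HM0 QM; rewrite le_max QM orbT.
exists (C * (c * (CB * M))); first by rewrite !mulr_ge0 // ltW.
move=> f g mf mg f1 g1.
have f1' : (\int[mu]_x (`|f x| `^ p)%:E <= (1 `^ p)%:E)%E by rewrite powR1; exact: f1.
have mw : measurable_fun setT (fun z : E * E => `|b z.1 - b z.2|).
  apply: measurableT_comp => //; apply: measurable_funB.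
  - exact: (measurableT_comp mb measurable_fst).
  - exact: (measurableT_comp mb measurable_snd).
have mc1 : measurable_fun setT (cst 1 : E * E -> R) by exact: measurable_cst.
have c10 (z : E * E) : 0 <= cst 1 z :> R by rewrite /= ler01.
have [h1 [mh1 h10 h1r h1E]] := Hc _ _ _ (mulr_ge0 (ltW CB0) (ltW M1)) ltr01 mw
  (fun z => normr_ge0 _) Hb f g mf mg f1' g1.
have [h0 [mh0 h00 h0r h0E]] := Hc _ _ _ ler01 ltr01 mc1 c10 (cube_bound1 Hmu s1) f g mf mg f1' g1.
rewrite mulr1 in h1r.
have mcomm := measurable_comm1 mu mK mb mf mg.
apply: (@le_trans _ _ (\int[mu]_x ((C * h1 x) `^ r)%:E)%E).
  apply: ae_integral_powR_le; rewrite ?(ltW r0) //; first exact: measurable_funM.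
    by move=> x; rewrite mulr_ge0 // ltW.
  apply: filterS2 h1E h0E => x h1E h0E.
  have H0 := kernel_abs_integral_le x aE a1n a2n mf mg; rewrite h0E -EFinM in H0.
  have H1 := kernel_mul_integral_le x aE a1n a2n mb mf mg; rewrite h1E -EFinM in H1.
  have zero : (\int[mu2]_z (`|cst 0 z * f z.1 * g z.2|)%:E <= 0%:E)%E.
    rewrite (eq_integral (cst 0%E)) ?integral0 // => z _.
    by rewrite /= !mul0r normr0.
  have zero' : (\int[mu2]_z (`|(K x z.1 z.2 * (cst 0 z.1 - cst 0 x) - cst 0 z) * f z.1 * g z.2|)%:E <= 0%:E)%E.
    rewrite (eq_integral (cst 0%E)) ?integral0 // => z _.
    by rewrite /= subrr mulr0 subrr !mul0r normr0.
  (* Nothing is approximated here: [beta = b], [phi = 0] and [G = 0]. *)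
  have bE y : b y = b y + cst 0 y by rewrite addr0.
  have := comm1_at mK mb (measurable_cst _) mf mg (measurable_cst _) bE H0 H1 zero' zero.
  rewrite addr0 (_ : fine _ = 0) ?subr0 //.
  rewrite (eq_integral (cst 0%E)) ?integral0 // => z _.
  by rewrite /= !mul0r.
by apply: integral_powR_scale => //; rewrite ?mulr_ge0 // ltW.
Qed.

End boundedness.

(** * Finite rank approximation *)

Section tails.
Context {R : realType} {n : nat} (mu : {sigma_finite_measure set (Rn R n) -> \bar R})
  (Hmu : is_lebesgue mu) (n0 : (0 < n)%N).
Local Notation E := (Rn R n).
Local Notation mu2 := (mu \x mu)%E.
Implicit Types (f g : E -> R).

Definition box (A : R) : set E := cube (const_mx (- A)) (2 * A).

Lemma boxP A (x : E) : box A x <-> forall i, `|tov x ord0 i| <= A.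
Proof.
by split=> H i; move: (H i); rewrite ?mxE ler_norml => /andP[? ?]; apply/andP; split; lra.
Qed.

Lemma box_far (A0 T : R) (x y : E) : ~ hcube (const_mx (- (A0 + T))) (2 * (A0 + T)) x ->
  box A0 y -> T <= enorm (tov x - tov y).
Proof.
move=> xA /boxP yA.
have [i xi] : exists i, ~ (- (A0 + T) <= tov x ord0 i < A0 + T).
  apply: contrapT => H; apply: xA => i; rewrite mxE.
  rewrite (_ : - _ + _ = A0 + T); last by ring.
  by apply: contrapT => Hi; apply: H; exists i.
rewrite (le_trans _ (coord_le_enorm _ i)) // !mxE.
have := yA i; rewrite ler_norml => /andP[y1 y2].
have [x1|x1] := leP (- (A0 + T)) (tov x ord0 i); have [x2|x2] := ltP (tov x ord0 i) (A0 + T).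
- by exfalso; apply: xi; rewrite x1 x2.
- by rewrite (le_trans _ (ler_norm _)) //; lra.
- by rewrite distrC (le_trans _ (ler_norm _)) //; lra.
- by rewrite (le_trans _ (ler_norm _)) //; lra.
Qed.

Lemma riesz_shift (a e T : R) (x y : E) : 0 < T -> 0 <= e -> T <= enorm (tov x - tov y) ->
  riesz a (x, y) <= T `^ (- e) * riesz (a + e) (x, y).
Proof.
move=> T0 e0 Txy; have xy0 : 0 < enorm (tov x - tov y) by exact: lt_le_trans Txy.
rewrite /riesz /= powRN -invfM lef_pV2 ?posrE ?mulr_gt0 ?powR_gt0 //.
rewrite (_ : n%:R - a = e + (n%:R - (a + e))); last by ring.
rewrite [leRHS]powRD; last by apply/implyP => _; rewrite gt_eqF.
by rewrite ler_wpM2r ?powR_ge0 // ler_powRl // ltW.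
Qed.

(** On the box [|f|^p' <= 1 + |f|^p], and the constant 1 is integrable there because the box has
    finite measure. *)
Lemma integral_box_powR_le (A p p' : R) f : 0 < A -> 0 < p' -> p' <= p ->
  measurable_fun setT f -> (\int[mu]_x (`|f x| `^ p)%:E <= 1)%E ->
  (\int[mu]_x (`|f x * \1_(box A) x| `^ p')%:E <= ((2 * A) ^+ n + 1)%:E)%E.
Proof.
move=> A0 p'0 pp mf f1.
have mB : measurable (box A) by exact: measurable_cube.
have mi : measurable_fun setT (\1_(box A) : E -> R) by exact: measurable_indic.
apply: (@le_trans _ _ (\int[mu]_x (\1_(box A) x + `|f x| `^ p)%:E)%E).
  apply: le_integralR.
  - exact: measurableT.
  - by apply: measurable_norm_powR; exact: measurable_funM.
  - by apply: measurable_funD => //; exact: measurable_norm_powR.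
  - by move=> x; exact: powR_ge0.
  - move=> x _; rewrite indicE; case: (boolP (x \in box A)) => _; last first.
      by rewrite mulr0 normr0 powR0 ?gt_eqF // add0r powR_ge0.
    rewrite mulr1; have [f1x|f1x] := leP `|f x| 1.
      rewrite (le_trans (_ : _ <= 1 `^ p')) ?ler_powRl ?(ltW p'0) //.
      by rewrite powR1 lerDl powR_ge0.
    rewrite (le_trans (_ : _ <= `|f x| `^ p)) ?lerDr //.
    by rewrite ler_powR // ltW.
rewrite ge0_integralDR; [|exact: measurableT|exact: mi|exact: measurable_norm_powR
  |by move=> x; rewrite indicE|by move=> x; exact: powR_ge0].
rewrite EFinD leeD // integral_indic // setIT.
by rewrite [leLHS](mu_cube Hmu) // mulr_ge0 // ltW.
Qed.

End tails.

Lemma ler_chain (R : realDomainType) (k ph C L N t r r1 r2 : R) : 0 <= k -> 0 <= ph ->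
  0 <= C -> 0 <= r2 -> k <= C * N -> N <= r1 * r2 -> r1 <= t * r -> ph <= L ->
  k * ph <= C * L * t * 1 * (r * r2).
Proof.
move=> k0 ph0 C0 r20 kC Nr r1t phL.
rewrite (_ : C * L * t * 1 * _ = C * (t * r * r2) * L); last by ring.
apply: ler_pM => //; apply: le_trans kC _; apply: ler_wpM2l => //.
by apply: le_trans Nr _; rewrite ler_wpM2r.
Qed.

Section approximation.
Context {R : realType} {n : nat} (mu : {sigma_finite_measure set (Rn R n) -> \bar R})
  (Hmu : is_lebesgue mu) (n0 : (0 < n)%N).
Local Notation E := (Rn R n).
Local Notation mu2 := (mu \x mu)%E.
Implicit Types (f g : E -> R).

Lemma locally_integrable_bounded (u : E -> R) (L : R) : 0 <= L -> measurable_fun setT u ->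
  (forall x, `|u x| <= L) -> Defs.locally_integrable mu u.
Proof.
move=> L0 mu_ uL _ [a [l [l0 ->]]].
have mQ : measurable (cube a l : set E) by exact: measurable_cube.
apply/integrableP; split; first by apply/measurable_EFinP; exact: measurable_funTS.
apply: (@le_lt_trans _ _ (\int[mu]_(x in cube a l) (L * cst 1 x)%:E)%E).
  apply: (@le_integralR _ _ _ mu _ (fun x => `|u x|)); [exact: mQ|exact: measurableT_comp
    |by apply: measurable_funM; exact: measurable_cst|by []|by move=> x _; rewrite /= mulr1].
rewrite ge0_integralZ; [|exact: mQ|exact: measurable_cst|by move=> x; rewrite /= ler01|exact: L0].
by rewrite integral_one // [X in (_ * X)%E](mu_cube Hmu a (ltW l0)) -EFinM ltry.
Qed.

Lemma locally_integrableB (u v : E -> R) : Defs.locally_integrable mu u ->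
  Defs.locally_integrable mu v -> Defs.locally_integrable mu (fun x => u x - v x).
Proof.
move=> iu iv Q cQ; have mQ : measurable Q.
  by case: cQ => a [l [_ ->]]; exact: measurable_cube.
exact: (integrableB mQ (iu _ cQ) (iv _ cQ)).
Qed.

Variables (alpha p q r C : R) (K : E -> E -> E -> R).
Hypotheses (alpha0 : 0 < alpha) (alphan : alpha < 2 * n%:R) (p1 : 1 < p) (q1 : 1 < q)
  (r1 : 1 <= r) (rE : r^-1 = p^-1 + q^-1 - alpha / n%:R)
  (mK : measurable_fun setT (fun t : E * (E * E) => K t.1 t.2.1 t.2.2))
  (C0 : 0 < C) (HK : frac_kernel alpha C K).

(* Off the box where [phi] vanishes, trading a little integrability of [f] for a
   larger order of the potential gains the decaying factor [T `^ (- e)]. *)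
Lemma kernel_tail_le (phi : E -> R) (L A0 T e a1 a2 : R) f g (x : E) :
  0 < L -> 0 < T -> 0 <= e -> a1 + a2 = alpha -> a1 <= n%:R -> a2 <= n%:R ->
  measurable_fun setT phi -> measurable_fun setT f -> measurable_fun setT g ->
  (forall y, `|phi y| <= L) -> (forall y, phi y != 0 -> box A0 y) ->
  ~ box A0 x -> ~ hcube (const_mx (- (A0 + T))) (2 * (A0 + T)) x ->
  (\int[mu2]_z (`|(K x z.1 z.2 * (phi z.1 - phi x) - cst 0 z) * f z.1 * g z.2|)%:E <=
   (C * L * T `^ (- e))%:E *
   (potential mu (cst 1%R) (a1 + e) (fun y => f y * \1_(box A0) y)%R x *
    potential mu (cst 1%R) a2 g x))%E.
Proof.
move=> L0 T0 e0 aE a1n a2n mphi mf mg phiL phiA xA0 xA.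
have mB : measurable_fun setT (\1_(box A0) : E -> R).
  by apply: measurable_indic; exact: measurable_cube.
have phix : phi x = 0 by apply: contrapT => /eqP /phiA.
apply: (integral_potential_le Hmu n0 (a2 := a2)) => //.
- apply: measurable_tensor => //; apply: measurable_funB; last exact: measurable_cst.
  apply: measurable_funM; first exact: measurable_kernel_at.
  by apply: measurable_funB => //; exact: (measurableT_comp mphi measurable_fst).
- exact: measurable_funM.
- by rewrite !mulr_ge0 ?powR_ge0 ?(ltW C0) ?(ltW L0).
move=> y z xy xz /=; rewrite phix !subr0.
have [->|py] := eqVneq (phi y) 0.
  by rewrite mulr0 !mul0r normr0 !mulr_ge0 ?powR_ge0 ?riesz_ge0 ?ler01 ?(ltW C0) ?(ltW L0).
have yA := phiA _ py.
rewrite indicE mem_set // mulr1 !normrM.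
have Kb := proj1 HK _ _ _ (offdiag_ne (z := z) xy).
have Ks := kernel_split a1n a2n xy xz; rewrite aE in Ks.
have rs := riesz_shift a1 T0 e0 (box_far xA yA).
apply: ler_regroup => //.
exact: (ler_chain (normr_ge0 _) (normr_ge0 _) (ltW C0) (riesz_ge0 _ _) Kb Ks rs (phiL y)).
Qed.

(** [c] is a number, while [h] is controlled only through its norm in [L^r]; integrating the
    pointwise bound over [Q], of measure [v], makes it uniform over the unit balls. *)
Lemma coefficient_bound (Q : set E) (v c B : R) (h : E -> R) : measurable Q -> 0 < v ->
  mu Q = v%:E -> measurable_fun setT h -> (forall x, 0 <= h x) -> 0 <= B ->
  (\int[mu]_x (h x `^ r)%:E <= (B `^ r)%:E)%E ->
  {ae mu, forall x, Q x -> `|c| <= h x} -> `|c| <= B / v `^ r^-1.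
Proof.
move=> mQ v0 Qv mh h0 B0 hB cQ.
have r0 : 0 < r by move: r1; lra.
have H : (((`|c| * v `^ r^-1) `^ r)%:E <= (B `^ r)%:E)%E.
  apply: le_trans hB.
  rewrite powRM ?powR_ge0 // -powRrM mulVf ?gt_eqF // powRr1 ?(ltW v0) // EFinM -Qv.
  have -> : ((`|c| `^ r)%:E * mu Q = \int[mu]_x ((`|c| `^ r) * \1_Q x)%:E)%E.
    rewrite ge0_integralZ; [|exact: measurableT|exact: measurable_indic|by move=> x; rewrite indicE|exact: powR_ge0].
    by rewrite integral_indic // setIT.
  apply: ae_ge0_le_integral.
  - exact: measurableT.
  - by move=> x _; rewrite lee_fin mulr_ge0 ?powR_ge0 // indicE.
  - by apply/measurable_EFinP/measurable_funM => //; exact: measurable_indic.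
  - by move=> x _; rewrite lee_fin powR_ge0.
  - by apply/measurable_EFinP; exact: (measurableT_comp (measurable_powR _)).
  - apply: filterS cQ => x cQ _; rewrite lee_fin indicE.
    case: (boolP (x \in Q)) => [|_]; last by rewrite mulr0 powR_ge0.
    by rewrite inE mulr1 => /cQ ch; rewrite ler_powRl // ltW.
rewrite ler_pdivlMr ?powR_gt0 // leNgt; apply/negP => lt.
move: H; rewrite lee_fin leNgt => /negP; apply.
by rewrite gt0_ltr_powR // nnegrE ?mulr_ge0 ?powR_ge0.
Qed.

End approximation.

Section finite_rank.
Context {R : realType} {n : nat} (mu : {sigma_finite_measure set (Rn R n) -> \bar R})
  (Hmu : is_lebesgue mu) (n0 : (0 < n)%N).
Local Notation E := (Rn R n).
Local Notation mu2 := (mu \x mu)%E.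
Implicit Types (f g : E -> R).
Variables (alpha p q r C : R) (K : E -> E -> E -> R).
Hypotheses (alpha0 : 0 < alpha) (alphan : alpha < 2 * n%:R) (p1 : 1 < p) (q1 : 1 < q)
  (r1 : 1 <= r) (rE : r^-1 = p^-1 + q^-1 - alpha / n%:R)
  (mK : measurable_fun setT (fun t : E * (E * E) => K t.1 t.2.1 t.2.2))
  (C0 : 0 < C) (HK : frac_kernel alpha C K).

(** Three errors are made, each of size at most [rho] in [L^r]: replacing [b] by [phi], dropping the
    region outside a box, and freezing [x] in a cell. The grid and the bound on the coefficients are
    fixed before [f] and [g], as [Lr_precompact] requires. *)
Lemma comm1_approx (b : E -> R) (eta : R) : CMO mu b -> 0 < eta ->
  exists (I : finType) (Q : I -> set E) (M : R),
    (forall i, measurable (Q i) /\ (mu (Q i) < +oo)%E) /\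
    forall f g, measurable_fun setT f -> measurable_fun setT g ->
      (\int[mu]_x (`|f x| `^ p)%:E <= 1)%E -> (\int[mu]_x (`|g x| `^ q)%:E <= 1)%E ->
    exists c : I -> R, (forall i, `|c i| <= M) /\
      (\int[mu]_x (`|comm1 mu K b f g x - \sum_i c i * \1_(Q i) x| `^ r)%:E <= eta%:E)%E.
Proof.
move=> [[lb _] Hb] eta0.
have r0 : 0 < r by move: r1; lra.
have nR : 0 < n%:R :> R by rewrite ltr0n.
have mb := locally_integrable_measurable lb.
have t0 : 0 < 3 * 2 `^ r * 2 `^ r :> R by rewrite !mulr_gt0 ?powR_gt0.
(* The three errors are added by two quasi-triangle inequalities, which give [2^r (2^r 2 rho^r +
   rho^r) <= 3 4^r rho^r = eta]. *)
pose rho := (eta / (3 * 2 `^ r * 2 `^ r)) `^ r^-1.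
have rho0 : 0 < rho by rewrite powR_gt0 // divr_gt0.
have rhoE : 2 `^ r * (2 `^ r * (rho `^ r + rho `^ r) + rho `^ r) <= eta.
  have e1 : rho `^ r = eta / (3 * 2 `^ r * 2 `^ r).
    by rewrite -powRrM mulVf ?gt_eqF // powRr1 // ltW // divr_gt0.
  have e2 : eta = 3 * 2 `^ r * 2 `^ r * rho `^ r by rewrite e1 mulrC divfK // gt_eqF.
  have e3 : 1 <= 2 `^ r :> R.
    by rewrite -[leLHS](powRr0 2) ler_powR // ?ler1n // ltW.
  have e4 : 0 <= 2 `^ r * rho `^ r * (2 `^ r - 1).
    by rewrite !mulr_ge0 ?powR_ge0 ?subr_ge0.
  rewrite [leRHS]e2 -subr_ge0 (le_trans e4) //.
  by rewrite le_eqVlt; apply/orP; left; apply/eqP; ring.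
clearbody rho.
have [a1 [a2 [p2 [q2 [[a10 a20 aE a1n a2n] [p20 q20] p2E q2E rE2]]]]] :=
  split_exponents n0 alpha0 p1 q1 r0 rE.
have ip : 0 < p^-1 by rewrite invr_gt0; move: p1; lra.
have ip1 : p^-1 < 1 by rewrite invf_lt1 //; move: p1; lra.
(* [1/p'] will be the midpoint of [1/p] and 1, so [1 < p' < p]; [e] is such that order [a1 + e] on
   [L^p'] has the same target exponent [p2] as order [a1] on [L^p]. *)
pose e := n%:R * (1 - p^-1) / 2.
have e0 : 0 < e by rewrite divr_gt0 // mulr_gt0 // subr_gt0.
pose p' := ((1 + p^-1) / 2)^-1.
have p'1 : 1 < p' by rewrite invf_gt1 //; lra.
have p'p : p' <= p by rewrite -[leRHS]invrK lef_pV2 ?posrE //; lra.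
have p2E' : p2^-1 = p'^-1 - (a1 + e) / n%:R.
  by rewrite p2E /p' /e invrK; field; rewrite !gt_eqF //; move: p1; lra.
clearbody e p'.
have p'0 : 0 < p' by lra.
have [s [c [s1 c0 Hc]]] := potential_product Hmu n0 a10 p1 p20 p2E a20 q1 q20 q2E r0 rE2.
have [s' [c' [s'1 c'0 Hc']]] :=
  potential_product Hmu n0 (addr_gt0 a10 e0) p'1 p20 p2E' a20 q1 q20 q2E r0 rE2.
have [CB CB0 HCB] := cube_bound_BMO Hmu s1.
(* Mean oscillation allowed to [b - phi]: the kernel, the potentials and the weight contribute the
   factors [C], [c] and [CB]. *)
pose eps := rho / (C * c * CB).
have eps0 : 0 < eps by rewrite divr_gt0 // !mulr_gt0.
have epsE : C * (c * (CB * eps)) = rho by rewrite /eps; field; rewrite !gt_eqF.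
clearbody eps.
have [phi0 [sphi [cphi osc]]] := Hb _ eps0.
have [L [A0 [L0 A00 lip bnd supp]]] := test_function_bounds sphi cphi.
pose phi (x : E) := phi0 (tov x).
have mphi : measurable_fun setT phi by exact: measurable_continuous (proj1 (sphi [::])).
have phiA y : phi y != 0 -> box A0 y by move=> /supp H; apply/boxP.
have phiL y : `|phi y| <= L by exact: bnd.
pose beta (x : E) := b x - phi x.
have mbeta : measurable_fun setT beta by exact: measurable_funB.
have Hbeta : cube_bound mu s (fun z => `|beta z.1 - beta z.2|) (CB * eps).
  apply: HCB => //; apply: locally_integrableB => //.
  exact: (locally_integrable_bounded Hmu (ltW L0) mphi phiL).
(* Bound for the [L^p'] norm of [f] restricted to the box that contains the support of [phi]. *)
pose V := ((2 * A0) ^+ n + 1) `^ p'^-1.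
have V1 : 0 < (2 * A0) ^+ n + 1 by rewrite ltr_wpDl // exprn_ge0 // mulr_ge0 // ltW.
have V0 : 0 < V by rewrite powR_gt0.
have VE : V `^ p' = (2 * A0) ^+ n + 1.
  by rewrite -powRrM mulVf ?gt_eqF // powRr1 // ltW.
clearbody V.
(* Distance at which the decay [T^(-e)] brings the tail down to [rho]. *)
pose T := (rho / (C * L * (c' * V))) `^ (- e^-1).
have T0 : 0 < T by rewrite powR_gt0 // divr_gt0 // !mulr_gt0.
have TE : C * L * T `^ (- e) * (c' * V) = rho.
  rewrite -powRrM mulrNN mulVf ?gt_eqF // powRr1; last by rewrite divr_ge0 ?mulr_ge0 // ltW.
  by field; rewrite !gt_eqF.
clearbody T.
pose eta1 := rho / c.
have eta10 : 0 < eta1 by rewrite divr_gt0.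
have eta1E : eta1 * c = rho by rewrite divfK // gt_eqF.
have alphaI : 0 < alpha < 2 * n%:R by rewrite alpha0.
have [delta [chi [delta0 mchi Hchi]]] :=
  kernel_discretise n0 alphaI C0 L0 HK (fun x y => lip (tov x) (tov y)) phiL eta10.
clearbody eta1.
pose l := 2 * (A0 + T).
have l0 : 0 < l by rewrite mulr_gt0 // addr_gt0.
pose a : 'rV[R]_n := const_mx (- (A0 + T)).
pose M := (Num.truncn (l / delta)).+1.
have M0 : (0 < M)%N by [].
have lM0 : 0 < l / M%:R by rewrite divr_gt0 // ltr0n.
have lMd : l / M%:R <= delta.
  rewrite ler_pdivrMr ?ltr0n // mulrC -ler_pdivrMr //.
  by apply: ltW; apply: truncnS_gt.
clearbody M.
pose Q (m : {ffun 'I_n -> 'I_M}) : set E := hcube (subcorner a l m) (l / M%:R).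
pose v := (l / M%:R) ^+ n.
have v0 : 0 < v by rewrite exprn_gt0.
have mQ m : measurable (Q m) by exact: measurable_hcube.
have Qv m : mu (Q m) = v%:E by exact: (mu_hcube Hmu _ (ltW lM0)).
pose c1 := 2 * L * C + eta1.
have c10 : 0 < c1 by rewrite addr_gt0 // !mulr_gt0.
exists {ffun 'I_n -> 'I_M}, Q, (c1 * c / v `^ r^-1); split.
  by move=> i; rewrite Qv ltry.
move=> f g mf mg f1 g1.
have f1' : (\int[mu]_x (`|f x| `^ p)%:E <= (1 `^ p)%:E)%E by rewrite powR1; exact: f1.
have mw : measurable_fun setT (fun z : E * E => `|beta z.1 - beta z.2|).
  apply: measurableT_comp => //; apply: measurable_funB.
  - exact: (measurableT_comp mbeta measurable_fst).
  - exact: (measurableT_comp mbeta measurable_snd).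
have m1 : measurable_fun setT (cst 1 : E * E -> R) by exact: measurable_cst.
have p10 (z : E * E) : 0 <= cst 1 z :> R by rewrite /= ler01.
have [h1 [mh1 h10 h1r h1E]] := Hc _ _ _ (mulr_ge0 (ltW CB0) (ltW eps0)) ltr01 mw
  (fun z => normr_ge0 _) Hbeta f g mf mg f1' g1.
have [h0 [mh0 h00 h0r h0E]] := Hc _ _ _ ler01 ltr01 m1 p10 (cube_bound1 Hmu s1) f g mf mg f1' g1.
have mfB : measurable_fun setT (fun y => f y * \1_(box A0) y).
  by apply: measurable_funM => //; apply: measurable_indic; exact: measurable_cube.
have f2 := integral_box_powR_le Hmu A00 p'0 p'p mf f1; rewrite -VE in f2.
have [h3 [mh3 h30 h3r h3E]] := Hc' _ _ _ ler01 V0 m1 p10 (cube_bound1 Hmu s'1) _ g mfB mg f2 g1.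
rewrite !mulr1 in h1r h0r h3r.
pose ctr (m : {ffun 'I_n -> 'I_M}) : E := ofv (subcorner a l m).
pose G m (z : E * E) := chi (ctr m) z * K (ctr m) z.1 z.2 * (phi z.1 - phi (ctr m)).
have mG m : measurable_fun setT (G m).
  apply: measurable_funM; first by apply: measurable_funM => //; exact: measurable_kernel_at.
  by apply: measurable_funB => //; exact: (measurableT_comp mphi measurable_fst).
(* The value at the corner of the cell of the operator with the cut-off kernel, used on the whole
   cell. *)
pose cf m := fine (\int[mu2]_z (G m z * f z.1 * g z.2)%:E)%E.
have diff m x : Q m x -> forall y z, x <> y ->
    `|K x y z * (phi y - phi x) - G m (y, z)| <= eta1 * (dist3 x y z `^ (2 * n%:R - alpha))^-1.
  move=> xm y z xy; apply: Hchi; last exact: offdiag_ne.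
  by rewrite (le_trans (grid_dist l0 xm)).
have Gint m x : Q m x -> (potential mu (cst 1%R) a1 f x * potential mu (cst 1%R) a2 g x)%E = (h0 x)%:E ->
    (\int[mu2]_z (`|G m z * f z.1 * g z.2|)%:E <= (c1 * h0 x)%:E)%E.
  move=> xm h0x; rewrite EFinM -h0x.
  apply: (kernel_integral_le Hmu n0 (alpha := alpha)) => //; first exact: ltW.
  move=> y z xy xz; rewrite /= mulr1.
  have -> : G m (y, z) = K x y z * (phi y - phi x) - (K x y z * (phi y - phi x) - G m (y, z)).
    by rewrite subKr.
  rewrite (le_trans (ler_normB _ _)) // /c1 mulrDl lerD //; last exact: diff xm _ _ xy.
  rewrite normrM (_ : 2 * L * C * _ = C / dist3 x y z `^ (2 * n%:R - alpha) * (2 * L)); last by ring.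
  rewrite ler_pM //; first exact: (proj1 HK _ _ _ (offdiag_ne xy)).
  by rewrite (le_trans (ler_normB _ _)) // mulr_natl mulr2n lerD.
(* [cf m] does not depend on [x], yet at almost every [x] of the cell it is at most [c1 h0 x] in
   absolute value. *)
exists cf; split.
  move=> m; apply: (coefficient_bound r1 (mQ m) v0 (Qv m) (h := fun x => c1 * h0 x)).
  - exact: measurable_funM.
  - by move=> x; rewrite mulr_ge0 // ltW.
  - by rewrite mulr_ge0 // ltW.
  - by apply: integral_powR_scale => //; rewrite ltW.
  - apply: filterS h0E => x h0x xm.
    by apply: normr_fine_integral_le (Gint _ _ xm h0x); exact: measurable_tensor.
have bE y : b y = beta y + phi y by rewrite subrK.
pose t3 := C * L * T `^ (- e).
have t30 : 0 <= t3 by rewrite !mulr_ge0 ?powR_ge0 // ltW.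
pose hh x := (C * h1 x + eta1 * h0 x) + t3 * h3 x.
have g1_0 x : 0 <= C * h1 x by rewrite mulr_ge0 // ltW.
have g0_0 x : 0 <= eta1 * h0 x by rewrite mulr_ge0 // ltW.
have g3_0 x : 0 <= t3 * h3 x by rewrite mulr_ge0.
have mg1 : measurable_fun setT (fun x => C * h1 x) by exact: measurable_funM.
have mg0 : measurable_fun setT (fun x => eta1 * h0 x) by exact: measurable_funM.
have mg3 : measurable_fun setT (fun x => t3 * h3 x) by exact: measurable_funM.
have mP : measurable_fun setT (fun x => \sum_i cf i * \1_(Q i) x).
  by apply: measurable_sum => i; apply: measurable_funM => //; exact: measurable_indic.
have mcomm := measurable_comm1 mu mK mb mf mg.
have mhh : measurable_fun setT hh by do 2!apply: measurable_funD => //.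
have hh0 x : 0 <= hh x by rewrite /hh !addr_ge0.
apply: (@le_trans _ _ (\int[mu]_x (hh x `^ r)%:E)%E).
  apply: ae_integral_powR_le; rewrite ?(ltW r0) //; first exact: measurable_funB.
  apply: filterS3 h1E h0E h3E => x h1x h0x h3x.
  have H0 := kernel_abs_integral_le Hmu n0 mK C0 HK x aE a1n a2n mf mg; rewrite h0x -EFinM in H0.
  have H1 := kernel_mul_integral_le Hmu n0 mK C0 HK x aE a1n a2n mbeta mf mg.
  rewrite h1x -EFinM in H1.
  (* In the large cube the commutator is compared with the coefficient of the cell of [x]; outside,
     the step function is 0 and all of the [phi] part counts as tail error. *)
  have [xa|xa] := pselect (hcube a l x).
    have [m xm] := proj1 (hcube_subdiv _ _ M0 l0) xa.
    rewrite (grid_sum M0 l0 _ xm).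
    have H2 : (\int[mu2]_z (`|(K x z.1 z.2 * (phi z.1 - phi x) - G m z) * f z.1 * g z.2|)%:E <=
        (eta1 * h0 x)%:E)%E.
      rewrite EFinM -h0x.
      apply: (kernel_integral_le Hmu n0 (alpha := alpha)
        (k := fun z : E * E => K x z.1 z.2 * (phi z.1 - phi x) - G m z)) => //.
      + apply: measurable_funB => //; apply: measurable_funM; first exact: measurable_kernel_at.
        by apply: measurable_funB => //; exact: (measurableT_comp mphi measurable_fst).
      + exact: ltW.
      + by move=> y z xy xz; rewrite /= mulr1; exact: diff xm _ _ xy.
    rewrite (le_trans (comm1_at mK mbeta mphi mf mg (mG m) bE H0 H1 H2 (Gint _ _ xm h0x))) //.
    by rewrite /hh lerDl.
  rewrite (grid_sum0 M0 l0 _ xa) subr0.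
  (* With [y = x], [box_far] would give [T <= 0]. *)
  have xA0 : ~ box A0 x.
    move=> xA0; have := box_far xa xA0; rewrite subrr.
    rewrite /enorm big1 ?sqrtr0; last by move=> i _; rewrite mxE expr0n.
    by move=> /(lt_le_trans T0); rewrite ltxx.
  have H2 := kernel_tail_le Hmu n0 mK C0 HK L0 T0 (ltW e0) aE a1n a2n mphi mf mg phiL phiA xA0 xa.
  rewrite h3x -EFinM in H2.
  have zero : (\int[mu2]_z (`|cst 0 z * f z.1 * g z.2|)%:E <= 0%:E)%E.
    rewrite (eq_integral (cst 0%E)) ?integral0 // => z _.
    by rewrite /= !mul0r normr0.
  have := comm1_at mK mbeta mphi mf mg (measurable_cst _) bE H0 H1 H2 zero.
  rewrite (_ : fine _ = 0) ?subr0; last first.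
    rewrite (eq_integral (cst 0%E)) ?integral0 // => z _.
    by rewrite /= !mul0r.
  by move/le_trans; apply; rewrite /hh lerD2r lerDl.
have b1 : (\int[mu]_x (`|C * h1 x| `^ r)%:E <= (rho `^ r)%:E)%E.
  under eq_integral => x _ do rewrite (ger0_norm (g1_0 x)).
  by rewrite -epsE; apply: integral_powR_scale; rewrite ?mulr_ge0 // ltW.
have b0 : (\int[mu]_x (`|eta1 * h0 x| `^ r)%:E <= (rho `^ r)%:E)%E.
  under eq_integral => x _ do rewrite (ger0_norm (g0_0 x)).
  by rewrite -eta1E; apply: integral_powR_scale; rewrite // ltW.
have b3 : (\int[mu]_x (`|t3 * h3 x| `^ r)%:E <= (rho `^ r)%:E)%E.
  under eq_integral => x _ do rewrite (ger0_norm (g3_0 x)).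
  by rewrite -TE; apply: integral_powR_scale => //; rewrite mulr_ge0 // ltW.
have b10 := integral_powR_add_le r0 mg1 mg0 b1 b0.
have := integral_powR_add_le r0 (measurable_funD mg1 mg0) mg3 b10 b3.
under eq_integral => x _ do rewrite ger0_norm ?addr_ge0 //.
by move/le_trans; apply; rewrite lee_fin.
Qed.

End finite_rank.

(** * Compactness *)

Section compactness.
Context {R : realType} {n : nat} (mu : {sigma_finite_measure set (Rn R n) -> \bar R})
  (Hmu : is_lebesgue mu) (n0 : (0 < n)%N).
Local Notation E := (Rn R n).
Local Notation mu2 := (mu \x mu)%E.

Lemma unit_ball_integral (p : R) (f : E -> R) : 0 < p ->
  (Lnorm mu p%:E (EFin \o f) <= 1)%E -> (\int[mu]_x (`|f x| `^ p)%:E <= 1)%E.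
Proof. by move=> p0 /(Lnorm_leP mu f p0 ler01); rewrite powR1. Qed.

Lemma comm1_compact (alpha p q r C : R) (K : E -> E -> E -> R) (b : E -> R) :
  0 < alpha -> alpha < 2 * n%:R -> 1 < p -> 1 < q -> 1 <= r ->
  r^-1 = p^-1 + q^-1 - alpha / n%:R ->
  measurable_fun setT (fun t : E * (E * E) => K t.1 t.2.1 t.2.2) ->
  0 < C -> frac_kernel alpha C K -> CMO mu b ->
  compact_bilinear mu p q r (comm1 mu K b).
Proof.
move=> alpha0 alphan p1 q1 r1 rE mK C0 HK Hb.
have p0 : 0 < p by lra.
have q0 : 0 < q by lra.
have r0 : 0 < r by lra.
have [B B0 HB] := comm1_bounded Hmu n0 alpha0 p1 q1 r1 rE mK C0 HK (proj1 Hb).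
have mb := locally_integrable_measurable (proj1 (proj1 Hb)).
split=> [f g [mf _] [mg _] f1 g1|fs gs Hf Hg].
  split; first exact: measurable_comm1.
  apply/(Lnorm_lty mu _ r0); apply: le_lt_trans (ltry (B `^ r)).
  by apply: HB => //; exact: unit_ball_integral.
have mf k : measurable_fun setT (fs k) by case: (Hf k) => -[].
have mg k : measurable_fun setT (gs k) by case: (Hg k) => -[].
have f1 k := unit_ball_integral p0 (proj2 (Hf k)).
have g1 k := unit_ball_integral q0 (proj2 (Hg k)).
have [phi [phiS [h [mh hr hE]]]] : exists phi : nat -> nat, (forall k, (phi k < phi k.+1)%N) /\
    exists h : E -> R, [/\ measurable_fun setT h, (\int[mu]_x (`|h x| `^ r)%:E < +oo)%E &
      forall k, (\int[mu]_x (`|comm1 mu K b (fs (phi k)) (gs (phi k)) x - h x| `^ r)%:E <=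
        ((2^-1 ^+ k) `^ r)%:E)%E].
  apply: (@Lr_precompact _ _ _ mu (fun k => comm1 mu K b (fs k) (gs k)) r r1).
  - by move=> k; exact: measurable_comm1.
  - by move=> k; apply: le_lt_trans (ltry (B `^ r)); exact: HB.
  - move=> eta eta0.
    have [I [Q [M [HQ HM]]]] := comm1_approx Hmu n0 alpha0 alphan p1 q1 r1 rE mK C0 HK Hb eta0.
    have [c Hc] := choice (fun k => HM _ _ (mf k) (mg k) (f1 k) (g1 k)).
    by exists I, c, Q, M; split=> // k; case: (Hc k).
exists phi; split=> //; exists h; split; first by split=> //; exact/(Lnorm_lty mu _ r0).
apply: (@squeeze_cvge _ _ _ _ (cst 0%E) _ (fun k => (2^-1 ^+ k)%:E)).
- apply: nearW => k; rewrite /cst Lnorm_ge0 /=.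
  by apply/(Lnorm_leP mu _ r0) => //; exact: hE.
- exact: cvg_cst.
- by apply: cvg_EFin; [exact: nearW|apply: cvg_expr; rewrite ger0_norm; lra].
Qed.

(** Positive and negative parts are exchanged separately, so the equality holds also where the
    integral does not converge absolutely. *)
Lemma integral_swap (F : E * E -> \bar R) : measurable_fun setT F ->
  (\int[mu2]_z F (z.2, z.1) = \int[mu2]_z F z)%E.
Proof.
move=> mF.
have ge0 (H : E * E -> \bar R) : measurable_fun setT H -> (forall z, 0 <= H z)%E ->
    (\int[mu2]_z H (z.2, z.1) = \int[mu2]_z H z)%E.
  move=> mH H0.
  have mH' : measurable_fun setT (fun z : E * E => H (z.2, z.1)).
    by apply: (measurableT_comp mH); apply: measurable_fun_pair; [exact: measurable_snd|exact: measurable_fst].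
  by rewrite [LHS](fubini_tonelli1 _ mH') // [RHS](fubini_tonelli2 _ mH).
rewrite [LHS]integralE [RHS]integralE; congr (_ - _)%E.
- rewrite -[RHS](ge0 _ (measurable_funepos mF)) //.
  by apply: eq_integral => z _; rewrite !funeposE.
- rewrite -[RHS](ge0 _ (measurable_funeneg mF)) //.
  by apply: eq_integral => z _; rewrite !funenegE.
Qed.

Lemma comm2_swap (K : E -> E -> E -> R) (b f g : E -> R) :
  measurable_fun setT (fun t : E * (E * E) => K t.1 t.2.1 t.2.2) ->
  measurable_fun setT b -> measurable_fun setT f -> measurable_fun setT g ->
  comm2 mu K b f g = comm1 mu (fun x y z => K x z y) b g f.
Proof.
move=> mK mb.
have TopE (f' g' : E -> R) : measurable_fun setT f' -> measurable_fun setT g' ->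
    Top mu K f' g' = Top mu (fun x y z => K x z y) g' f'.
  move=> mf' mg'; apply/funext => x; rewrite /Top; congr fine.
  have mF : measurable_fun setT (fun z : E * E => (K x z.1 z.2 * f' z.1 * g' z.2)%:E).
    apply/measurable_EFinP; apply: (measurable_tensor (k := fun z : E * E => K x z.1 z.2)) => //.
    exact: measurable_kernel_at.
  rewrite -[LHS](integral_swap mF); apply: eq_integral => z _ /=.
  by congr EFin; rewrite mulrAC.
move=> mf mg; apply/funext => x; rewrite /comm2 /comm1 (TopE f (fun z => b z * g z)) //.
  by rewrite (TopE f g).
exact: measurable_funM.
Qed.

Lemma frac_kernel_swap (alpha C : R) (K : E -> E -> E -> R) :
  frac_kernel alpha C K -> frac_kernel alpha C (fun x y z => K x z y).
Proof.
have od (x y z : E) : offdiag x y z -> offdiag x z y by move=> H [? ?]; exact: H.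
have dE (x y z : E) : dist3 x y z = dist3 x z y by rewrite /dist3 addrC.
have mE (x y z : E) : maxd x y z = maxd x z y by rewrite /maxd maxC.
move=> [H1 [H2 [H3 H4]]]; split; first by move=> x y z xyz; rewrite dE; exact/H1/od.
split; first by move=> x y z h xyz; rewrite mE dE; exact/H2/od.
split; first by move=> x y z h xyz; rewrite mE dE; exact/H4/od.
by move=> x y z h xyz; rewrite mE dE; exact/H3/od.
Qed.

Lemma compact_bilinear_swap (p q r : R) (B B' : (E -> R) -> (E -> R) -> E -> R) :
  (forall f g, measurable_fun setT f -> measurable_fun setT g -> B f g = B' g f) ->
  compact_bilinear mu q p r B' -> compact_bilinear mu p q r B.
Proof.
move=> BE [H1 H2]; split=> [f g Lf Lg f1 g1|fs gs Hf Hg].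
  by rewrite BE; [exact: H1|case: Lf|case: Lg].
have [phi [phiS [h [Lh ch]]]] := H2 _ _ Hg Hf.
exists phi; split=> //; exists h; split=> //.
rewrite (_ : (fun k => _) = (fun k => Lnorm mu r%:E (EFin \o (B' (gs (phi k)) (fs (phi k)) \- h)))) //.
apply/funext => k; rewrite BE //; first by case: (Hf (phi k)) => -[].
by case: (Hg (phi k)) => -[].
Qed.

End compactness.

Theorem theorem2p1 (R : realType) (n : nat) (alpha p q r C : R)
  (mu : {measure set (Rn R n) -> \bar R})
  (K : Rn R n -> Rn R n -> Rn R n -> R) (b : Rn R n -> R) :
  (1 <= n)%N -> 0 < alpha -> alpha < 2 * n%:R ->
  1 < p -> 1 < q -> 1 <= r ->
  alpha / n%:R < p^-1 + q^-1 ->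
  r^-1 = p^-1 + q^-1 - alpha / n%:R ->
  is_lebesgue mu ->
  measurable_fun setT (fun t : Rn R n * (Rn R n * Rn R n) => K t.1 t.2.1 t.2.2) ->
  0 < C -> frac_kernel alpha C K ->
  CMO mu b ->
  compact_bilinear mu p q r (comm1 mu K b) /\
  compact_bilinear mu p q r (comm2 mu K b).
Proof.
move=> n0 alpha0 alphan p1 q1 r1 _ rE Hmu mK C0 HK Hb.
(* The estimates are stated for a measure bundled as sigma-finite; the goal is moved to [nu], which
   equals [mu]. *)
have [nu nuE] := sigma_finite_pack (lebesgue_sigma_finite Hmu).
rewrite -{mu}nuE in Hmu Hb *.
have mb := locally_integrable_measurable (proj1 (proj1 Hb)).
split; first exact: (comm1_compact Hmu n0 alpha0 alphan p1 q1 r1 rE mK C0 HK Hb).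
apply: (compact_bilinear_swap (B' := comm1 nu (fun x y z => K x z y) b)).
  by move=> f g mf mg; exact: comm2_swap.
have rE' : r^-1 = q^-1 + p^-1 - alpha / n%:R by rewrite rE [q^-1 + _]addrC.
apply: (comm1_compact Hmu n0 alpha0 alphan q1 p1 r1 rE' _ C0 (frac_kernel_swap HK) Hb).
have ms : measurable_fun setT (fun t : Rn R n * (Rn R n * Rn R n) => (t.1, (t.2.2, t.2.1))).
  apply: measurable_fun_pair; first exact: measurable_fst.
  by apply: measurable_fun_pair; [exact: (measurableT_comp measurable_snd measurable_snd)
    |exact: (measurableT_comp measurable_fst measurable_snd)].
exact: (measurableT_comp mK ms).
Qed.
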